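(* Let $\mu_0,\mu_1$ be finite Borel measures on $\mathbb{C}$ with compact infinite supports $S_0,S_1$, such that $\mu_0\ge\mu_1$, and put $\mu_2:=\mu_0-\mu_1$. Let $\Omega$ be the unbounded component of $\overline{\mathbb{C}}\setminus S_1$. If $\mu_0$ is a polynomially small (PS) perturbation of $\mu_1$, then the following hold: (i) $\displaystyle\lim_{n\to\infty}\gamma_n(\mu_1)/\gamma_n(\mu_0)=1$; (ii) $\displaystyle\lim_{n\to\infty}\|p_n(\mu_1,\cdot)-p_n(\mu_0,\cdot)\|_{L^2(\mu_0)}=0$; (iii) uniformly on compact subsets of $\overline{\mathbb{C}}\setminus\mathrm{Co}(S_0)$ (and for $z\in\Omega$, provided $p_n(\mu_0,\cdot)$ does not vanish in $\mathrm{Co}(S_0)\cap\Omega$ for large $n\in\mathbb{N}$), $$\lim_{n\to\infty}\frac{p_n(\mu_1,z)}{p_n(\mu_0,z)}=1.$$ Furthermore, if $$\sum_{j=0}^\infty\|p_j(\mu_1,\cdot)\|_{L^2(\mu_2)}^2<\infty,$$ then $$\lim_{n\to\infty}\frac{\lambda_n(\mu_0,z)}{\lambda_n(\mu_1,z)}=1,$$ uniformly on compact subsets of $\Omega$.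
   Context: For a finite Borel measure $\mu$ on $\mathbb{C}$ with compact support, $\langle f,g\rangle_\mu=\int f\overline{g}\,d\mu$ and $\|f\|_{L^2(\mu)}=\sqrt{\langle f,f\rangle_\mu}$. If the support is infinite, $p_n(\mu,z)=\gamma_n(\mu)z^n+\cdots$, $\gamma_n(\mu)>0$, $n=0,1,2,\dots$, denote the orthonormal polynomials for this inner product. The Christoffel functions are $\lambda_n(\mu,z):=\inf\{\|P\|_{L^2(\mu)}^2: P\in\mathbb{P}_n,\ P(z)=1\}$ for $z\in\mathbb{C}$, where $\mathbb{P}_n$ is the space of complex polynomials of degree at most $n$. $\mathrm{Co}(E)$ is the convex hull of $E$. PS perturbation: $\mu_0=\mu_1+\mu_2$ is a polynomially small (PS) perturbation of $\mu_1$ if $\mu_2$ is not the zero measure and $\lim_{n\to\infty}\|p_n(\mu_1,\cdot)\|_{L^2(\mu_2)}=0$. *)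

(* Defs.v *)
From HB Require Import structures.
From mathcomp Require Import all_boot all_order all_algebra complex.
From mathcomp Require Import all_classical all_reals all_analysis.

Set Implicit Arguments.
Unset Strict Implicit.
Unset Printing Implicit Defensive.

Import Order.TTheory GRing.Theory Num.Theory.
Import numFieldNormedType.Exports.

Local Open Scope classical_set_scope.
Local Open Scope ring_scope.
Local Open Scope complex_scope.

(* The topology on the complex numbers R[i] is the one the library puts on
   the alias R[i]^o (the norm topology, R[i] being a numFieldType). *)
Notation borelC R := (g_sigma_algebraType (@open R[i]^o)).

Notation sphere R := (one_point_compactification R[i]^o).

Definition infty {R : realType} : sphere R := None.

Definition in_sphere {R : realType} (z : R[i]) : sphere R := Some z.

(* Extension of a function on the plane to the sphere, by its limit at the
   point at infinity. The value 0 below is irrelevant, since infty^' is the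
   filter of punctured neighbourhoods. *)
Definition extend_infty (R : realType) (K : numFieldType) (f : R[i] -> K)
    (w : sphere R) : K^o :=
  if w is Some z then f z
  else lim ((if v is Some z then f z else 0 : K^o) @[v --> infty^']).

Definition cvg_unif_compacts (R : realType) (K : numFieldType)
    (U : set (sphere R)) (f : nat -> sphere R -> K^o) (l : sphere R -> K^o) :=
  forall A : set (sphere R), compact A -> A `<=` U ->
    {uniform A, f @ \oo --> l}.

Definition unbounded_component (R : realType) (S : set R[i]^o) :
    set (sphere R) :=
  connected_component (~` (in_sphere @` S)) infty.

(* Real convexity: a scalar k : R[i] with 0 <= k <= 1 is a real number. *)
Definition convex_hull (R : realType) (E : set R[i]^o) : set R[i]^o :=
  smallest (@convex_set R[i] R[i]^o) E.

Definition measure_support (R : realType)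
    (mu : {measure set (borelC R) -> \bar R}) : set R[i]^o :=
  [set z | forall U : set R[i]^o, open_nbhs z U -> (0 < mu U)%E].

Section OrthogonalPolynomials.
Variables (R : realType) (mu : {measure set (borelC R) -> \bar R}).

Definition inner (f g : borelC R -> R[i]) : R[i] :=
  (\int[mu]_z complex.Re (f z * (g z)^*%C)) +i*
  (\int[mu]_z complex.Im (f z * (g z)^*%C)).

Definition L2norm (f : borelC R -> R[i]) : R :=
  Num.sqrt (complex.Re (inner f f)).

(* In R[i], 0 < c means that c is real and positive. *)
Definition orthonormal_polynomials (p : nat -> {poly R[i]}) :=
  (forall n, size (p n) = n.+1 /\ 0 < lead_coef (p n)) /\
  (forall m n, inner (horner (p m)) (horner (p n)) = (m == n)%:R).

(* The sequence (p_n(mu, .))_n; it exists and is unique when mu is a finite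
   measure whose support is compact and infinite. *)
Definition orthopoly : nat -> {poly R[i]} :=
  xget (fun=> 0) [set p | orthonormal_polynomials p].

Definition gamma (n : nat) : R[i] := lead_coef (orthopoly n).

Definition christoffel (n : nat) (z : R[i]) : R :=
  inf [set L2norm (horner P) ^+ 2 | P in
        [set P : {poly R[i]} | (size P <= n.+1)%N /\ P.[z] = 1]].

End OrthogonalPolynomials.

Definition PS_perturbation (R : realType)
    (mu0 mu1 mu2 : {measure set (borelC R) -> \bar R}) :=
  [/\ forall A, measurable A -> mu0 A = (mu1 A + mu2 A)%E,
      exists2 A, measurable A & mu2 A != 0%E &
      L2norm mu2 (horner (orthopoly mu1 n)) @[n --> \oo] --> (0 : R)].

(* Main.v *)
Require Import Defs.
From HB Require Import structures.
From mathcomp Require Import all_boot all_order all_algebra complex.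
From mathcomp Require Import all_classical all_reals all_analysis.
From mathcomp Require Import measurable_realfun ring lra.

(** Write [p] and [q] for the orthonormal polynomials of [mu1] and [mu0], and
[eps n] for the norm of [p n] in L2(mu2). Comparing leading coefficients,
[<p n, q n>_mu0 = gamma_n(mu1) / gamma_n(mu0)], a number between 1 and
[sqrt (1 + eps n ^ 2)]; expanding [||p n - q n||_mu0 ^ 2] gives (i) and (ii).

For [r] of degree at most [n], [(r(z) q_n(t) - r(t) q_n(z)) / (z - t)] is
orthogonal to [q_n] as a polynomial in [t], so that [r(z) / q_n(z)] is the quotient
of the Cauchy transforms of [r conj(q_n)] and of [|q_n|^2]. If a line separates [z]
from the support, the denominator is bounded below and [r = p_n - q_n] gives the
first half of (iii). In the component [Omega] the same identity for [mu1] writes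
[p_n / q_n] as a quotient [A_n / B_n] of bounded Cauchy transforms with
[A_n - B_n -> 0]. Along an ultrafilter some moment of [|p_n|^2 mu1] against the powers
of [1 / (t - z)] does not tend to 0: otherwise this would propagate over the connected
set [Omega] to infinity, where [A_n(z)] is of order [1 / z]. The first such moment bounds
[A_n] from below on a small circle around [z], and the maximum principle for the
pole-free rational function [(p_n - q_n) / q_n] concludes.

For the Christoffel functions, with [K_n] the reproducing kernel of [mu1], the
extremal polynomial of [mu1] shows that the ratio lies between 1 and
[1 + ||K_n(., z)||_mu2 ^ 2 / K_n(z, z)]. The first [N] terms of the kernel become
negligible because [K_n(z, z)] grows without bound, by a polynomial equal to 1 at [z] and
small on the support of [mu1] (Runge); the remaining ones are controlled by the tail of
the convergent series. *)

Set Implicit Arguments.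
Unset Strict Implicit.
Unset Printing Implicit Defensive.

Import Order.TTheory GRing.Theory Num.Theory.
Import numFieldNormedType.Exports.
Import Normc.

Local Open Scope classical_set_scope.
Local Open Scope ring_scope.
Local Open Scope complex_scope.

(** * The complex plane *)

(** Outside the hull the Cauchy transform of [|q_n|^2 mu0] has a definite sign in some direction. In
    [Omega] no line separates, and that of [|p_n|^2 mu1] may vanish at the given point or become
    small there along a subsequence, so a pointwise lower bound uniform in [n] is out of reach. What
    survives is that a weak limit of these probability measures has a Cauchy transform not
    identically zero on [Omega], hence with isolated zeros. The ultrafilter replaces the extraction
    of the limit, the moments are its Taylor coefficients up to sign, and the propagation to
    infinity is the identity theorem. A zero at the centre does no harm: the estimate is made on a
    circle, and the assumption on the zeros of [q_n] lets the maximum principle fill the disc. No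
    theory of analytic functions is used: the maximum principle rests on a factorisation and an
    [m]-th root, while Runge's theorem and the identity theorem share one step, the re-expansion of
    a resolvent at a nearby point. Integrands are continuous on the whole plane, hence integrable;
    estimates are asked only on a compact carrier. *)

Section Modulus.
Variable R : realType.
Implicit Types (z w : R[i]) (r : R).

Lemma complex_eq z w : complex.Re z = complex.Re w ->
  complex.Im z = complex.Im w -> z = w.
Proof. by case: z => a b; case: w => c d /= -> ->. Qed.

Lemma ReD z w : complex.Re (z + w) = complex.Re z + complex.Re w.
Proof. by case: z => a b; case: w. Qed.

Lemma ImD z w : complex.Im (z + w) = complex.Im z + complex.Im w.
Proof. by case: z => a b; case: w. Qed.

Lemma ReN z : complex.Re (- z) = - complex.Re z.
Proof. by case: z. Qed.

Lemma ImN z : complex.Im (- z) = - complex.Im z.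
Proof. by case: z. Qed.

Lemma ReM z w : complex.Re (z * w) =
  complex.Re z * complex.Re w - complex.Im z * complex.Im w.
Proof. by case: z => a b; case: w. Qed.

Lemma ImM z w : complex.Im (z * w) =
  complex.Re z * complex.Im w + complex.Im z * complex.Re w.
Proof. by case: z => a b; case: w => c d /=. Qed.

Lemma Re_conj z : complex.Re z^*%C = complex.Re z.
Proof. by case: z. Qed.

Lemma Im_conj z : complex.Im z^*%C = - complex.Im z.
Proof. by case: z. Qed.

Definition ReImE := (ReD, ImD, ReN, ImN, ReM, ImM, Re_conj, Im_conj).

Lemma normc_ge0 z : 0 <= normc z.
Proof. by case: z => a b; exact: sqrtr_ge0. Qed.

Lemma sqr_normcE z : normc z ^+ 2 = complex.Re z ^+ 2 + complex.Im z ^+ 2.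
Proof. by case: z => a b; rewrite sqr_sqrtr // addr_ge0 ?sqr_ge0. Qed.

Lemma normc_le_add z w : normc (z + w) <= normc z + normc w.
Proof. exact: (@le_normcD R). Qed.

Lemma normc_opp z : normc (- z) = normc z.
Proof. exact: (@normcN R). Qed.

Lemma normc_distC z w : normc (z - w) = normc (w - z).
Proof. by rewrite -normc_opp opprB. Qed.

Lemma normc_le_sub z w : normc z - normc w <= normc (z - w).
Proof. by rewrite lerBlDr -{1}[z](subrK w); exact: normc_le_add. Qed.

Lemma normcX z n : normc (z ^+ n) = normc z ^+ n.
Proof. by elim: n => [|n IH]; rewrite ?expr0 ?normc1// !exprS normcM IH. Qed.

Lemma normc_conj z : normc z^*%C = normc z.
Proof. by case: z => a b /=; rewrite sqrrN. Qed.

Lemma normc_real r : normc r%:C = `|r|.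
Proof. by rewrite /= expr0n /= addr0 sqrtr_sqr. Qed.

Lemma normc_eq0 z : (normc z == 0) = (z == 0).
Proof. by apply/eqP/eqP => [/eq0_normc //|->]; exact: normc0. Qed.

Lemma normc_gt0 z : (0 < normc z) = (z != 0).
Proof. by rewrite lt_neqAle normc_ge0 andbT eq_sym normc_eq0. Qed.

Lemma normc_le2 z r : 0 <= r -> (normc z <= r) = (normc z ^+ 2 <= r ^+ 2).
Proof. by move=> r0; rewrite ler_pXn2r// nnegrE ?normc_ge0. Qed.

Lemma Re_le_normc z : complex.Re z <= normc z.
Proof.
apply: le_trans (ler_norm _) _.
rewrite -(@ler_pXn2r _ 2)// ?nnegrE ?normc_ge0// sqr_normcE real_normK ?num_real//.
by rewrite lerDl sqr_ge0.
Qed.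

Lemma normRe_le z : `|complex.Re z| <= normc z.
Proof. by rewrite ler_norml Re_le_normc andbT lerNl -ReN -normc_opp Re_le_normc. Qed.

Lemma normIm_le z : `|complex.Im z| <= normc z.
Proof.
rewrite -(@ler_pXn2r _ 2)// ?nnegrE ?normc_ge0// sqr_normcE real_normK ?num_real//.
by rewrite lerDr sqr_ge0.
Qed.

Lemma normc_le_ReIm z : normc z <= `|complex.Re z| + `|complex.Im z|.
Proof.
rewrite normc_le2 ?addr_ge0// sqr_normcE -[complex.Re z ^+ 2]real_normK ?num_real//.
rewrite -[complex.Im z ^+ 2]real_normK ?num_real//.
by rewrite sqrrD -addrA [X in _ <= _ + X]addrC addrA lerDl mulrn_wge0// mulr_ge0.
Qed.

Lemma mulc_conj z : z * z^*%C = (normc z ^+ 2)%:C.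
Proof. by apply: complex_eq; rewrite sqr_normcE !ReImE /=; ring. Qed.

Lemma normcE z : `|z| = (normc z)%:C.
Proof. by []. Qed.

Lemma normc_sum (I : Type) (s : seq I) (P : pred I) (F : I -> R[i]) :
  normc (\sum_(i <- s | P i) F i) <= \sum_(i <- s | P i) normc (F i).
Proof.
elim/big_ind2 : _ => [|x1 x2 y1 y2 h1 h2|//]; first by rewrite normc0.
by apply: le_trans (normc_le_add _ _) _; exact: lerD.
Qed.

Lemma Re_mulc_real z r : complex.Re (z * r%:C) = complex.Re z * r.
Proof. by case: z => a b; rewrite ReM /= mulr0 subr0. Qed.

Lemma conjcM z w : (z * w)^*%C = z^*%C * w^*%C.
Proof. exact: rmorphM. Qed.

Lemma conjc_sum (I : Type) (s : seq I) (P : pred I) (F : I -> R[i]) :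
  (\sum_(i <- s | P i) F i)^*%C = \sum_(i <- s | P i) (F i)^*%C.
Proof. exact: rmorph_sum. Qed.

(** Take [u = conj z / |z|]: its half-plane separates [z] from every disc centred at 0 of smaller
    radius than [|z|]. This is the separating line used for points near infinity. *)
Lemma normc_direction z : z != 0 -> exists2 u, normc u <= 1 &
  forall r w, normc w <= r -> normc z - r <= complex.Re (u * (z - w)).
Proof.
rewrite -normc_gt0 => z0; pose u := z^*%C * (normc z)^-1%:C.
have u1 : normc u = 1.
  rewrite normcM normc_conj normc_real ger0_norm ?invr_ge0 ?normc_ge0//.
  by rewrite divff ?gt_eqF.
exists u => [|r w wr]; first by rewrite u1.
have -> : u * (z - w) = (normc z)%:C - u * w.
  rewrite mulrBr; congr (_ - _).
  by rewrite /u mulrAC [_ * z]mulrC mulc_conj -rmorphM /= expr2 mulfK// gt_eqF.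
rewrite ReD ReN /= lerD2l lerN2; apply: le_trans (Re_le_normc _) _.
by rewrite normcM u1 mul1r.
Qed.

End Modulus.

(** * Topology of the plane through the real-valued modulus *)

Section PlaneTopology.
Variable R : realType.
Implicit Types (z w : R[i]^o) (A : set R[i]^o).

Lemma nbhs_complexP z A :
  nbhs z A <-> exists2 e : R, 0 < e & forall v, normc (v - z) < e -> A v.
Proof.
split.
  move=> /nbhs_ballP[[e e'] /=]; rewrite ltcE /= => /andP[/eqP -> e0] eA.
  exists e => // v vz; apply: eA; rewrite /ball/= normcE -[v]/(v : R[i]).
  by rewrite normc_distC ltcR.
move=> [e e0 eA]; apply/nbhs_ballP; exists e%:C; first by rewrite /= ltcR.
by move=> v; rewrite /ball/= normcE ltcR normc_distC => /eA.
Qed.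

Lemma near_complex z (e : R) : 0 < e -> \forall v \near z, normc (v - z) < e.
Proof. by move=> e0; apply/nbhs_complexP; exists e. Qed.

Lemma cvg_complexP T (F : set_system T) (f : T -> R[i]^o) z : Filter F ->
  f @ F --> z <-> (forall e : R, 0 < e -> \forall t \near F, normc (f t - z) < e).
Proof.
move=> FF; split => [fz e e0|H A /nbhs_complexP[e e0 eA]].
  exact: (fz _ (near_complex z e0)).
by apply: filterS (H _ e0) => t; exact: eA.
Qed.

Lemma continuous_lipschitz (f : R[i]^o -> R) :
  (forall z w, `|f z - f w| <= normc (z - w)) -> continuous f.
Proof.
move=> H z; apply/(@cvgrPdist_lt _ _ _ (nbhs z) _ f) => e e0; apply: filterS (near_complex z e0) => v.
by apply: le_lt_trans; rewrite normc_distC.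
Qed.

Lemma continuous_Re : continuous (@complex.Re R : R[i]^o -> R).
Proof.
by apply: continuous_lipschitz => z w; rewrite -ReN -ReD normRe_le.
Qed.

Lemma continuous_Im : continuous (@complex.Im R : R[i]^o -> R).
Proof.
by apply: continuous_lipschitz => z w; rewrite -ImN -ImD normIm_le.
Qed.

Lemma continuous_normc : continuous (@normc R : R[i]^o -> R).
Proof.
apply: continuous_lipschitz => z w; rewrite ler_norml normc_le_sub andbT.
by rewrite lerNl opprB normc_distC normc_le_sub.
Qed.

Lemma continuous_complex (T : topologicalType) (f : T -> R[i]^o) :
  continuous (fun t => complex.Re (f t)) ->
  continuous (fun t => complex.Im (f t)) -> continuous f.
Proof.
move=> /= fr fi t; apply/cvg_complexP => e e0.
have e2 : 0 < e / 2 by rewrite divr_gt0.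
have /cvgrPdist_lt/(_ _ e2) A := fr t.
have /cvgrPdist_lt/(_ _ e2) B := fi t.
apply: filterS2 A B => s A B; apply: le_lt_trans (normc_le_ReIm _) _.
by rewrite !ReImE [e]splitr ltrD// distrC.
Qed.

Lemma continuous_conj : continuous (@conjc R : R[i]^o -> R[i]^o).
Proof.
apply: continuous_complex.
  rewrite (_ : (fun t => _) = (@complex.Re R : R[i]^o -> R)).
    exact: continuous_Re.
  by apply/funext => t; rewrite Re_conj.
rewrite (_ : (fun t => _) = (fun t : R[i]^o => - complex.Im t)).
  by move=> z; apply: (@cvgN _ _ _ (nbhs z) _ (@complex.Im R : R[i]^o -> R) _ (@continuous_Im z)).
by apply/funext => t; rewrite Im_conj.
Qed.

Lemma continuous_real_complex (T : topologicalType) (f : T -> R) :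
  continuous f -> continuous (fun t => (f t)%:C : R[i]^o).
Proof. by move=> cf; apply: continuous_complex => //= t; exact: cvg_cst. Qed.

Lemma continuous_mulc (T : topologicalType) (f g : T -> R[i]^o) :
  continuous f -> continuous g -> continuous (fun t => f t * g t : R[i]^o).
Proof. by move=> cf cg t; exact: (cvgM (cf t) (cg t)). Qed.

Lemma continuous_addc (T : topologicalType) (f g : T -> R[i]^o) :
  continuous f -> continuous g -> continuous (fun t => f t + g t : R[i]^o).
Proof. by move=> cf cg t; exact: (cvgD (cf t) (cg t)). Qed.

Lemma continuous_horner (p : {poly R[i]}) :
  continuous (horner p : R[i]^o -> R[i]^o).
Proof.
elim/poly_ind: p => [|p c IH].
  rewrite (_ : horner 0 = cst 0); last by apply/funext => z; rewrite horner0.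
  exact: cst_continuous.
rewrite (_ : horner _ = fun z => p.[z] * z + c); last first.
  by apply/funext => z; rewrite hornerMXaddC.
apply: continuous_addc; last exact: cst_continuous.
by apply: continuous_mulc; [exact: IH|move=> z; exact: cvg_id].
Qed.

Lemma compact_normc_bounded A : compact A ->
  exists2 M : R, 0 < M & forall z, A z -> normc z <= M.
Proof.
move=> cA; have [A0|/set0P A0] := eqVneq A set0.
  by exists 1 => // z; rewrite A0.
have cN : {within A, continuous (@normc R : R[i]^o -> R)}.
  exact: continuous_subspaceT continuous_normc.
have [c cAc H] := compact_EVT_max A0 cA cN.
exists (1 + normc c); first by rewrite ltr_pwDl ?normc_ge0.
by move=> z Az; rewrite (le_trans (H _ (mem_set Az)))// lerDr.
Qed.

Lemma continuous_dist z : continuous (fun v : R[i]^o => normc (v - z)).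
Proof.
apply: continuous_lipschitz => v w; rewrite ler_norml lerNl opprB.
have E (x y : R[i]) : normc (x - z) - normc (y - z) <= normc (x - y).
  by rewrite -{2}(subrK z x) -addrA -[z - y]opprB; exact: normc_le_sub.
by apply/andP; split; [rewrite [normc (v - w)]normc_distC|]; exact: E.
Qed.

Lemma closed_disc z (r : R) : closed [set v : R[i]^o | normc (v - z) <= r].
Proof.
have -> : [set v : R[i]^o | normc (v - z) <= r] =
    (fun v : R[i]^o => normc (v - z)) @^-1` [set x | x <= r] by [].
apply: closed_comp; last exact: closed_le.
by move=> v _; exact: continuous_dist.
Qed.

Lemma compact_disc z (r : R) : compact [set v : R[i]^o | normc (v - z) <= r].
Proof.
pose f (x : R * R) : R[i]^o := x.1 +i* x.2.
pose B : set (R * R) := `[complex.Re z - r, complex.Re z + r] `*`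
  `[complex.Im z - r, complex.Im z + r].
apply: (@subclosed_compact _ _ (f @` B)).
- exact: closed_disc.
- apply: continuous_compact; last first.
    by apply: compact_setX; exact: segment_compact.
  apply: continuous_subspaceT; apply: continuous_complex => x /=.
    exact: cvg_fst.
  exact: cvg_snd.
- move=> [a b] /= h; exists (a, b) => //=.
  have := le_trans (normRe_le _) h; have := le_trans (normIm_le _) h.
  rewrite !ReImE /= !ler_distl => hI hR.
  by split; rewrite /= in_itv.
Qed.

End PlaneTopology.

(** * Integrals of continuous functions *)

Lemma sqr_le_discriminant (R : realFieldType) (a b x : R) : 0 <= b ->
  (forall t, 2 * t * x <= a + t ^+ 2 * b) -> x ^+ 2 <= a * b.
Proof.
move=> b0 key; have [b_eq0|bn0] := eqVneq b 0.
  rewrite b_eq0 mulr0; have [->|xn0] := eqVneq x 0; first by rewrite expr0n.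
  (* With [b = 0] the hypothesis is affine in [t]; this [t] would give [a + 1 <= a]. *)
  have := key ((a + 1) / (2 * x)); rewrite b_eq0 mulr0.
  have -> : 2 * ((a + 1) / (2 * x)) * x = a + 1 by field.
  by move=> h; exfalso; lra.
have b_gt0 : 0 < b by rewrite lt_neqAle eq_sym bn0.
have := key (x / b).
have -> : 2 * (x / b) * x = x ^+ 2 / b + x ^+ 2 / b by field.
have -> : a + (x / b) ^+ 2 * b = a + x ^+ 2 / b by field.
by rewrite lerD2r ler_pdivrMr.
Qed.

Lemma sum_Cauchy_Schwarz (R : realFieldType) (I : Type) (s : seq I) (u v : I -> R) :
  (\sum_(i <- s) u i * v i) ^+ 2 <=
  (\sum_(i <- s) u i ^+ 2) * (\sum_(i <- s) v i ^+ 2).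
Proof.
apply: sqr_le_discriminant; first by apply: sumr_ge0 => i _; exact: sqr_ge0.
move=> t; rewrite !mulr_sumr -big_split /=; apply: ler_sum => i _.
rewrite -subr_ge0 (_ : _ - _ = (u i - t * v i) ^+ 2) ?sqr_ge0//; ring.
Qed.

Section Integrals.
Variable R : realType.

(* One-constructor types rather than definitions: closing tactics would unfold
   continuity into filters. *)
Variant ccont (f : R[i] -> R[i]) : Prop :=
  CCont of continuous (f : R[i]^o -> R[i]^o).
Variant rcont (f : R[i] -> R) : Prop := RCont of continuous (f : R[i]^o -> R).

Lemma ccont_cst c : ccont (fun=> c).
Proof. by split; exact: cst_continuous. Qed.

Lemma ccont_id : ccont id.
Proof. by split => z; exact: cvg_id. Qed.

Lemma ccont_horner p : ccont (horner p).
Proof. by split; exact: continuous_horner. Qed.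

Lemma ccontM f g : ccont f -> ccont g -> ccont (fun z => f z * g z).
Proof. by move=> [cf] [cg]; split; exact: (continuous_mulc cf cg). Qed.

Lemma ccontD f g : ccont f -> ccont g -> ccont (fun z => f z + g z).
Proof. by move=> [cf] [cg]; split; exact: (continuous_addc cf cg). Qed.

Lemma ccontB f g : ccont f -> ccont g -> ccont (fun z => f z - g z).
Proof.
move=> cf cg; rewrite (_ : (fun z => _) = fun z => f z + -1 * g z).
  exact: (ccontD cf (ccontM (ccont_cst _) cg)).
by apply/funext => z; rewrite mulN1r.
Qed.

Lemma ccont_conj f : ccont f -> ccont (fun z => (f z)^*%C).
Proof.
move=> [cf]; split => z.
exact: continuous_comp (cf z) (@continuous_conj R _).
Qed.

Lemma ccont_real f : rcont f -> ccont (fun z => (f z)%:C).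
Proof. by move=> [cf]; split; exact: (continuous_real_complex cf). Qed.

Lemma rcont_Re f : ccont f -> rcont (fun z => complex.Re (f z)).
Proof.
by move=> [cf]; split => z; exact: continuous_comp (cf z) (@continuous_Re R _).
Qed.

Lemma rcont_Im f : ccont f -> rcont (fun z => complex.Im (f z)).
Proof.
by move=> [cf]; split => z; exact: continuous_comp (cf z) (@continuous_Im R _).
Qed.

Lemma rcont_normc f : ccont f -> rcont (fun z => normc (f z)).
Proof.
move=> [cf]; split => z.
exact: continuous_comp (cf z) (@continuous_normc R _).
Qed.

Lemma rcontM f g : rcont f -> rcont g -> rcont (fun z => f z * g z).
Proof. by move=> [cf] [cg]; split => z; exact: (cvgM (cf z) (cg z)). Qed.

Lemma rcontD f g : rcont f -> rcont g -> rcont (fun z => f z + g z).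
Proof. by move=> [cf] [cg]; split => z; exact: (cvgD (cf z) (cg z)). Qed.

Lemma rcont_cst c : rcont (fun=> c).
Proof. by split; exact: cst_continuous. Qed.

Lemma rcontX f n : rcont f -> rcont (fun z => f z ^+ n).
Proof.
move=> cf; elim: n => [|n IH]; first exact: rcont_cst.
rewrite (_ : (fun z => _) = fun z => f z * f z ^+ n); first exact: rcontM.
by apply/funext => z; rewrite exprS.
Qed.

Lemma measurable_open_plane (U : set R[i]^o) :
  open U -> measurable (U : set (borelC R)).
Proof. by move=> oU; apply: sub_sigma_algebra. Qed.

Lemma measurable_rcont f : rcont f -> measurable_fun setT (f : borelC R -> R).
Proof.
move=> [cf]; apply: (measurability _ (RGenOInfty.measurableE R)).
move=> /= _ [_ [a ->]] <-; rewrite setTI; apply: measurable_open_plane.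
by move/continuousP : cf; apply; exact: interval_open.
Qed.

(** Weaker than being the support: one compact set can then carry several measures, as the support
    of [mu0] does for [mu0], [mu1] and [mu2]. *)
Definition carried (mu : {measure set (borelC R) -> \bar R}) (K : set R[i]^o) :=
  compact K /\ mu (~` K) = 0%E.

Variables (mu : {finite_measure set (borelC R) -> \bar R}) (K : set R[i]^o).
Hypothesis muK : carried mu K.

Lemma measurable_carrier : measurable (~` K : set (borelC R)).
Proof.
apply: measurable_open_plane; rewrite openC; apply: compact_closed.
  exact: norm_hausdorff.
by case: muK.
Qed.

Lemma integrable_rcont f : rcont f -> mu.-integrable setT (EFin \o f).
Proof.
move=> cf; have mf := measurable_rcont cf.
have mEf : measurable_fun setT (EFin \o f : borelC R -> \bar R).
  exact/measurable_EFinP.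
have mK := measurable_carrier.
have mK' : measurable (K : set (borelC R)) by rewrite -(setCK K); exact: measurableC.
apply/(negligible_integrable mK) => //; first exact: muK.2.
rewrite setTD setCK; apply: measurable_bounded_integrable => //.
- by rewrite ltey_eq fin_num_measure.
- by apply: measurable_funTS.
have [K0|/set0P K0] := eqVneq K set0.
  by exists 0; split => // x _ z /=; rewrite K0.
have cN : {within K, continuous (fun z : R[i]^o => `|f z|)}.
  apply: continuous_subspaceT => z.
  by case: cf => cf; apply: continuous_comp; [exact: cf|exact: norm_continuous].
have [c cAc H] := compact_EVT_max K0 muK.1 cN.
exists `|f c|; split; first exact: num_real.
by move=> x lx z Kz /=; rewrite (le_trans (H _ (mem_set Kz)))// ltW.
Qed.

Lemma Rint_restrict f : rcont f -> \int[mu]_z f z = \int[mu]_(z in K) f z.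
Proof.
move=> cf; rewrite /Rintegral (@negligible_integral _ _ _ mu setT (~` K))//.
- by rewrite setTD setCK.
- exact: measurable_carrier.
- exact: integrable_rcont.
- exact: muK.2.
Qed.

Lemma Rint_le f g : rcont f -> rcont g -> (forall z, K z -> f z <= g z) ->
  \int[mu]_z f z <= \int[mu]_z g z.
Proof.
move=> cf cg fg; rewrite !Rint_restrict//.
have mK : measurable (K : set (borelC R)).
  by rewrite -(setCK K); apply: measurableC; exact: measurable_carrier.
by apply: le_Rintegral => //; apply: integrableS (integrable_rcont _).
Qed.

Lemma Rint_ge0 f : rcont f -> (forall z, K z -> 0 <= f z) ->
  0 <= \int[mu]_z f z.
Proof. by move=> cf f0; rewrite Rint_restrict//; exact: Rintegral_ge0. Qed.

Lemma RintD f g : rcont f -> rcont g ->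
  \int[mu]_z (f z + g z) = \int[mu]_z f z + \int[mu]_z g z.
Proof. by move=> cf cg; rewrite RintegralD//; exact: integrable_rcont. Qed.

Lemma RintB f g : rcont f -> rcont g ->
  \int[mu]_z (f z - g z) = \int[mu]_z f z - \int[mu]_z g z.
Proof. by move=> cf cg; rewrite RintegralB//; exact: integrable_rcont. Qed.

Lemma RintZ f c : rcont f -> \int[mu]_z (c * f z) = c * \int[mu]_z f z.
Proof. by move=> cf; rewrite RintegralZl//; exact: integrable_rcont. Qed.

End Integrals.

(** * Complex integrals and the geometry of L2(mu) *)

Section ComplexIntegral.
Variables (R : realType) (mu : {finite_measure set (borelC R) -> \bar R}).
Variable K : set R[i]^o.
Hypothesis muK : carried mu K.
Implicit Types f g h : R[i] -> R[i].

Definition cint (m : {measure set (borelC R) -> \bar R}) (f : R[i] -> R[i]) : R[i] :=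
  (\int[m]_z complex.Re (f z)) +i* (\int[m]_z complex.Im (f z)).

Definition sqnorm (m : {measure set (borelC R) -> \bar R}) (f : R[i] -> R[i]) : R :=
  \int[m]_z (normc (f z) ^+ 2).

Lemma innerE f g : inner mu f g = cint mu (fun z => f z * (g z)^*%C).
Proof. by []. Qed.

Lemma inner_sqnorm f : inner mu f f = (sqnorm mu f)%:C.
Proof.
rewrite /inner /sqnorm; apply: complex_eq => /=; last first.
  rewrite (_ : (fun z => _) = cst 0) ?Rintegral_cst ?mul0r//.
  by apply/funext => z /=; rewrite !ReImE; ring.
by congr Rintegral; apply/funext => z; rewrite mulc_conj.
Qed.

Lemma sqnorm_ge0 f : 0 <= sqnorm mu f.
Proof. by apply: Rintegral_ge0 => z _; rewrite sqr_ge0. Qed.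

Lemma L2normE f : L2norm mu f = Num.sqrt (sqnorm mu f).
Proof. by rewrite /L2norm inner_sqnorm. Qed.

Lemma sqr_L2norm f : L2norm mu f ^+ 2 = sqnorm mu f.
Proof. by rewrite L2normE sqr_sqrtr ?sqnorm_ge0. Qed.

Lemma L2norm_ge0 f : 0 <= L2norm mu f.
Proof. by rewrite L2normE sqrtr_ge0. Qed.

Lemma eq_cint f g : f =1 g -> cint mu f = cint mu g.
Proof. by move=> /funext ->. Qed.

Lemma cintD f g : ccont f -> ccont g ->
  cint mu (fun z => f z + g z) = cint mu f + cint mu g.
Proof.
move=> cf cg; apply: complex_eq; rewrite !ReImE /=.
  by rewrite -(RintD muK); [|exact: rcont_Re..]; congr Rintegral;
    apply/funext => z; rewrite ReD.
by rewrite -(RintD muK); [|exact: rcont_Im..]; congr Rintegral;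
  apply/funext => z; rewrite ImD.
Qed.

Lemma cintZ c f : ccont f -> cint mu (fun z => c * f z) = c * cint mu f.
Proof.
move=> cf; have fR := rcont_Re cf; have fI := rcont_Im cf.
have cM r u : rcont u -> rcont (fun z : R[i] => r * u z).
  by move=> cu; apply: rcontM => //; exact: rcont_cst.
apply: complex_eq; rewrite !ReImE /=.
  rewrite -!(RintZ muK)// -(RintB muK); [|exact: cM..].
  by congr Rintegral; apply/funext => z; rewrite ReM.
rewrite -!(RintZ muK)// -(RintD muK); [|exact: cM..].
by congr Rintegral; apply/funext => z; rewrite ImM.
Qed.

Lemma cintB f g : ccont f -> ccont g ->
  cint mu (fun z => f z - g z) = cint mu f - cint mu g.
Proof.
move=> cf cg.
have cNg : ccont (fun z => -1 * g z) by apply: ccontM cg; exact: ccont_cst.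
have := cintD cf cNg; rewrite (cintZ (-1) cg) mulN1r => <-.
by apply: eq_cint => z; rewrite mulN1r.
Qed.

Lemma cint_sum (I : Type) (s : seq I) (F : I -> R[i] -> R[i]) :
  (forall i, ccont (F i)) ->
  cint mu (fun z => \sum_(i <- s) F i z) = \sum_(i <- s) cint mu (F i).
Proof.
move=> cF; elim: s => [|i s IH].
  rewrite big_nil; have := cintZ 0 (@ccont_cst R 0); rewrite (mul0r (cint _ _)) => h; rewrite -[RHS]h.
  by apply: eq_cint => z; rewrite big_nil mul0r.
rewrite big_cons -IH -cintD//; first by apply: eq_cint => z; rewrite big_cons.
elim: s {IH} => [|j s IH].
  rewrite (_ : (fun z => _) = fun=> 0); first exact: ccont_cst.
  by apply/funext => z; rewrite big_nil.
rewrite (_ : (fun z => _) = fun z => F j z + \sum_(j <- s) F j z).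
  exact: (ccontD (cF j) IH).
by apply/funext => z; rewrite big_cons.
Qed.

(* Rotating the integral onto the positive axis reduces to real integrands. *)
Lemma normc_cint f : ccont f -> normc (cint mu f) <= \int[mu]_z normc (f z).
Proof.
move=> cf; set I := cint mu f.
have [->|I0] := eqVneq I 0.
  rewrite normc0; apply: (Rint_ge0 muK); first exact: rcont_normc.
  by move=> z _; exact: normc_ge0.
pose u : R[i] := I^*%C / (normc I)%:C.
have nI0 : (normc I)%:C != 0 :> R[i].
  by apply/eqP => /complexI /eqP; rewrite normc_eq0 (negbTE I0).
have nu : normc u = 1.
  rewrite normcM normcV normc_conj normc_real ger0_norm ?normc_ge0//.
  by rewrite divff// normc_eq0.
have <- : complex.Re (u * I) = normc I.
  have -> : u * I = (normc I)%:C.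
    by rewrite /u mulrAC [_ * I]mulrC mulc_conj rmorphXn /= expr2 mulfK.
  by [].
have cuf : ccont (fun z => u * f z) by exact: (ccontM (ccont_cst u) cf).
rewrite /I -(cintZ u cf).
apply: (Rint_le muK (rcont_Re cuf) (rcont_normc cf)) => z _.
by apply: le_trans (Re_le_normc _) _; rewrite normcM nu mul1r.
Qed.

(** The weight [h] is there for Cauchy kernels, which are bounded by [1 / d] on the carrier; [h = 1]
    gives the usual inequality. *)
Lemma Cauchy_Schwarz (f g h : R[i] -> R[i]) B : 0 <= B ->
  ccont f -> ccont g -> ccont h -> (forall z, K z -> normc (h z) <= B) ->
  normc (cint mu (fun z => h z * (f z * (g z)^*%C))) <=
  B * (L2norm mu f * L2norm mu g).
Proof.
move=> B0 cf cg ch hB.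
have cfg : ccont (fun z => f z * (g z)^*%C) by exact: (ccontM cf (ccont_conj cg)).
have chfg := ccontM ch cfg.
apply: le_trans (normc_cint chfg) _.
have rf := rcont_normc cf; have rg := rcont_normc cg.
have rfg := rcontM rf rg.
apply: (@le_trans _ _ (\int[mu]_z (B * (normc (f z) * normc (g z))))).
  apply: (Rint_le muK (rcont_normc chfg) (rcontM (rcont_cst B) rfg)) => z Kz.
  rewrite !normcM normc_conj ler_wpM2r ?mulr_ge0 ?normc_ge0//.
  exact: hB.
rewrite (RintZ muK _ rfg).
apply: ler_wpM2l => //.
set J := (X in X <= _).
have rf2 := rcontX 2 rf; have rg2 := rcontX 2 rg.
(* This is the nonnegativity of the integral of [(|f| - t |g|)^2]. *)
have key t : 2 * t * J <= sqnorm mu f + t ^+ 2 * sqnorm mu g.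
  have rtg := rcontM (rcont_cst (t ^+ 2)) rg2.
  rewrite -(RintZ muK _ rfg) -(RintZ muK _ rg2) -(RintD muK rf2 rtg).
  apply: (Rint_le muK (rcontM (rcont_cst (2 * t)) rfg) (rcontD rf2 rtg)) => z _.
  rewrite -subr_ge0.
  have -> : normc (f z) ^+ 2 + t ^+ 2 * normc (g z) ^+ 2 -
    2 * t * (normc (f z) * normc (g z)) = (normc (f z) - t * normc (g z)) ^+ 2.
    by ring.
  exact: sqr_ge0.
have J0 : 0 <= J.
  by apply: Rintegral_ge0 => z _; rewrite mulr_ge0 ?normc_ge0.
rewrite -(@ler_pXn2r _ 2)// ?nnegrE ?mulr_ge0 ?L2norm_ge0//.
by rewrite exprMn !sqr_L2norm; apply: sqr_le_discriminant; rewrite ?sqnorm_ge0.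
Qed.

Lemma inner_Cauchy_Schwarz f g : ccont f -> ccont g ->
  normc (inner mu f g) <= L2norm mu f * L2norm mu g.
Proof.
move=> cf cg; rewrite -[leRHS]mul1r.
have := @Cauchy_Schwarz f g (fun=> 1) 1 ler01 cf cg (ccont_cst 1).
rewrite innerE; under [cint mu _]eq_cint do rewrite mul1r.
by apply => z _; rewrite normc1.
Qed.

Lemma inner_conj f g : ccont f -> ccont g -> inner mu g f = (inner mu f g)^*%C.
Proof.
move=> cf cg; rewrite !innerE; apply: complex_eq; rewrite !ReImE /=.
  by congr Rintegral; apply/funext => z; rewrite !ReImE; ring.
rewrite -mulN1r -(RintZ muK _ (rcont_Im (ccontM cf (ccont_conj cg)))).
by congr Rintegral; apply/funext => z; rewrite !ReImE; ring.
Qed.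

Lemma innerDl f g h : ccont f -> ccont g -> ccont h ->
  inner mu (fun z => f z + g z) h = inner mu f h + inner mu g h.
Proof.
move=> cf cg /ccont_conj ch; rewrite !innerE -(cintD (ccontM cf ch) (ccontM cg ch)).
by apply: eq_cint => z; rewrite mulrDl.
Qed.

Lemma innerZl c f g : ccont f -> ccont g ->
  inner mu (fun z => c * f z) g = c * inner mu f g.
Proof.
move=> cf /ccont_conj cg; rewrite !innerE -(cintZ _ (ccontM cf cg)).
by apply: eq_cint => z; rewrite mulrA.
Qed.

Lemma sqnormD f g : ccont f -> ccont g ->
  sqnorm mu (fun z => f z + g z) =
  sqnorm mu f + 2 * complex.Re (inner mu f g) + sqnorm mu g.
Proof.
move=> cf cg; have cfg := ccontM cf (ccont_conj cg).
have rf := rcontX 2 (rcont_normc cf); have rg := rcontX 2 (rcont_normc cg).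
have rfg := rcontM (rcont_cst 2) (rcont_Re cfg).
rewrite /sqnorm /inner /= -(RintZ muK _ (rcont_Re cfg)) -(RintD muK rf rfg).
rewrite -(RintD muK (rcontD rf rfg) rg).
by congr Rintegral; apply/funext => z; rewrite !sqr_normcE !ReImE; ring.
Qed.

Lemma L2norm_triangle f g : ccont f -> ccont g ->
  L2norm mu (fun z => f z + g z) <= L2norm mu f + L2norm mu g.
Proof.
move=> cf cg; rewrite -(@ler_pXn2r _ 2)// ?nnegrE ?addr_ge0 ?L2norm_ge0//.
rewrite sqr_L2norm sqnormD// -!sqr_L2norm.
have := le_trans (Re_le_normc _) (inner_Cauchy_Schwarz cf cg).
by move=> h; rewrite sqrrD lerD2r lerD2l -[leRHS]mulr_natl ler_pM2l.
Qed.

Lemma sqnormZ c f : ccont f ->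
  sqnorm mu (fun z => c * f z) = normc c ^+ 2 * sqnorm mu f.
Proof.
move=> cf; rewrite -(RintZ muK _ (rcontX 2 (rcont_normc cf))).
by congr Rintegral; apply/funext => z; rewrite normcM exprMn.
Qed.

Lemma L2normZ c f : ccont f ->
  L2norm mu (fun z => c * f z) = normc c * L2norm mu f.
Proof.
by move=> cf; rewrite !L2normE sqnormZ// sqrtrM ?sqr_ge0// sqrtr_sqr ger0_norm ?normc_ge0.
Qed.

Lemma L2norm_sum (I : Type) (s : seq I) (c : I -> R[i]) (F : I -> R[i] -> R[i]) :
  (forall i, ccont (F i)) ->
  L2norm mu (fun z => \sum_(i <- s) c i * F i z) <=
  \sum_(i <- s) normc (c i) * L2norm mu (F i).
Proof.
move=> cF; elim: s => [|i s IH].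
  rewrite big_nil (_ : (fun z => _) = fun z => 0 * (fun=> 0) z).
    by rewrite (L2normZ _ (ccont_cst 0)) normc0 mul0r.
  by apply/funext => z; rewrite big_nil mul0r.
rewrite big_cons (_ : (fun z => _) =
  fun z => c i * F i z + \sum_(i <- s) c i * F i z); last first.
  by apply/funext => z; rewrite big_cons.
have cS : ccont (fun z => \sum_(i <- s) c i * F i z).
  elim: s {IH} => [|j s IH].
    rewrite (_ : (fun z => _) = fun=> 0); first exact: ccont_cst.
    by apply/funext => z; rewrite big_nil.
  rewrite (_ : (fun z => _) = fun z => c j * F j z + \sum_(j <- s) c j * F j z).
    exact: (ccontD (ccontM (ccont_cst _) (cF j)) IH).
  by apply/funext => z; rewrite big_cons.
apply: le_trans (L2norm_triangle (ccontM (ccont_cst _) (cF i)) cS) _.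
by rewrite (L2normZ _ (cF i)) lerD2l.
Qed.

Lemma L2norm_le f g : ccont f -> ccont g ->
  (forall z, K z -> normc (f z) <= normc (g z)) -> L2norm mu f <= L2norm mu g.
Proof.
move=> cf cg fg; rewrite !L2normE ler_wsqrtr//.
apply: (Rint_le muK (rcontX 2 (rcont_normc cf)) (rcontX 2 (rcont_normc cg))).
by move=> z /fg; rewrite -(@ler_pXn2r _ 2)// nnegrE normc_ge0.
Qed.

End ComplexIntegral.

(** * Supports of measures *)

Section Support.
Variables (R : realType) (mu : {finite_measure set (borelC R) -> \bar R}).
Let S := measure_support mu.

Lemma open_support_compl : @open R[i]^o (~` S).
Proof.
rewrite openE => z /existsNP[U /not_implyP[[oU Uz] nU]].
rewrite /interior nbhsE; exists U; first by split.
by move=> v Uv /(_ U (conj oU Uv)).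
Qed.

Let rball (x : rat * rat * rat) : set R[i]^o :=
  [set v | normc (v - (ratr x.1.1 +i* ratr x.1.2)) < ratr x.2].

Let open_rball x : open (rball x).
Proof.
pose f (v : R[i]^o) := normc (v - (ratr x.1.1 +i* ratr x.1.2)).
have -> : rball x = f @^-1` [set y | y < ratr x.2] by [].
apply: open_comp; last exact: open_lt.
by move=> v _; exact: (@continuous_dist R (ratr x.1.1 +i* ratr x.1.2)).
Qed.

(** Each point outside the support lies in a null disc with rational centre and radius, and there
    are countably many of these. Codes that decode to no disc, or to a disc of positive measure,
    contribute the empty set. *)
Lemma measure_support_compl : mu (~` S) = 0%E.
Proof.
pose F k : set (borelC R) := if (unpickle k : option (rat * rat * rat)) is Some x
  then (if mu (rball x) == 0%E then rball x else set0) else set0.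
have nF k : mu.-negligible (F k).
  rewrite /F; case: unpickle => [x|]; last exact: negligible_set0.
  case: ifPn => [/eqP x0|_]; last exact: negligible_set0.
  by exists (rball x); split => //; apply: measurable_open_plane.
have mS : measurable (~` S : set (borelC R)).
  by apply: measurable_open_plane; exact: open_support_compl.
apply: (measure_negligible mS); apply: negligibleS (negligible_bigcup nF).
move=> z /existsNP[U /not_implyP[[oU Uz] nU]].
have U0 : mu U = 0%E.
  by apply/eqP; rewrite eq_le measure_ge0 andbT leNgt; apply/negP.
have /nbhs_complexP[e e0 eU] : nbhs z U by exact: open_nbhs_nbhs.
have e6 : 0 < e / 6 by rewrite divr_gt0.
(* The centre is within [e / 3] of [z] and the radius lies between [e / 3] and [e / 2]: the disc
   contains [z], and it stays within [5 e / 6] of [z], hence inside [U]. *)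
have [q1 hq1] : exists q, ratr q \in `]complex.Re z, complex.Re z + e / 6[.
  by apply: rat_in_itvoo; rewrite ltrDl.
have [q2 hq2] : exists q, ratr q \in `]complex.Im z, complex.Im z + e / 6[.
  by apply: rat_in_itvoo; rewrite ltrDl.
have [q3 hq3] : exists q, ratr q \in `]e / 3, e / 2[.
  by apply: rat_in_itvoo; lra.
move: hq1 hq2 hq3; rewrite !in_itv /=.
move=> /andP[a1 a2] /andP[b1 b2] /andP[c1 c2].
have dz : normc (z - (ratr q1 +i* ratr q2)) < e / 3.
  apply: le_lt_trans (normc_le_ReIm _) _; rewrite !ReImE /=.
  rewrite !ltr0_norm; lra.
pose x := (q1, q2, q3).
have zx : rball x z by rewrite /rball /=; apply: lt_trans dz c1.
have xU : rball x `<=` U.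
  move=> v vx; apply: eU.
  rewrite -[v - z]/(v - z : R[i]) (_ : v - z = (v - (ratr q1 +i* ratr q2)) + ((ratr q1 +i* ratr q2) - z)); last by ring.
  apply: le_lt_trans (normc_le_add _ _) _; move: vx; rewrite /rball /= => vx.
  rewrite [X in _ + X]normc_distC; lra.
have mr y : measurable (rball y : set (borelC R)).
  by apply: measurable_open_plane.
have mU : measurable (U : set (borelC R)) by exact: measurable_open_plane.
have x0 : mu (rball x) == 0%E.
  rewrite -measure_le0 -U0.
  exact: (le_measure mu (mem_set (mr x)) (mem_set mU) xU).
have Fz : F (pickle x) z by rewrite /F pickleK x0.
exact: (ex_intro2 _ _ (pickle x) Logic.I Fz).
Qed.

Hypothesis cS : compact S.

Lemma carried_support : carried mu S.
Proof. by split => //; exact: measure_support_compl. Qed.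

(** A nonzero polynomial has finitely many roots, so some point of the support is not one of them;
    [|p|] is bounded below on a neighbourhood of it, which has positive measure. *)
Lemma sqnorm_horner_gt0 (p : {poly R[i]}) : infinite_set S -> p != 0 ->
  0 < sqnorm mu (horner p).
Proof.
move=> iS p0.
have [z Sz pz] : exists2 z, S z & p.[z] != 0.
  apply: contra_notP iS => H.
  have [r pr] := closed_field_poly_normal p.
  apply: (@sub_finite_set _ _ [set` r]) (finite_seq r) => z Sz /=.
  apply/negPn/negP => zr; apply: H; exists z => //.
  rewrite pr hornerZ mulf_neq0 ?lead_coef_eq0//.
  by rewrite -[_ != 0]/(~~ root _ _) root_prod_XsubC.
pose c := normc p.[z] / 2.
have nz : 0 < normc p.[z] by rewrite normc_gt0.
have c0 : 0 < c by rewrite divr_gt0.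
pose U : set R[i]^o := [set v | c < normc p.[v]].
have [cp] := rcont_normc (@ccont_horner R p).
have oU : open U.
  have -> : U = (fun v : R[i]^o => normc p.[v]) @^-1` [set y | c < y] by [].
  by apply: open_comp; [move=> v _; exact: cp|exact: open_gt].
have Uz : U z by rewrite /U /= /c; lra.
have U0 : (0 < mu U)%E by apply: Sz; split.
have mU : measurable (U : set (borelC R)) by exact: measurable_open_plane.
have cp2 := rcontX 2 (rcont_normc (@ccont_horner R p)).
have ip2 := integrable_rcont carried_support cp2.
have mp2 := measurable_rcont cp2.
have muU : (0 < fine (mu U)) by rewrite fine_gt0// U0 ltey_eq fin_num_measure.
apply: (@lt_le_trans _ _ (c ^+ 2 * fine (mu U))); first by rewrite mulr_gt0 ?exprn_gt0.
rewrite -lee_fin EFinM fineK ?fin_num_measure//.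
rewrite /sqnorm /Rintegral fineK; last exact: integrable_fin_num.
rewrite -integral_cst//.
have mp2U : measurable_fun (U : set (borelC R)) (fun z => (normc p.[z] ^+ 2)%:E).
  by apply/measurable_EFinP; apply: measurable_funTS.
apply: (@le_trans _ _ (\int[mu]_(z in U) (normc p.[z] ^+ 2)%:E)%E).
  apply: ge0_le_integral => //.
  - by move=> v _; rewrite lee_fin sqr_ge0.
  - by move=> v /ltW Uv; rewrite lee_fin ler_pXn2r// nnegrE ?normc_ge0 ?ltW.
apply: ge0_subset_integral => //; first exact/measurable_EFinP.
by move=> v _; rewrite lee_fin sqr_ge0.
Qed.

End Support.

(** * Orthonormal polynomials and Christoffel functions *)

Section OrthonormalPolynomials.
Variables (R : realType) (mu : {finite_measure set (borelC R) -> \bar R}).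
Variable K : set R[i]^o.
Hypothesis muK : carried mu K.
Implicit Types p q r : {poly R[i]}.

Definition ip p q : R[i] := inner mu (horner p) (horner q).

Lemma ip_conj p q : ip q p = (ip p q)^*%C.
Proof. exact: (inner_conj muK (ccont_horner p) (ccont_horner q)). Qed.

Lemma ipDl p q r : ip (p + q) r = ip p r + ip q r.
Proof.
rewrite /ip -(innerDl muK (ccont_horner p) (ccont_horner q) (ccont_horner r)).
by congr (inner mu _ _); apply/funext => z; rewrite hornerD.
Qed.

Lemma ipZl c p q : ip (c *: p) q = c * ip p q.
Proof.
rewrite /ip -(innerZl muK _ (ccont_horner p) (ccont_horner q)).
by congr (inner mu _ _); apply/funext => z; rewrite hornerZ.
Qed.

Lemma ip0l p : ip 0 p = 0.
Proof. by rewrite -(scale0r (0 : {poly R[i]})) ipZl mul0r. Qed.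

Lemma ipBl p q r : ip (p - q) r = ip p r - ip q r.
Proof. by rewrite ipDl -scaleN1r ipZl mulN1r. Qed.

Lemma ip_suml (I : Type) (s : seq I) (P : pred I) (F : I -> {poly R[i]}) q :
  ip (\sum_(i <- s | P i) F i) q = \sum_(i <- s | P i) ip (F i) q.
Proof.
elim/big_rec2 : _ => [|i x y _ <-]; first exact: ip0l.
by rewrite ipDl.
Qed.

Lemma ipZr c p q : ip p (c *: q) = c^*%C * ip p q.
Proof. by rewrite ip_conj ipZl conjcM -ip_conj. Qed.

Lemma ip_self p : ip p p = (sqnorm mu (horner p))%:C.
Proof. exact: inner_sqnorm. Qed.

Definition orthonormal_upto (s : nat -> {poly R[i]}) n :=
  (forall i, (i < n)%N -> size (s i) = i.+1 /\ 0 < lead_coef (s i)) /\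
  (forall i j, (i < n)%N -> (j < n)%N -> ip (s i) (s j) = (i == j)%:R).

Lemma orthonormal_span s n p : orthonormal_upto s n -> (size p <= n)%N ->
  p = \sum_(i < n) ip p (s i) *: s i.
Proof.
move=> [s1 s2] pn.
have [c pc] : exists c : nat -> R[i], p = \sum_(i < n) c i *: s i.
  elim: n p pn s1 {s2} => [|n IH] p pn s1.
    exists (fun=> 0); rewrite big_ord0; apply/eqP.
    by rewrite -size_poly_eq0 -leqn0.
  have [sn ln] := s1 n (ltnSn n).
  pose a := p`_n / lead_coef (s n).
  have [||c pc] := IH (p - a *: s n); last 1 first.
  - exists (fun i => if i == n then a else c i).
    rewrite big_ord_recr /= eqxx -[LHS](subrK (a *: s n)) pc; congr (_ + _).
    by apply: eq_bigr => i _; rewrite ltn_eqF.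
  - apply/leq_sizeP => j nj; rewrite coefB coefZ.
    have [->|jn] := eqVneq j n.
      have -> : (s n)`_n = lead_coef (s n) by rewrite lead_coefE sn.
      by rewrite /a divfK ?subrr// gt_eqF.
    have nj' : (n < j)%N by rewrite ltn_neqAle eq_sym jn.
    by rewrite !nth_default ?mulr0 ?subr0 ?sn// (leq_trans pn).
  - by move=> i ni; apply: s1; exact: ltnW.
rewrite {1}pc; apply: eq_bigr => i _; congr (_ *: _).
rewrite pc ip_suml (bigD1 i)//= big1 ?addr0 => [|j ji].
  by rewrite ipZl s2// eqxx mulr1.
by rewrite ipZl s2// (inj_eq val_inj) (negbTE ji) mulr0.
Qed.

Hypothesis posdef : forall p, p != 0 -> 0 < sqnorm mu (horner p).

Definition gram_schmidt_step (n : nat) (s : nat -> {poly R[i]}) : {poly R[i]} :=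
  let r := 'X^n - \sum_(i < n) ip 'X^n (s i) *: s i in
  ((Num.sqrt (sqnorm mu (horner r)))^-1)%:C *: r.

Lemma gram_schmidt_stepP n s : orthonormal_upto s n ->
  orthonormal_upto (fun i => if i == n then gram_schmidt_step n s else s i) n.+1.
Proof.
move=> os; have [s1 s2] := os; rewrite /gram_schmidt_step.
set sm := \sum_(i < n) _; set r := 'X^n - sm; set c := Num.sqrt _.
have szsm : (size sm <= n)%N.
  apply: (leq_trans (size_sum _ _ _)); apply/bigmax_leqP => i _.
  by apply: (leq_trans (size_scale_leq _ _)); rewrite (s1 i _).1.
have szr : size r = n.+1 by rewrite size_polyDl size_polyXn// size_polyN ltnS.
have lr : lead_coef r = 1.
  by rewrite lead_coefDl ?lead_coefXn// size_polyXn size_polyN ltnS.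
have r0 : r != 0 by rewrite -size_poly_eq0 szr.
have c0 : 0 < c by rewrite sqrtr_gt0 posdef.
have cV0 : (c^-1)%:C != 0 :> R[i].
  by apply/eqP => /complexI /eqP; rewrite invr_eq0 gt_eqF.
have orth i : (i < n)%N -> ip r (s i) = 0.
  move=> ni; rewrite ipBl /sm ip_suml (bigD1 (Ordinal ni))//= big1 ?addr0.
    by rewrite ipZl s2// eqxx mulr1 subrr.
  move=> j ji; rewrite ipZl s2//.
  by rewrite -[(j : nat) == i]/((j : nat) == Ordinal ni) (inj_eq val_inj) (negbTE ji) mulr0.
have orth' i : (i < n)%N -> ip (s i) r = 0.
  by move=> ni; rewrite ip_conj orth// conjc0.
have cc : ip ((c^-1)%:C *: r) ((c^-1)%:C *: r) = 1.
  rewrite ipZl ipZr conjc_real ip_self -!rmorphM /= mulrA -expr2.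
  rewrite -[sqnorm _ _]sqr_sqrtr ?sqnorm_ge0// -/c -exprMn mulVf ?expr1n//.
  by rewrite gt_eqF.
split.
  move=> i; rewrite ltnS leq_eqVlt => /orP[/eqP ->|ni].
    rewrite eqxx size_scale// szr; split=> //.
    by rewrite lead_coefZ lr mulr1 ltcR invr_gt0.
  by rewrite ltn_eqF//; exact: s1.
move=> i j; rewrite ltnS leq_eqVlt => /orP[/eqP ->|ni];
  rewrite ltnS leq_eqVlt => /orP[/eqP ->|nj].
- by rewrite !eqxx cc.
- by rewrite eqxx (ltn_eqF nj) (gtn_eqF nj) ipZl orth// mulr0.
- by rewrite eqxx (ltn_eqF ni) ipZr orth'// mulr0.
- by rewrite (ltn_eqF nj) (ltn_eqF ni); exact: s2.
Qed.

(** Stage [n] is meaningful only at indices below [n], and 0 elsewhere. Later stages never revise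
    earlier entries, so the orthonormal sequence is read off at stage [i.+1], index [i]. *)
Fixpoint gram_schmidt (n : nat) : nat -> {poly R[i]} :=
  if n is m.+1 then
    fun i => if i == m then gram_schmidt_step m (gram_schmidt m)
             else gram_schmidt m i
  else fun=> 0.

Lemma gram_schmidt_upto n : orthonormal_upto (gram_schmidt n) n.
Proof. by elim: n => [|n IH]; [split|exact: gram_schmidt_stepP]. Qed.

Lemma gram_schmidt_stable n i : (i < n)%N -> gram_schmidt n i = gram_schmidt i.+1 i.
Proof.
elim: n => // n IH; rewrite ltnS leq_eqVlt => /orP[/eqP -> //|ni].
by rewrite /= ltn_eqF// IH.
Qed.

Lemma orthopolyP : orthonormal_polynomials mu (orthopoly mu).
Proof.
rewrite /orthopoly; apply: xgetPex; exists (fun i => gram_schmidt i.+1 i).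
split => [n|m n].
  by have [h _] := gram_schmidt_upto n.+1; exact: h.
pose N := (maxn m n).+1; have [_ h] := gram_schmidt_upto N.
have mN : (m < N)%N by rewrite ltnS leq_maxl.
have nN : (n < N)%N by rewrite ltnS leq_maxr.
by rewrite -(gram_schmidt_stable mN) -(gram_schmidt_stable nN); exact: h.
Qed.

Local Notation p := (orthopoly mu).

Lemma orthopoly_upto n : orthonormal_upto p n.
Proof. by have [h1 h2] := orthopolyP; split => [i _|i j _ _]; [exact: h1|exact: h2]. Qed.

Lemma size_orthopoly n : size (p n) = n.+1.
Proof. exact: (orthopolyP.1 n).1. Qed.

Lemma gamma_gt0 n : 0 < gamma mu n.
Proof. exact: (orthopolyP.1 n).2. Qed.

Lemma ip_orthopoly m n : ip (p m) (p n) = (m == n)%:R.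
Proof. exact: orthopolyP.2. Qed.

Lemma sqnorm_orthopoly n : sqnorm mu (horner (p n)) = 1.
Proof. by have := ip_orthopoly n n; rewrite ip_self eqxx => /complexI. Qed.

Lemma L2norm_orthopoly n : L2norm mu (horner (p n)) = 1.
Proof. by rewrite L2normE sqnorm_orthopoly sqrtr1. Qed.

Lemma ip_orthopoly_small q n : (size q <= n)%N -> ip q (p n) = 0.
Proof.
move=> qn; rewrite (orthonormal_span (orthopoly_upto n) qn) ip_suml big1// => i _.
by rewrite ipZl ip_orthopoly ltn_eqF// mulr0.
Qed.

Definition kernel_diag n (z : R[i]) : R := \sum_(i < n.+1) normc (p i).[z] ^+ 2.

(** The Christoffel-Darboux kernel [K_n(., z)] as a polynomial in its first variable; the conjugate
    is on the value at [z], so that pairing with it on the right evaluates at [z]. *)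
Definition kernel n (z : R[i]) : {poly R[i]} :=
  \sum_(i < n.+1) (p i).[z]^*%C *: p i.

Lemma kernel_diagE n z : (kernel n z).[z] = (kernel_diag n z)%:C.
Proof.
rewrite horner_sum rmorph_sum; apply: eq_bigr => i _ /=.
by rewrite hornerZ mulrC mulc_conj.
Qed.

Lemma kernel_reproducing n z q : (size q <= n.+1)%N -> ip q (kernel n z) = q.[z].
Proof.
move=> qn; rewrite {2}(orthonormal_span (orthopoly_upto n.+1) qn) horner_sum.
rewrite ip_conj ip_suml conjc_sum; apply: eq_bigr => i _.
by rewrite ipZl conjcM conjcK -ip_conj hornerZ mulrC.
Qed.

Lemma size_kernel n z : (size (kernel n z) <= n.+1)%N.
Proof.
apply: (leq_trans (size_sum _ _ _)); apply/bigmax_leqP => i _.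
by apply: (leq_trans (size_scale_leq _ _)); rewrite size_orthopoly.
Qed.

Lemma sqnorm_kernel n z : sqnorm mu (horner (kernel n z)) = kernel_diag n z.
Proof.
apply: complexI; rewrite -ip_self (kernel_reproducing _ (size_kernel n z)).
exact: kernel_diagE.
Qed.

Lemma kernel_diag_gt0 n z : 0 < kernel_diag n z.
Proof.
apply: (@lt_le_trans _ _ (normc (p 0).[z] ^+ 2)).
  have /eqP/size_poly1P[c c0 ->] := size_orthopoly 0.
  by rewrite hornerC exprn_gt0 ?normc_gt0.
rewrite /kernel_diag big_ord_recl lerDl; apply: sumr_ge0 => i _; exact: sqr_ge0.
Qed.

Lemma kernel_diag_le m n z : (m <= n)%N -> kernel_diag m z <= kernel_diag n z.
Proof.
move=> mn; rewrite /kernel_diag -!(big_mkord xpredT (fun i => normc (p i).[z] ^+ 2)).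
rewrite [leRHS](big_cat_nat _ (n := m.+1))//= lerDl.
by apply: sumr_ge0 => i _; exact: sqr_ge0.
Qed.

Let admissible n z := [set P : {poly R[i]} | (size P <= n.+1)%N /\ P.[z] = 1].

(** Cauchy-Schwarz applied to [1 = P(z) = <P, K_n(., z)>], where [K_n(., z)] has squared norm
    [K_n(z, z)]. *)
Lemma kernel_diag_lower n z P : admissible n z P ->
  (kernel_diag n z)^-1 <= L2norm mu (horner P) ^+ 2.
Proof.
move=> [sP Pz]; have Kgt0 := kernel_diag_gt0 n z.
rewrite -[_^-1]mul1r ler_pdivrMr//.
have := inner_Cauchy_Schwarz muK (ccont_horner P) (ccont_horner (kernel n z)).
rewrite -/(ip _ _) (kernel_reproducing _ sP) Pz normc1 => h.
rewrite -(sqnorm_kernel n z) -(sqr_L2norm mu (horner (kernel n z))) -exprMn.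
by rewrite exprn_ege1.
Qed.

Lemma christoffelE n z : christoffel mu n z = (kernel_diag n z)^-1.
Proof.
have Kgt0 := kernel_diag_gt0 n z.
rewrite /christoffel; set A := [set _ | _ in _].
have Amin : A (kernel_diag n z)^-1.
  (* The case of equality in Cauchy-Schwarz: the kernel, normalised to be 1 at [z]. *)
  exists ((kernel_diag n z)^-1%:C *: kernel n z).
    split; first by apply: (leq_trans (size_scale_leq _ _)); exact: size_kernel.
    by rewrite hornerZ kernel_diagE -rmorphM /= mulVf ?gt_eqF.
  rewrite (_ : horner _ = fun v => (kernel_diag n z)^-1%:C * (kernel n z).[v]).
    rewrite (L2normZ muK _ (ccont_horner _)) exprMn sqr_L2norm sqnorm_kernel.
    by rewrite normc_real ger0_norm ?invr_ge0 ?ltW// expr2 mulfVK// gt_eqF.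
  by apply/funext => v; rewrite hornerZ.
have Alb : lbound A (kernel_diag n z)^-1.
  by move=> _ [P aP <-]; exact: kernel_diag_lower.
apply/eqP; rewrite eq_le; apply/andP; split.
  by apply: ge_inf => //; exists (kernel_diag n z)^-1.
by apply: lb_le_inf => //; exists (kernel_diag n z)^-1.
Qed.

Lemma christoffel_le n (z : R[i]) (P : {poly R[i]}) : (size P <= n.+1)%N -> P.[z] = 1 ->
  christoffel mu n z <= sqnorm mu (horner P).
Proof.
by move=> sP Pz; rewrite christoffelE -sqr_L2norm; exact: kernel_diag_lower.
Qed.

(* Multiplying the extremal polynomial of degree [n] by a polynomial which is
   small on the carrier. *)
Lemma kernel_diag_growth n m (z : R[i]) (Q : {poly R[i]}) (eta : R) : 0 <= eta -> (size Q <= m.+1)%N -> Q.[z] = 1 ->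
  (forall t, K t -> normc Q.[t] <= eta) ->
  kernel_diag n z <= eta ^+ 2 * kernel_diag (n + m) z.
Proof.
move=> eta0 sQ Qz QK; have Kn := kernel_diag_gt0 n z.
have Knm := kernel_diag_gt0 (n + m) z.
have adm : admissible (n + m) z ((kernel_diag n z)^-1%:C *: kernel n z * Q).
  split.
    apply: (leq_trans (size_polyMleq _ _)).
    have h : (size ((kernel_diag n z)^-1%:C *: kernel n z) <= n.+1)%N.
      by apply: (leq_trans (size_scale_leq _ _)); exact: size_kernel.
    by rewrite -subn1 leq_subLR add1n (leq_trans (leq_add h sQ))// addSn addnS.
  by rewrite hornerM Qz mulr1 hornerZ kernel_diagE -rmorphM /= mulVf ?gt_eqF.
have := kernel_diag_lower adm; set P := _ * Q.
have cc : ccont (fun v => (eta / kernel_diag n z)%:C * (kernel n z).[v]).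
  exact: (ccontM (ccont_cst _) (ccont_horner _)).
have : L2norm mu (horner P) <= eta / kernel_diag n z * L2norm mu (horner (kernel n z)).
  have <- : normc (eta / kernel_diag n z)%:C = eta / kernel_diag n z.
    by rewrite normc_real ger0_norm// divr_ge0// ltW.
  rewrite -(L2normZ muK _ (ccont_horner _)).
  apply: (L2norm_le muK (ccont_horner _) cc) => v Kv.
  rewrite hornerM hornerZ !normcM mulrAC; apply: ler_wpM2r; first exact: normc_ge0.
  have Ki0 : 0 <= (kernel_diag n z)^-1 by rewrite invr_ge0 ltW.
  rewrite !normc_real (ger0_norm Ki0) (ger0_norm (mulr_ge0 eta0 Ki0)) mulrC.
  by rewrite ler_wpM2r// QK.
move=> h1 h2.
have : (kernel_diag (n + m) z)^-1 <=
    (eta / kernel_diag n z * L2norm mu (horner (kernel n z))) ^+ 2.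
  apply: le_trans h2 _; rewrite ler_pXn2r// nnegrE ?L2norm_ge0//.
  by rewrite mulr_ge0 ?L2norm_ge0// divr_ge0// ltW.
rewrite exprMn sqr_L2norm sqnorm_kernel.
have -> : (eta / kernel_diag n z) ^+ 2 * kernel_diag n z = eta ^+ 2 / kernel_diag n z.
  by field; rewrite gt_eqF.
by rewrite -[_^-1]mul1r ler_pdivrMr// mulrAC ler_pdivlMr// mul1r.
Qed.

End OrthonormalPolynomials.

(** * Cauchy transforms and the convex hull *)

Section CauchyKernel.
Variable R : realType.
Implicit Types (d D : R) (z t u : R[i]) (r s : {poly R[i]}) (n : nat).

Lemma rcont_norm (f : R[i] -> R) : rcont f -> rcont (fun z => `|f z|).
Proof.
by move=> [cf]; split => z; exact: continuous_comp (cf z) (@norm_continuous _ _ _).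
Qed.

Lemma rcontV (f : R[i] -> R) : rcont f -> (forall z, f z != 0) ->
  rcont (fun z => (f z)^-1).
Proof. by move=> [cf] f0; split => z; exact: (cvgV (f0 z) (cf z)). Qed.

Lemma rcont_max (f g : R[i] -> R) : rcont f -> rcont g ->
  rcont (fun z => Num.max (f z) (g z)).
Proof.
move=> cf cg; rewrite (_ : (fun z => _) =
  fun z => (f z + g z + `|f z + -1 * g z|) * 2^-1); last first.
  by apply/funext => z; rewrite maxr_absE mulN1r.
apply: rcontM (rcont_cst _); apply: (rcontD (rcontD cf cg)).
exact: (rcont_norm (rcontD cf (rcontM (rcont_cst _) cg))).
Qed.

(* A continuous function of [t] on the whole plane equal to [1 / (z - t)] as soon
   as [d <= |z - t|]. *)
Definition cauchy_kernel (d : R) (z t : R[i]) : R[i] :=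
  (z - t)^*%C * ((Num.max (normc (z - t)) d ^+ 2)^-1)%:C.

Lemma ccont_kernel d z : 0 < d -> ccont (cauchy_kernel d z).
Proof.
move=> d0; have cz : ccont (fun t => z - t) by exact: (ccontB (ccont_cst z) (@ccont_id R)).
apply: (ccontM (ccont_conj cz)); apply: ccont_real; apply: rcontV.
  exact: (rcontX 2 (rcont_max (rcont_normc cz) (rcont_cst d))).
by move=> t; rewrite expf_neq0// gt_eqF// lt_max d0 orbT.
Qed.

Lemma cauchy_kernelE d z t : 0 < d -> d <= normc (z - t) ->
  cauchy_kernel d z t = (z - t)^-1.
Proof.
move=> d0 dz; rewrite /cauchy_kernel max_l//.
have zt : z - t != 0 by rewrite -normc_gt0 (lt_le_trans d0).
apply: (mulfI zt); rewrite mulrA mulc_conj divff// -rmorphM /= divff//.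
by rewrite expf_neq0// gt_eqF// (lt_le_trans d0).
Qed.

Lemma normc_kernel d z t : 0 < d -> d <= normc (z - t) ->
  normc (cauchy_kernel d z t) = (normc (z - t))^-1.
Proof. by move=> d0 dz; rewrite cauchy_kernelE// normcV. Qed.

Variables (mu : {finite_measure set (borelC R) -> \bar R}) (K : set R[i]^o).
Hypothesis muK : carried mu K.
Hypothesis posdef : forall p : {poly R[i]}, p != 0 -> 0 < sqnorm mu (horner p).
Local Notation p := (orthopoly mu).

Lemma eq_cint_carrier f g : ccont f -> ccont g -> (forall z, K z -> f z = g z) ->
  cint mu f = cint mu g.
Proof.
move=> cf cg fg; apply: complex_eq => /=.
  rewrite (Rint_restrict muK (rcont_Re cf)) (Rint_restrict muK (rcont_Re cg)).
  by apply: eq_Rintegral => z; rewrite inE => /fg ->.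
rewrite (Rint_restrict muK (rcont_Im cf)) (Rint_restrict muK (rcont_Im cg)).
by apply: eq_Rintegral => z; rewrite inE => /fg ->.
Qed.

Definition cauchy_int d n z (r : {poly R[i]}) :=
  cint mu (fun t => cauchy_kernel d z t * (r.[t] * ((p n).[t])^*%C)).

Let ccont_integrand d n z (r : {poly R[i]}) : 0 < d ->
  ccont (fun t => cauchy_kernel d z t * (r.[t] * ((p n).[t])^*%C)).
Proof.
move=> d0; apply: (ccontM (ccont_kernel z d0)).
exact: (ccontM (ccont_horner r) (ccont_conj (ccont_horner (p n)))).
Qed.

Lemma cauchy_intB d n z r s : 0 < d ->
  cauchy_int d n z (r - s) = cauchy_int d n z r - cauchy_int d n z s.
Proof.
move=> d0.
rewrite -(cintB muK (ccont_integrand n z r d0) (ccont_integrand n z s d0)).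
by apply: eq_cint => t; rewrite hornerD hornerN; ring.
Qed.

(* [(r(z) p_n(t) - p_n(z) r(t)) / (z - t)] is a polynomial in [t] of degree less
   than [n], hence orthogonal to [p_n]. *)
Lemma cauchy_int_ratio d n z r : 0 < d -> (forall t, K t -> d <= normc (z - t)) ->
  (size r <= n.+1)%N ->
  r.[z] * cauchy_int d n z (p n) = (p n).[z] * cauchy_int d n z r.
Proof.
move=> d0 dK sr; apply/eqP; rewrite -subr_eq0; apply/eqP.
pose D := r.[z] *: p n - (p n).[z] *: r.
have Dz : root D z by rewrite rootE !hornerE mulrC subrr.
have /factor_theorem[Q DQ] := Dz.
have cpn := ccont_horner (p n).
have sQ : (size Q <= n)%N.
  have [->|Q0] := eqVneq Q 0; first by rewrite size_poly0.
  have : (size D <= n.+1)%N.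
    apply: (leq_trans (size_polyD _ _)); rewrite geq_max size_polyN.
    rewrite !(leq_trans (size_scale_leq _ _))//.
    by rewrite (size_orthopoly muK posdef).
  by rewrite DQ size_Mmonic ?monicXsubC// size_XsubC addnS addn1.
have i1 := ccont_integrand n z (p n) d0; have i2 := ccont_integrand n z r d0.
rewrite -(cintZ muK _ i1) -(cintZ muK _ i2).
rewrite -(cintB muK (ccontM (ccont_cst _) i1) (ccontM (ccont_cst _) i2)).
have iQ : ccont (fun t => Q.[t] * ((p n).[t])^*%C).
  exact: (ccontM (ccont_horner Q) (ccont_conj cpn)).
(* The truncated kernel is [1 / (z - t)] on the carrier, and equality there is enough. The sign
   comes from [D = Q * ('X - z)]. *)
rewrite (@eq_cint_carrier _ (fun t => -1 * (Q.[t] * ((p n).[t])^*%C))).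
- rewrite (cintZ muK _ iQ) -[cint _ _]/(ip mu Q (p n)).
  by rewrite (ip_orthopoly_small muK posdef)// mulr0.
- exact: (ccontB (ccontM (ccont_cst _) i1) (ccontM (ccont_cst _) i2)).
- exact: (ccontM (ccont_cst _) iQ).
move=> t /dK dt; have zt : z - t != 0 by rewrite -normc_gt0 (lt_le_trans d0).
have DE : D.[t] = Q.[t] * (t - z) by rewrite DQ hornerM hornerXsubC.
rewrite /D hornerD hornerN !hornerZ in DE.
rewrite [cauchy_kernel d z t](cauchy_kernelE d0 dt); set c := ((p n).[t])^*%C.
have -> : r.[z] * ((z - t)^-1 * ((p n).[t] * c)) -
  (p n).[z] * ((z - t)^-1 * (r.[t] * c)) =
  (r.[z] * (p n).[t] - (p n).[z] * r.[t]) * (z - t)^-1 * c by ring.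
by rewrite DE; field.
Qed.

Lemma normc_cauchy_int d n z r : 0 < d -> (forall t, K t -> d <= normc (z - t)) ->
  normc (cauchy_int d n z r) <= d^-1 * L2norm mu (horner r).
Proof.
move=> d0 dK; rewrite -[L2norm _ _]mulr1 -{1}(L2norm_orthopoly muK posdef n).
apply: (Cauchy_Schwarz muK _ (ccont_horner r) (ccont_horner (p n))
  (ccont_kernel z d0)); first by rewrite invr_ge0 ltW.
move=> t Kt; rewrite normc_kernel// ?dK// lef_pV2 ?posrE ?dK//.
by rewrite (lt_le_trans d0)// dK.
Qed.

(** The real part of [conj u / (z - t)] is [Re (u (z - t)) / |z - t|^2], at least [d / D^2] on the
    carrier; it is averaged against [|p_n|^2 mu], of total mass 1. *)
Lemma cauchy_int_lower d D n z (u : R[i]) : 0 < d -> normc u <= 1 ->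
  (forall t, K t -> d <= complex.Re (u * (z - t)) /\ normc (z - t) <= D) ->
  d / D ^+ 2 <= normc (cauchy_int d n z (p n)).
Proof.
move=> d0 u1 uK; have dK t : K t -> d <= normc (z - t).
  move=> /uK[h _]; apply: le_trans h _; apply: le_trans (Re_le_normc _) _.
  by rewrite normcM ler_piMl// normc_ge0.
have ipn := ccont_integrand n z (p n) d0.
apply: (@le_trans _ _ (normc (u^*%C * cauchy_int d n z (p n)))); last first.
  by rewrite normcM normc_conj ler_piMl// normc_ge0.
apply: le_trans (Re_le_normc _).
rewrite -(cintZ muK _ ipn) -[leLHS]mulr1 -{1}(sqnorm_orthopoly muK posdef n).
have rp2 := rcontX 2 (rcont_normc (ccont_horner (p n))).
rewrite -(RintZ muK _ rp2).
apply: (Rint_le muK (rcontM (rcont_cst _) rp2)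
  (rcont_Re (ccontM (ccont_cst u^*%C) ipn))) => t Kt.
have dt := dK _ Kt; have [h1 h2] := uK _ Kt.
have zt0 : 0 < normc (z - t) by rewrite (lt_le_trans d0).
rewrite /cauchy_kernel max_l// mulc_conj.
set A := (normc (z - t) ^+ 2)^-1; set B := normc (p n).[t] ^+ 2.
have -> : u^*%C * ((z - t)^*%C * A%:C * B%:C) = (u * (z - t))^*%C * (A * B)%:C.
  have -> : (A * B)%:C = A%:C * B%:C by exact: rmorphM.
  by rewrite conjcM !mulrA.
rewrite Re_mulc_real Re_conj [leRHS]mulrA ler_wpM2r ?sqr_ge0//.
apply: ler_pM => //; [exact: ltW| |].
  by rewrite invr_ge0 sqr_ge0.
rewrite lef_pV2 ?posrE ?exprn_gt0// ?(lt_le_trans zt0)//.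
by rewrite ler_pXn2r// nnegrE ltW// (lt_le_trans zt0).
Qed.

(** The constant is the upper bound [1 / d] for the transform of [r conj(p_n)], divided by the lower
    bound [d / D^2] for that of [|p_n|^2]. *)
Lemma outside_hull_bound d D n z (u : R[i]) r : 0 < d -> normc u <= 1 ->
  (forall t, K t -> d <= complex.Re (u * (z - t)) /\ normc (z - t) <= D) ->
  K !=set0 -> (size r <= n.+1)%N ->
  normc r.[z] <= (D / d) ^+ 2 * L2norm mu (horner r) * normc (p n).[z].
Proof.
move=> d0 u1 uK [t0 Kt0] sr.
have dK t : K t -> d <= normc (z - t).
  move=> /uK[h _]; apply: le_trans h _; apply: le_trans (Re_le_normc _) _.
  by rewrite normcM ler_piMl// normc_ge0.
have D0 : 0 < D.
  by apply: (lt_le_trans d0); apply: le_trans (dK _ Kt0) (uK _ Kt0).2.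
have := cauchy_int_ratio d0 dK sr => /(congr1 (@normc R)); rewrite !normcM => E.
have lo := cauchy_int_lower n d0 u1 uK.
have up := normc_cauchy_int n r d0 dK.
have dD : 0 < d / D ^+ 2 by rewrite divr_gt0// exprn_gt0.
rewrite -(ler_pM2r dD); apply: (@le_trans _ _ (normc r.[z] * normc (cauchy_int d n z (p n)))).
  by rewrite ler_wpM2l ?normc_ge0.
rewrite E.
have -> : (D / d) ^+ 2 * L2norm mu (horner r) * normc (p n).[z] * (d / D ^+ 2) =
   normc (p n).[z] * (d^-1 * L2norm mu (horner r)).
  by field; rewrite !gt_eqF.
by rewrite ler_wpM2l ?normc_ge0.
Qed.

(** Fejer's theorem on the zeros of orthogonal polynomials: at a zero of [p_n], the previous bound
    with [r = 1] would read [1 <= 0]. *)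
Lemma orthopoly_outside_hull_neq0 d D n z (u : R[i]) : 0 < d -> normc u <= 1 ->
  (forall t, K t -> d <= complex.Re (u * (z - t)) /\ normc (z - t) <= D) ->
  K !=set0 -> (p n).[z] != 0.
Proof.
move=> d0 u1 uK K0; apply/eqP => pz.
have := @outside_hull_bound d D n z u 1 d0 u1 uK K0.
by rewrite size_poly1 pz hornerC normc0 mulr0 normc1 => /(_ isT); rewrite ler10.
Qed.

End CauchyKernel.

(** * Three unit vectors in the plane *)

Section PlaneCone.
Variable R : realFieldType.
Implicit Types a b c p s t x y : R.

(** For unit vectors [a], [b], [t] with [c = a.b], [p = t.a], [s = t.b], the number [p - c s] is
    [1 - c^2] times the coefficient of [a] in [t]. If it were positive, [p + s <= 0] would force
    [s < 0], hence [s^2 <= c^2], then [1 - c^2 <= p - c s], and finally [s <= c - 1], against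
    [c <= s]. *)
Lemma cone_coefficient c p s : -1 < c -> c < 0 -> c <= p -> c <= s ->
  p + s <= 0 -> p ^+ 2 - 2 * c * p * s + s ^+ 2 = 1 - c ^+ 2 -> p - c * s <= 0.
Proof.
move=> c1 c0 cp cs ps gram; rewrite leNgt; apply/negP; set x := p - c * s => x0.
set w := 1 - c ^+ 2 in gram; have w0 : 0 < w by rewrite /w; nra.
have x2 : x ^+ 2 = w * (1 - s ^+ 2) by rewrite /x /w; rewrite /w in gram; nra.
have ws : w * s = x * c + (s - c * p) by rewrite /w /x; ring.
have y0 : s - c * p <= - x by rewrite /x; nra.
have s0 : s < 0.
  rewrite ltNge; apply/negP => s0; have := mulr_ge0 (ltW w0) s0.
  have : x * c < 0 by rewrite pmulr_rlt0.
  by rewrite ws; lra.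
have s2 : s ^+ 2 <= c ^+ 2 by nra.
have xw : w <= x.
  rewrite -(@ler_pXn2r _ 2)// ?nnegrE ?(ltW w0) ?(ltW x0)// x2 [w ^+ 2]expr2.
  by apply: ler_wpM2l; [exact: ltW|rewrite /w; lra].
have : w * s <= w * (c - 1).
  rewrite ws; apply: (@le_trans _ _ (x * (c - 1))); nra.
by rewrite ler_pM2l//; lra.
Qed.

(** If [t] makes with [a] and with [b] no larger an angle than they make together, yet lies on the
    wrong side of their bisector, then [-t] is in the cone they span, so that 0 is a convex
    combination of the three up to scaling. *)
Lemma plane_cone a1 a2 b1 b2 t1 t2 :
  a1 ^+ 2 + a2 ^+ 2 = 1 -> b1 ^+ 2 + b2 ^+ 2 = 1 -> t1 ^+ 2 + t2 ^+ 2 = 1 ->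
  let c := a1 * b1 + a2 * b2 in
  -1 < c -> c <= t1 * a1 + t2 * a2 -> c <= t1 * b1 + t2 * b2 ->
  t1 * (a1 + b1) + t2 * (a2 + b2) <= 0 ->
  exists x y, [/\ 0 <= x, 0 <= y, t1 + x * a1 + y * b1 = 0 &
    t2 + x * a2 + y * b2 = 0].
Proof.
move=> A B T c c1; set p := t1 * a1 + _; set s := t1 * b1 + _ => cp cs.
have -> : t1 * (a1 + b1) + t2 * (a2 + b2) = p + s by rewrite /p /s; ring.
move=> ps.
(* The Gram determinant of three plane vectors vanishes. *)
have gram : p ^+ 2 - 2 * c * p * s + s ^+ 2 = 1 - c ^+ 2.
  have : (t1 ^+ 2 + t2 ^+ 2) * (a1 ^+ 2 + a2 ^+ 2) * (b1 ^+ 2 + b2 ^+ 2)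
    + 2 * p * c * s - (t1 ^+ 2 + t2 ^+ 2) * c ^+ 2
    - (a1 ^+ 2 + a2 ^+ 2) * s ^+ 2 - (b1 ^+ 2 + b2 ^+ 2) * p ^+ 2 = 0.
    by rewrite /p /s /c; ring.
  by rewrite A B T; lra.
(* For [c >= 0] both [p] and [s] vanish, and so does [c]; the Gram relation then reads [0 = 1]. *)
have [c0|c0] := leP 0 c.
  have p0 : p = 0 by lra.
  have s0 : s = 0 by lra.
  by move: gram cp; rewrite p0 s0 => gram cp; exfalso; nra.
have w0 : 0 < 1 - c ^+ 2 by nra.
have x0 := cone_coefficient c1 c0 cp cs ps gram.
have y0 : s - c * p <= 0.
  by apply: cone_coefficient cs cp _ _ => //; [lra|rewrite -gram; ring].
have fin w x y a b t : 0 < w -> w * t = x * a + y * b ->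
    t + - x / w * a + - y / w * b = 0.
  move=> wgt0 E; apply: (mulfI (lt0r_neq0 wgt0)).
  have -> : w * (t + - x / w * a + - y / w * b) = w * t - (x * a + y * b).
    by field; exact: lt0r_neq0.
  by rewrite E subrr mulr0.
(* Cramer's rule for the coordinates of [-t] in the basis [a], [b]. *)
exists (- (p - c * s) / (1 - c ^+ 2)), (- (s - c * p) / (1 - c ^+ 2)); split.
- by rewrite divr_ge0 ?(ltW w0)//; lra.
- by rewrite divr_ge0 ?(ltW w0)//; lra.
- have E : (1 - c ^+ 2) * t1 = (p - c * s) * a1 + (s - c * p) * b1.
    have : ((a1 ^+ 2 + a2 ^+ 2) * (b1 ^+ 2 + b2 ^+ 2) - c ^+ 2) * t1 =
      (p * (b1 ^+ 2 + b2 ^+ 2) - c * s) * a1 + (s * (a1 ^+ 2 + a2 ^+ 2) - c * p) * b1.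
      by rewrite /p /s /c; ring.
    by rewrite A B !mulr1.
  exact: fin E.
- have E : (1 - c ^+ 2) * t2 = (p - c * s) * a2 + (s - c * p) * b2.
    have : ((a1 ^+ 2 + a2 ^+ 2) * (b1 ^+ 2 + b2 ^+ 2) - c ^+ 2) * t2 =
      (p * (b1 ^+ 2 + b2 ^+ 2) - c * s) * a2 + (s * (a1 ^+ 2 + a2 ^+ 2) - c * p) * b2.
      by rewrite /p /s /c; ring.
    by rewrite A B !mulr1.
  exact: fin E.
Qed.

End PlaneCone.

(** * Separation of a point from the convex hull of a compact set *)

Section HullSeparation.
Variable R : realType.
Implicit Types (z t u a b x y : R[i]) (C K : set R[i]^o).

Lemma convex_set2 C x y (r : R) : convex_set C -> C x -> C y -> 0 <= r -> r <= 1 ->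
  C (r%:C * x + (1 - r)%:C * y).
Proof.
move=> cC Cx Cy r0 r1.
have rC0 : 0 <= r%:C :> R[i] by rewrite ler0c.
have rC1 : r%:C <= 1 :> R[i] by rewrite -[1]/(1%:C) lecR.
have := cC x y (Itv01 rC0 rC1) (mem_set Cx) (mem_set Cy).
rewrite inE /conv /=; congr (C _).
by rewrite /unstable.onem rmorphB.
Qed.

(** The relation makes [z] the barycentre of [a], [b], [t]. Grouping [a] with [b] reduces to two
    points, except when both their weights are 0, where [z = t]. *)
Lemma convex_set3 C z a b t (wa wb wt : R) : convex_set C -> C a -> C b -> C t ->
  0 <= wa -> 0 <= wb -> 0 < wt ->
  wa%:C * (z - a) + wb%:C * (z - b) + wt%:C * (z - t) = 0 -> C z.
Proof.
move=> cC Ca Cb Ct a0 b0 t0.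
have neqC (r : R) : 0 < r -> r%:C != 0 :> R[i].
  by move=> r0; apply/eqP => /complexI h; rewrite h ltxx in r0.
have [ab0|ab0] := eqVneq (wa + wb) 0.
  have -> : wa = 0 by lra.
  have -> : wb = 0 by lra.
  rewrite !mul0r !add0r => /eqP; rewrite mulf_eq0 (negbTE (neqC _ t0)) /=.
  by rewrite subr_eq0 => /eqP ->.
have ab_gt0 : 0 < wa + wb by rewrite lt_neqAle eq_sym ab0 addr_ge0.
pose y := (wa / (wa + wb))%:C * a + (1 - wa / (wa + wb))%:C * b.
have Cy : C y.
  apply: convex_set2 => //; first by rewrite divr_ge0// ltW.
  by rewrite ler_pdivrMr// mul1r lerDl.
have s_gt0 : 0 < wa + wb + wt by rewrite addr_gt0.
move=> E.
have -> : z = (wt / (wa + wb + wt))%:C * t + (1 - wt / (wa + wb + wt))%:C * y.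
  have n1 := neqC _ ab_gt0; have n2 := neqC _ s_gt0.
  rewrite /y !(rmorphB, rmorphM, rmorphD, fmorphV) /= in n1 n2 *.
  have -> : (1 : R)%:C = 1 by [].
  rewrite -[LHS](subr0) -(mul0r ((wa%:C + wb%:C + wt%:C : R[i])^-1)) -E.
  by field; rewrite n1 n2.
apply: convex_set2 => //; first by rewrite divr_ge0 ?ltW.
by rewrite ler_pdivrMr// mul1r lerDr addr_ge0.
Qed.

Lemma convex_hull_convex K : convex_set (convex_hull K).
Proof.
move=> x y l; rewrite !inE => hx hy C [cC KC].
by have := cC x y l (mem_set (hx _ (conj cC KC))) (mem_set (hy _ (conj cC KC)));
  rewrite inE.
Qed.

Lemma sub_convex_hull K : K `<=` convex_hull K.
Proof. by move=> x Kx C [_ KC]; exact: KC. Qed.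

Lemma compact_dist K z : compact K -> ~ K z ->
  exists2 d : R, 0 < d & forall t, K t -> d <= normc (z - t).
Proof.
move=> cK nKz; have : nbhs (z : R[i]^o) (~` K).
  apply: open_nbhs_nbhs; split => //; rewrite openC.
  by apply: compact_closed => //; exact: norm_hausdorff.
move=> /nbhs_complexP[d d0 dK]; exists d => // t Kt.
by rewrite leNgt normc_distC; apply/negP => /dK /(_ Kt).
Qed.

(* The extremal pair of directions of [K] seen from [z] has the smallest scalar
   product; its bisector separates. *)
Lemma hull_separation_weak K z : compact K -> K !=set0 -> ~ convex_hull K z ->
  exists u, forall t, K t -> 0 < complex.Re (u * (z - t)).
Proof.
move=> cK [t0 Kt0] hz.
have [d d0 dK] := compact_dist cK (fun Kz => hz (sub_convex_hull Kz)).
(* On [K], the conjugate of the unit direction from [t] to [z]; the truncated kernel makes it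
   continuous on the whole plane. *)
pose e t : R[i] := cauchy_kernel d z t * (normc (z - t))%:C.
have cz : ccont (fun t => z - t) by exact: (ccontB (ccont_cst z) (@ccont_id R)).
have ce : ccont e.
  exact: (ccontM (ccont_kernel z d0) (ccont_real (rcont_normc cz))).
have ne t : K t -> normc (e t) = 1.
  move=> /dK dt; rewrite normcM normc_kernel// normc_real ger0_norm ?normc_ge0//.
  by rewrite mulVf// gt_eqF// (lt_le_trans d0).
have ze t : K t -> z - t = (normc (z - t))%:C * (e t)^*%C.
  move=> /dK dt; rewrite /e cauchy_kernelE// conjcM conjc_real.
  have zt : 0 < normc (z - t) by rewrite (lt_le_trans d0).
  have zt0 : z - t != 0 by rewrite -normc_gt0.
  rewrite mulrA [_ * _^*%C]mulrC -mulrA.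
  have -> : (normc (z - t))%:C * (normc (z - t))%:C = (z - t) * (z - t)^*%C.
    by rewrite mulc_conj expr2 rmorphM.
  rewrite conjc_inv mulrCA mulVf ?mulr1//.
  by rewrite conjc_eq0.
clearbody e.
have [[cR] [cI]] := (rcont_Re ce, rcont_Im ce).
pose f (x : R[i]^o * R[i]^o) : R := complex.Re (e x.1) * complex.Re (e x.2) +
  complex.Im (e x.1) * complex.Im (e x.2).
have cf : continuous f.
  have h (g : R[i]^o -> R) : continuous g ->
      continuous (fun x : R[i]^o * R[i]^o => g x.1) /\
      continuous (fun x : R[i]^o * R[i]^o => g x.2).
    move=> cg; split => x.
      by apply: (@continuous_comp _ _ _ fst g); [exact: cvg_fst|exact: cg].
    by apply: (@continuous_comp _ _ _ snd g); [exact: cvg_snd|exact: cg].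
  have [r1 r2] := h _ cR; have [i1 i2] := h _ cI.
  by move=> x; exact: (cvgD (cvgM (r1 x) (r2 x)) (cvgM (i1 x) (i2 x))).
have cKK := compact_setX cK cK.
have [|[a b]] := compact_EVT_min _ cKK (continuous_subspaceT cf).
  by exists (t0, t0).
rewrite inE => -[/= Ka Kb] fmin.
have E1 t : K t -> complex.Re (e t) ^+ 2 + complex.Im (e t) ^+ 2 = 1.
  by move=> Kt; rewrite -sqr_normcE ne// expr1n.
have fE s t : f (s, t) = complex.Re (e s) * complex.Re (e t) +
  complex.Im (e s) * complex.Im (e t) by [].
have cH := @convex_hull_convex; have sH := @sub_convex_hull.
have npos t : K t -> 0 < (normc (z - t))^-1.
  by move=> /dK dt; rewrite invr_gt0 (lt_le_trans d0).
have zeV t : K t -> (normc (z - t))^-1%:C * (z - t) = (e t)^*%C.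
  move=> Kt; rewrite {2}ze// mulrA -rmorphM /= mulVf ?mul1r//.
  by rewrite -invr_eq0 gt_eqF// npos.
(* If the smallest scalar product were -1, the two directions would be opposite and [z] would lie on
   the segment from [a] to [b]. *)
have c1 : -1 < f (a, b).
  rewrite ltNge; apply/negP => c1; apply: hz.
  have eab : e a = - e b.
    have A := E1 _ Ka; have B := E1 _ Kb; rewrite fE in c1.
    have h : (complex.Re (e a) + complex.Re (e b)) ^+ 2 +
      (complex.Im (e a) + complex.Im (e b)) ^+ 2 <= 0 by nra.
    have := sqr_ge0 (complex.Re (e a) + complex.Re (e b)).
    have := sqr_ge0 (complex.Im (e a) + complex.Im (e b)) => k1 k2.
    have h1 : complex.Re (e a) + complex.Re (e b) = 0.
      by apply/eqP; rewrite -sqrf_eq0 eq_le k2 andbT; lra.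
    have h2 : complex.Im (e a) + complex.Im (e b) = 0.
      by apply/eqP; rewrite -sqrf_eq0 eq_le k1 andbT; lra.
    by apply: complex_eq; rewrite !ReImE; lra.
  apply: (convex_set3 (z := z) (cH K) (sH _ _ Ka) (sH _ _ Ka) (sH _ _ Kb)
    (lexx 0) (ltW (npos _ Ka)) (npos _ Kb)).
  by rewrite !zeV// eab mul0r add0r rmorphN /= addNr.
exists (e a + e b) => t Kt; rewrite ze//.
have -> : (e a + e b) * ((normc (z - t))%:C * (e t)^*%C) =
    ((e a + e b) * (e t)^*%C) * (normc (z - t))%:C by ring.
rewrite Re_mulc_real mulr_gt0//; last by rewrite -invr_gt0 npos.
(* A point [t] on the wrong side of the bisector would put [z] in the triangle [a], [b], [t], by
   minimality of the pair and [plane_cone]. *)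
rewrite ltNge; apply/negP => le0; apply: hz.
have ta : f (a, b) <= f (t, a) by apply: fmin; rewrite inE; split.
have tb : f (a, b) <= f (t, b) by apply: fmin; rewrite inE; split.
rewrite !fE in c1 ta tb.
have [|x [y [x0 y0 hR hI]]] := plane_cone (E1 _ Ka) (E1 _ Kb) (E1 _ Kt) c1 ta tb.
  by move: le0; rewrite !ReImE; lra.
apply: (convex_set3 (z := z) (cH K) (sH _ _ Ka) (sH _ _ Kb) (sH _ _ Kt)
  (mulr_ge0 x0 (ltW (npos _ Ka))) (mulr_ge0 y0 (ltW (npos _ Kb))) (npos _ Kt)).
rewrite !rmorphM /= -!mulrA !zeV//.
by apply: complex_eq; rewrite !ReImE /=; lra.
Qed.

Lemma hull_separation K z : compact K -> K !=set0 -> ~ convex_hull K z ->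
  exists u d, [/\ normc u <= 1, 0 < d &
    forall t, K t -> d <= complex.Re (u * (z - t))].
Proof.
move=> cK K0 hz; have [u uK] := hull_separation_weak cK K0 hz.
have u0 : 0 < normc u.
  have [t Kt] := K0; rewrite normc_gt0; apply/eqP => u0; have := uK _ Kt.
  by rewrite u0 mul0r ltxx.
have [cf] : rcont (fun t => complex.Re (u * (z - t))).
  apply: rcont_Re; apply: (ccontM (ccont_cst u)).
  exact: (ccontB (ccont_cst z) (@ccont_id R)).
have [t] := compact_EVT_min K0 cK (continuous_subspaceT cf).
rewrite inE => Kt tmin.
exists (u * (normc u)^-1%:C), (complex.Re (u * (z - t)) / normc u); split.
- by rewrite normcM normc_real ger0_norm ?invr_ge0 ?normc_ge0// divff// gt_eqF.
- by rewrite divr_gt0// uK.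
move=> v Kv; rewrite mulrAC Re_mulc_real ler_pM2r ?invr_gt0//.
by apply: tmin; rewrite inE.
Qed.

End HullSeparation.

(** * Maximum modulus principle for rational functions *)

Section MaximumModulus.
Variable R : realType.
Implicit Types (P Q S : {poly R[i]}) (a z w c : R[i]) (r M : R).

Lemma sqr_normcD z w : normc (z + w) ^+ 2 =
  normc z ^+ 2 + 2 * complex.Re (w * z^*%C) + normc w ^+ 2.
Proof. by rewrite !sqr_normcE !ReImE; ring. Qed.

(* A rational function [P / Q] is open: with [c] its value at [z] and
   [P - c Q = ('X - z)^m S], moving along an [m]-th root of [c Q(z) conj(S(z))]
   increases its modulus. *)
Lemma rational_increase P Q z r : 0 < r -> Q.[z] != 0 -> P.[z] != 0 ->
  P != (P.[z] / Q.[z]) *: Q ->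
  exists2 v, normc (v - z) < r & normc P.[z] * normc Q.[v] < normc P.[v] * normc Q.[z].
Proof.
move=> r0 Qz Pz PQ; set c := P.[z] / Q.[z] in PQ *.
have c0 : c != 0 by rewrite mulf_neq0 ?invr_eq0.
have D0 : P - c *: Q != 0 by rewrite subr_eq0.
have [m [S]] := multiplicity_XsubC (P - c *: Q) z; rewrite D0 /= => Sz DS.
have m0 : (0 < m)%N.
  case: m DS => // DS; move: Sz; rewrite -[S]mulr1 -(expr0 ('X - z%:P)) -DS.
  by rewrite /root hornerD hornerN hornerZ /c divfK// subrr eqxx.
have PE v : P.[v] = c * Q.[v] + (v - z) ^+ m * S.[v].
  rewrite -[LHS](subrK (c * Q.[v])) addrC; congr (_ + _).
  rewrite -hornerZ -hornerN -hornerD DS hornerM horner_exp hornerXsubC.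
  by rewrite mulrC.
pose W := c * Q.[z] * S.[z]^*%C; pose w : R[i] := m.-root W.
have wm : w ^+ m = W by rewrite rootCK.
pose h v := complex.Re (W * S.[v] * (c * Q.[v])^*%C).
have [ch] : rcont h.
  apply: rcont_Re; apply: (ccontM (ccontM (ccont_cst W) (ccont_horner S))).
  exact: (ccont_conj (ccontM (ccont_cst c) (ccont_horner Q))).
have hz : 0 < h z.
  have -> : h z = normc (c * Q.[z]) ^+ 2 * normc S.[z] ^+ 2.
    rewrite /h /W; set x := c * Q.[z].
    have -> : x * S.[z]^*%C * S.[z] * x^*%C = (x * x^*%C) * (S.[z] * S.[z]^*%C).
      by ring.
    by rewrite !mulc_conj Re_mulc_real.
  by rewrite mulr_gt0// exprn_gt0// normc_gt0// mulf_neq0.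
have : nbhs (z : R[i]^o) [set v | 0 < h v].
  apply: open_nbhs_nbhs; split => //.
  have -> : [set v : R[i]^o | 0 < h v] = h @^-1` [set y | 0 < y] by [].
  by apply: open_comp; [move=> v _; exact: ch|exact: open_gt].
move=> /nbhs_complexP[e e0 he].
have w1 : 0 < normc w + 1 by rewrite ltr_wpDl ?normc_ge0.
pose t := Num.min e r / (normc w + 1).
have er0 : 0 < Num.min e r by rewrite lt_min e0.
have t0 : 0 < t by rewrite divr_gt0.
pose v := z + t%:C * w.
have dv : normc (v - z) < Num.min e r.
  rewrite /v addrAC subrr add0r normcM normc_real gtr0_norm// /t.
  rewrite mulrAC ltr_pdivrMr// ltr_pM2l// ltrDl//.
have hv : 0 < h v by apply: he; apply: (lt_le_trans dv); rewrite ge_min lexx.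
exists v; first by apply: (lt_le_trans dv); rewrite ge_min lexx orbT.
have -> : normc P.[z] = normc c * normc Q.[z].
  by rewrite -normcM /c divfK.
rewrite mulrAC ltr_pM2r ?normc_gt0// -normcM.
rewrite -(@ltr_pXn2r _ 2)// ?nnegrE ?normc_ge0//.
rewrite PE sqr_normcD -addrA ltrDl ltr_pwDl ?sqr_ge0// mulr_gt0//.
have -> : (v - z) ^+ m = (t ^+ m)%:C * W.
  by rewrite /v addrAC subrr add0r exprMn wm rmorphXn.
have -> : (t ^+ m)%:C * W * S.[v] * (c * Q.[v])^*%C =
  (W * S.[v] * (c * Q.[v])^*%C) * (t ^+ m)%:C by ring.
by rewrite Re_mulc_real mulr_gt0// exprn_gt0.
Qed.

(** [|P / Q|] attains its maximum on the closed disc. At an interior point where it is nonzero,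
    [rational_increase] contradicts maximality unless [P / Q] is constant, and a constant is
    controlled on the circle. *)
Lemma rational_maximum_modulus P Q a r M : 0 < r ->
  (forall z, normc (z - a) <= r -> Q.[z] != 0) ->
  (forall z, normc (z - a) = r -> normc P.[z] <= M * normc Q.[z]) ->
  forall z, normc (z - a) <= r -> normc P.[z] <= M * normc Q.[z].
Proof.
move=> r0 Q0 PM z az.
pose D : set R[i]^o := [set v | normc (v - a) <= r].
pose f (v : R[i]^o) : R := normc P.[v] * (normc Q.[v])^-1.
have [cP] := rcont_normc (ccont_horner P).
have [cQ] := rcont_normc (ccont_horner Q).
have nQ v : D v -> 0 < normc Q.[v] by move=> /Q0; rewrite normc_gt0.
have cf : {within D, continuous f}.
  apply: continuous_in_subspaceT => v; rewrite inE => Dv.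
  have Qv : normc Q.[v] != 0 by rewrite gt_eqF// nQ.
  exact: (cvgM (cP v) (cvgV Qv (cQ v))).
(* A point of the circle: it yields [0 <= M] and settles the case of a constant quotient. *)
pose b := a + r%:C.
have b_a : normc (b - a) = r.
  by rewrite /b addrAC subrr add0r normc_real gtr0_norm.
have Db : D b by rewrite /D /= b_a.
have M0 : 0 <= M.
  by rewrite -(pmulr_lge0 _ (nQ _ Db)); apply: le_trans (PM _ b_a); exact: normc_ge0.
have [|v] := compact_EVT_max _ (@compact_disc R a r) cf; first by exists b.
rewrite inE => Dv vmax.
have fM : f v <= M -> normc P.[z] <= M * normc Q.[z].
  move=> fvM; rewrite -ler_pdivrMr ?nQ//; apply: le_trans fvM.
  by apply: vmax; rewrite inE.
apply: fM; have [va|va] := eqVneq (normc (v - a)) r.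
  by rewrite /f ler_pdivrMr ?nQ// PM.
have va' : normc (v - a) < r by rewrite lt_neqAle va.
have [Pv|Pv] := eqVneq P.[v] 0; first by rewrite /f Pv normc0 mul0r.
have [PQ|PQ] := eqVneq P ((P.[v] / Q.[v]) *: Q).
  have -> : f v = f b.
    rewrite /f PQ !hornerZ !normcM !mulfK ?gt_eqF ?nQ//.
  by rewrite /f ler_pdivrMr ?nQ// PM.
have rv : 0 < r - normc (v - a) by rewrite subr_gt0.
have [u uv] := rational_increase rv (Q0 _ Dv) Pv PQ.
have Du : D u.
  rewrite /D /= -[u - a]/(u - a : R[i]) -(subrK v u) -addrA.
  by apply: le_trans (normc_le_add _ _) _; rewrite -lerBrDr ltW.
rewrite ltNge -[X in ~~ X]/(_ <= _) => /negP[].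
have := vmax u; rewrite inE => /(_ Du); rewrite /f.
by rewrite ler_pdivrMr ?nQ// mulrAC ler_pdivlMr ?nQ.
Qed.

End MaximumModulus.

(** * The Riemann sphere *)

Section Sphere.
Variable R : realType.
Implicit Types (z : R[i]) (w : sphere R) (A U : set (sphere R)) (S : set R[i]^o).

Lemma nbhs_someP z A :
  nbhs (in_sphere z) A <-> exists2 e : R, 0 < e & forall v, normc (v - z) < e -> A (in_sphere v).
Proof. exact: (@nbhs_complexP R z (Some @^-1` A)). Qed.

Lemma nbhs_inftyP A : nbhs (infty : sphere R) A <->
  A infty /\ exists M : R, forall v, M < normc v -> A (in_sphere v).
Proof.
split.
  move=> [C [cC _] CA]; have [M M0 CM] := compact_normc_bounded cC.
  split; first by apply: CA; right.
  exists M => v Mv; apply: CA; left; exists v => // /CM.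
  by rewrite leNgt Mv.
move=> [Ai [M AM]]; exists [set v | normc (v - 0) <= M].
  by split; [exact: compact_disc|exact: closed_disc].
move=> _ [[v /= Mv <-]|->] //; apply: AM.
by move/negP: Mv; rewrite -ltNge subr0.
Qed.

Lemma dnbhs_inftyP A : (infty : sphere R)^' A <->
  exists M : R, forall v, M < normc v -> A (in_sphere v).
Proof.
split=> [|[M MA]].
  by move=> /nbhs_inftyP[_ [M MA]]; exists M => v /MA; exact.
apply/nbhs_inftyP; split; first by move=> /eqP.
by exists M => v Mv _; exact: MA.
Qed.

#[global] Instance dnbhs_infty_proper : ProperFilter (infty : sphere R)^'.
Proof.
apply: Build_ProperFilter_ex => [A /dnbhs_inftyP[M MA]].
exists (in_sphere (`|M| + 1)%:C); apply: MA.
rewrite normc_real ger0_norm ?addr_ge0//.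
by rewrite (le_lt_trans (ler_norm _))// ltrDl.
Qed.

Definition sphere_fun (K : numFieldType) (f : R[i] -> K) (v : sphere R) : K^o :=
  if v is Some z then f z else 0.

(** Carries non-strict estimates from finite points to infinity. Convergence has to be assumed,
    since [lim] says nothing about a divergent function. *)
Lemma extend_infty_closed (K : numFieldType) (f : R[i] -> K) (D : set K^o) :
  cvg (sphere_fun f v @[v --> (infty : sphere R)^']) -> closed D ->
  (exists M : R, forall z, M < normc z -> D (f z)) -> D (extend_infty f infty).
Proof.
move=> cf cD MD; apply: (closed_cvg _ cD _ _ cf).
by apply/dnbhs_inftyP; exact: MD.
Qed.

Lemma horner_infty (P : {poly R[i]}) n : (size P <= n.+1)%N ->
  sphere_fun (fun z => P.[z] / z ^+ n) v @[v --> (infty : sphere R)^'] --> (P`_n : R[i]^o).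
Proof.
move=> sP; apply/cvg_complexP => e e0; apply/dnbhs_inftyP.
pose s := \sum_(i < n) normc P`_i.
have s0 : 0 <= s by apply: sumr_ge0 => i _; exact: normc_ge0.
(* [|z| > 1] bounds each lower term by its coefficient over [|z|], and [|z| > s / e] makes their sum
   less than [e]. *)
exists (1 + s / e) => z Mz /=.
have z1 : 1 < normc z by apply: le_lt_trans Mz; rewrite lerDl divr_ge0// ltW.
have zs : s / e < normc z by apply: le_lt_trans Mz; rewrite lerDr.
have z_gt0 : 0 < normc z by apply: lt_trans z1.
have z0 : z != 0 by rewrite -normc_gt0.
rewrite (horner_coef_wide _ sP) big_ord_recr /= mulrDl mulfK ?expf_neq0//.
rewrite addrK mulr_suml; apply: le_lt_trans (normc_sum _ _ _) _.
apply: (@le_lt_trans _ _ (s / normc z)).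
  rewrite /s mulr_suml; apply: ler_sum => i _.
  rewrite !normcM normcV !normcX -mulrA ler_wpM2l ?normc_ge0//.
  have -> : normc z ^+ i / normc z ^+ n = (normc z ^+ (n - i))^-1.
    have -> : normc z ^+ n = normc z ^+ (n - i) * normc z ^+ i.
      by rewrite -exprD subnK// ltnW.
    rewrite invfM mulrCA divff ?mulr1//.
    by rewrite expf_neq0// gt_eqF.
  rewrite lef_pV2 ?posrE ?exprn_gt0//.
  have := ltn_ord i; rewrite -subn_gt0; case: (n - i)%N => // k _.
  by rewrite exprS ler_peMr ?(ltW z_gt0)// exprn_ege1// ltW.
by rewrite ltr_pdivrMr// mulrC -ltr_pdivrMr.
Qed.

Lemma cvg_ratio_infty (K : numFieldType) (f g h : R[i] -> K) (a b : K^o) : b != 0 ->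
  (forall z, z != 0 -> h z != 0) ->
  sphere_fun (fun z => f z / h z) v @[v --> (infty : sphere R)^'] --> a ->
  sphere_fun (fun z => g z / h z) v @[v --> (infty : sphere R)^'] --> b ->
  cvg (sphere_fun (fun z => f z / g z) v @[v --> (infty : sphere R)^']).
Proof.
move=> b0 h0 fa gb; apply/cvg_ex; exists (a * b^-1 : K^o).
have fgab := cvgM fa (cvgV b0 gb).
have E : \forall v \near (infty : sphere R)^',
    sphere_fun (fun z => f z / h z) v * (sphere_fun (fun z => g z / h z) v)^-1
    = sphere_fun (fun z => f z / g z) v.
  apply/dnbhs_inftyP; exists 0 => z z0.
  have hz : h z != 0 by apply: h0; rewrite -normc_gt0.
  by rewrite /= invfM invrK mulrACA mulVf ?mulr1.
have E' := near_eq_cvg E.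
by apply: cvg_trans; [exact: E'|exact: fgab].
Qed.

(** A common rank [N] on a neighbourhood of each point suffices: finitely many such neighbourhoods
    cover a compact set, which is the near-covering form of compactness. *)
Lemma uniform_of_local (K : numFieldType) U (f : nat -> sphere R -> K^o)
    (l : sphere R -> K^o) :
  (forall w, U w -> forall e : K, 0 < e ->
     exists N : nat, \forall v \near w, forall n, (N <= n)%N -> `|l v - f n v| < e) ->
  cvg_unif_compacts U f l.
Proof.
move=> H A cA AU; move=> B /uniform_nbhs[E [entE EB]].
have := entE; rewrite -entourage_ballE => -[e /= e0 eE].
suff : \forall n \near \oo, A `<=` (fun v => `|l v - f n v| < e).
  by apply: filterS => n hn; apply: EB => v Av; apply: eE; exact: hn.
move/compact_near_coveringP : cA; apply => w Aw.
have [N HN] := H w (AU _ Aw) e e0.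
exists ([set v | forall n, (N <= n)%N -> `|l v - f n v| < e], [set n | (N <= n)%N]).
  by split => //=; exists N.
by move=> [v n] /= [hv hn]; exact: hv.
Qed.

Lemma unbounded_component_locally_constant S (P : sphere R -> Prop) :
  (forall w, (~` (in_sphere @` S)) w ->
     \forall v \near w, (~` (in_sphere @` S)) v /\ (P v <-> P w)) ->
  forall w, unbounded_component S w -> (P w <-> P infty).
Proof.
move=> loc; set T := ~` (in_sphere @` S) in loc *.
have cO := @component_connected _ T infty.
have sub := @connected_component_sub _ T infty.
have Ti : T infty by move=> [z _].
(* Abstracting over [Q] treats the set and its complement at once. *)
have op (Q : Prop -> Prop) : (forall p q : Prop, (p <-> q) -> Q p -> Q q) ->
    open [set w | T w /\ Q (P w)].
  move=> QE; rewrite openE => w [Tw Qw]; rewrite /interior.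
  apply: filterS (loc w Tw) => v [Tv Pvw]; split => //.
  by apply: QE Qw; exact: iff_sym.
have op1 := op (fun p => p <-> P infty) _.
have op2 := op (fun p => ~ (p <-> P infty)) _.
have -> // : unbounded_component S = unbounded_component S `&` [set w | T w /\ (P w <-> P infty)].
2: by move=> w [_ [_]].
apply/esym/cO.
- exists infty; split; last by split.
  exact: connected_component_refl.
- exists [set w | T w /\ (P w <-> P infty)] => //.
  by apply: op1 => p q pq; rewrite pq.
- exists (~` [set w | T w /\ ~ (P w <-> P infty)]).
    by rewrite closedC; apply: op2 => p q pq; rewrite pq.
  apply/seteqP; split => w [Ow] /=.
    by move=> [_ h]; split => // -[].
  move=> h; split => //; split; first exact: sub.
  by apply: contrapT => h'; apply: h; split => //; exact: sub.
Qed.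

End Sphere.

(** * Polynomial approximation of resolvents *)

Section Resolvent.
Variable R : realType.
Implicit Types (S : set R[i]^o) (z t x : R[i]) (d e : R) (q : {poly R[i]}).

Lemma exists_half_pow (c e : R) : 0 < e -> exists m : nat, c * (2^-1) ^+ m <= e.
Proof.
move=> e0; have [c0|c0] := leP c 0.
  by exists 0%N; rewrite expr0 mulr1 (le_trans c0)// ltW.
have ce : 0 <= c / e by rewrite divr_ge0// ltW.
exists (Num.bound (c / e)); set m := Num.bound _.
have h1 : c / e < m%:R by exact: archi_boundP.
have h2 : (m%:R : R) <= 2 ^+ m by rewrite -natrX ler_nat ltnW// ltn_expl.
rewrite exprVn ler_pdivrMr ?exprn_gt0// mulrC -ler_pdivrMr//.
exact: le_trans (ltW h1) h2.
Qed.

Lemma normc_sub_pow (x : R[i]) k : normc x <= 1 ->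
  normc (1 - (1 - x) ^+ k) <= 2 ^+ k * normc x.
Proof.
(* The constants [2^k - 1] satisfy the recursion [a_(k+1) = 2 a_k + 1] of the inductive step. *)
move=> x1; suff : normc (1 - (1 - x) ^+ k) <= (2 ^+ k - 1) * normc x.
  by move/le_trans; apply; rewrite ler_wpM2r ?normc_ge0// lerBlDr lerDl.
elim: k => [|k IH]; first by rewrite !expr0 !subrr mul0r normc0.
have -> : 1 - (1 - x) ^+ k.+1 = (1 - (1 - x) ^+ k) * (1 - x) + x.
  by rewrite exprSr; ring.
apply: le_trans (normc_le_add _ _) _; rewrite normcM.
have h : normc (1 - x) <= 2.
  by apply: le_trans (normc_le_add _ _) _; rewrite normc1 normc_opp; lra.
have := normc_ge0 x; have := normc_ge0 (1 - (1 - x) ^+ k) => h1 h2.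
apply: (@le_trans _ _ ((2 ^+ k - 1) * normc x * 2 + normc x)).
  by rewrite lerD2r; apply: ler_pM => //; exact: normc_ge0.
by rewrite exprS; lra.
Qed.

Definition geometric_poly (h : R[i]) (m : nat) : {poly R[i]} :=
  \sum_(j < m) (- h) ^+ j *: 'X^j.

(* With [x = - h / (z - t)], a geometric sum of ratio [x] leaves the relative
   error [x ^ m] on [1 / (z + h - t)]. *)
Lemma geometric_polyE (h z t : R[i]) m : z - t != 0 -> z + h - t != 0 ->
  (z - t)^-1 * (geometric_poly h m).[(z - t)^-1] =
  (z + h - t)^-1 * (1 - (- h / (z - t)) ^+ m).
Proof.
move=> zt zht; set x := - h / (z - t).
have -> : (geometric_poly h m).[(z - t)^-1] = \sum_(j < m) x ^+ j.
  rewrite horner_sum; apply: eq_bigr => j _.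
  by rewrite hornerZ hornerXn exprMn.
have E : (z - t)^-1 * (z + h - t) = 1 - x by rewrite /x; field.
apply: (mulfI zht); rewrite mulrA mulrA divff// mul1r.
by rewrite [(z + h - t) * _]mulrC E -opprB mulNr -subrX1 opprB.
Qed.

(** The ratio of the geometric series is at most [1 / 2] on [S]. The outer factor [(z - t)^-1]
    matters: the approximant has no constant term as a polynomial in the resolvent, and only moments
    of positive order can vanish in the limit, that of order 0 being 1. *)
Lemma resolvent_approx S z z' d k e : 0 < d -> (forall t, S t -> d <= normc (z - t)) ->
  normc (z' - z) <= d / 2 -> 0 < e ->
  exists q, forall t, S t ->
    normc ((z' - t)^-1 ^+ k.+1 - (z - t)^-1 * q.[(z - t)^-1]) <= e.
Proof.
move=> d0 dS zz' e0; set h := z' - z in zz'.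
(* The first factor bounds the power of the resolvent at [z'], as [|z' - t| >= d / 2]; the second is
   the loss in [normc_sub_pow]. *)
have [m hm] := exists_half_pow ((d / 2)^-1 ^+ k.+1 * 2 ^+ k.+1) e0.
exists ('X^k * geometric_poly h m ^+ k.+1) => t St.
have dt := dS _ St; have zt0 : 0 < normc (z - t) by rewrite (lt_le_trans d0).
have z't : d / 2 <= normc (z' - t).
  have -> : z' - t = (z - t) - (z - z') by ring.
  apply: le_trans (normc_le_sub _ _); rewrite [normc (z - z')]normc_distC -/h.
  by move: zz'; lra.
have d20 : 0 < d / 2 by rewrite divr_gt0.
have zt : z - t != 0 by rewrite -normc_gt0.
have z'h : z' = z + h by rewrite /h; ring.
have z't0 : z + h - t != 0 by rewrite -z'h -normc_gt0 (lt_le_trans d20).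
set x := - h / (z - t).
have xm : normc (x ^+ m) <= (2^-1) ^+ m.
  rewrite normcX; apply: lerXn2r; rewrite ?nnegrE ?normc_ge0 ?invr_ge0//.
  rewrite /x normcM normcV normc_opp ler_pdivrMr//.
  by apply: le_trans zz' _; lra.
have -> : (z - t)^-1 * ('X^k * geometric_poly h m ^+ k.+1).[(z - t)^-1] =
   ((z' - t)^-1 * (1 - x ^+ m)) ^+ k.+1.
  rewrite hornerM hornerXn horner_exp mulrA -exprS -exprMn geometric_polyE//.
  by rewrite z'h.
rewrite exprMn -{1}[_^-1 ^+ _]mulr1 -mulrBr normcM !normcX normcV.
apply: le_trans hm; rewrite -mulrA; apply: ler_pM.
- by rewrite exprn_ge0// invr_ge0 normc_ge0.
- exact: normc_ge0.
- apply: lerXn2r; rewrite ?nnegrE ?invr_ge0 ?normc_ge0 ?(ltW d20)//.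
  by rewrite lef_pV2 ?posrE// (lt_le_trans d20).
apply: le_trans (normc_sub_pow _ _) _.
  by apply: le_trans xm _; rewrite exprn_ile1// ?invr_ge0// invf_le1 ?ler1n.
by rewrite ler_wpM2l ?exprn_ge0.
Qed.

End Resolvent.

(** * Runge's theorem for resolvents with pole in the unbounded component *)

Section Runge.
Variables (R : realType) (S : set R[i]^o).
Hypothesis cS : compact S.
Implicit Types (f g : R[i] -> R[i]) (z : R[i]).

Definition poly_approx f := forall e : R, 0 < e ->
  exists Q : {poly R[i]}, forall t, S t -> normc (f t - Q.[t]) <= e.

Lemma horner_bounded (Q : {poly R[i]}) :
  exists2 B : R, 0 < B & forall t, S t -> normc Q.[t] <= B.
Proof.
have [S0|/set0P S0] := eqVneq S set0; first by exists 1 => // t; rewrite S0.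
have [cQ] := rcont_normc (ccont_horner Q).
have [c _ cm] := compact_EVT_max S0 cS (continuous_subspaceT cQ).
exists (normc Q.[c] + 1); first by rewrite ltr_wpDl ?normc_ge0.
by move=> t St; rewrite (le_trans (cm t _)) ?inE// lerDl.
Qed.

Lemma poly_approx_eq f g : (forall t, S t -> f t = g t) ->
  poly_approx f -> poly_approx g.
Proof. by move=> fg af e /af[Q h]; exists Q => t St; rewrite -fg// h. Qed.

Lemma poly_approx_horner (Q : {poly R[i]}) : poly_approx (horner Q).
Proof. by move=> e e0; exists Q => t _; rewrite subrr normc0 ltW. Qed.

Lemma poly_approxD f g : poly_approx f -> poly_approx g ->
  poly_approx (fun t => f t + g t).
Proof.
move=> af ag e e0; have e2 : 0 < e / 2 by rewrite divr_gt0.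
have [P hP] := af _ e2; have [Q hQ] := ag _ e2.
exists (P + Q) => t St; rewrite hornerD opprD addrACA [e]splitr.
by apply: le_trans (normc_le_add _ _) _; rewrite lerD ?hP ?hQ.
Qed.

Lemma poly_approxM f g : poly_approx f -> poly_approx g ->
  poly_approx (fun t => f t * g t).
Proof.
(* [g] is known only through its approximants: one at distance 1 bounds it by [B + 1], which fixes
   the precision for [f]; a bound on the resulting [P] then fixes the precision for [g]. *)
move=> af ag e e0; have [Q0 hQ0] := ag 1 ltr01.
have [B B0 hB] := horner_bounded Q0.
have [P hP] := af (e / 2 / (B + 1)) ltac:(by rewrite !divr_gt0// addr_gt0).
have [C C0 hC] := horner_bounded P.
have [Q hQ] := ag (e / 2 / C) ltac:(by rewrite !divr_gt0).
exists (P * Q) => t St.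
have -> : f t * g t - (P * Q).[t] =
    (f t - P.[t]) * g t + P.[t] * (g t - Q.[t]) by rewrite hornerM; ring.
apply: le_trans (normc_le_add _ _) _; rewrite !normcM [e]splitr.
have gB : normc (g t) <= B + 1.
  rewrite -[g t](subrK Q0.[t]) addrC.
  by apply: le_trans (normc_le_add _ _) _; rewrite lerD ?hB ?hQ0.
apply: lerD.
  rewrite -[leRHS](@divfK _ (B + 1)); last by rewrite gt_eqF// addr_gt0.
  by apply: ler_pM; rewrite ?normc_ge0 ?hP.
rewrite mulrC -[leRHS](@divfK _ C); last by rewrite gt_eqF.
by apply: ler_pM; rewrite ?normc_ge0 ?hQ ?hC.
Qed.

Lemma poly_approx_comp f (q : {poly R[i]}) : poly_approx f ->
  poly_approx (fun t => q.[f t]).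
Proof.
move=> af; elim/poly_ind: q => [|q c IH].
  apply: poly_approx_eq (poly_approx_horner 0) => t _.
  by rewrite !horner0.
apply: poly_approx_eq (poly_approxD (poly_approxM IH af) (poly_approx_horner c%:P)).
by move=> t _; rewrite hornerMXaddC hornerC.
Qed.

Lemma poly_approx_lim f :
  (forall e : R, 0 < e -> exists2 g, poly_approx g &
     forall t, S t -> normc (f t - g t) <= e) -> poly_approx f.
Proof.
move=> h e e0; have e2 : 0 < e / 2 by rewrite divr_gt0.
have [g ag fg] := h _ e2; have [Q gQ] := ag _ e2.
exists Q => t St; have -> : f t - Q.[t] = (f t - g t) + (g t - Q.[t]) by ring.
rewrite [e]splitr.
by apply: le_trans (normc_le_add _ _) _; rewrite lerD ?fg ?gQ.
Qed.

Lemma resolvent_poly_approx_step z z' (d : R) : 0 < d ->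
  (forall t, S t -> d <= normc (z - t)) -> normc (z' - z) <= d / 2 ->
  poly_approx (fun t => (z - t)^-1) -> poly_approx (fun t => (z' - t)^-1).
Proof.
move=> d0 dS zz' az; apply: poly_approx_lim => e e0.
have [q hq] := resolvent_approx 0 d0 dS zz' e0.
exists (fun t => (z - t)^-1 * q.[(z - t)^-1]).
  exact: (poly_approxM az (poly_approx_comp q az)).
by move=> t St; have := hq _ St; rewrite expr1.
Qed.

(** The radius [d / 3] allows a propagation step both ways: it is at most [d / 2] when leaving [z],
    and exactly half of the distance [2 d / 3] guaranteed at [v] when coming back. *)
Lemma outside_near z : ~ S z -> exists d : R, [/\ 0 < d,
  forall t, S t -> d <= normc (z - t) &
  forall v, normc (v - z) < d / 3 -> forall t, S t -> 2 / 3 * d <= normc (v - t)].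
Proof.
move=> nSz; have [d d0 dS] := compact_dist cS nSz; exists d; split => // v vz t St.
have -> : v - t = (z - t) - (z - v) by ring.
apply: le_trans (normc_le_sub _ _); rewrite [normc (z - v)]normc_distC.
have := dS _ St; lra.
Qed.

(** Turns a one-way step, whose length is relative to the distance to [S], into an equivalence with
    infinity. It serves both for Runge's theorem and for the moments along an ultrafilter. *)
Lemma sphere_locally_constant (P : sphere R -> Prop) :
  (forall z z' (d : R), 0 < d -> (forall t, S t -> d <= normc (z - t)) ->
     normc (z' - z) <= d / 2 -> P (in_sphere z) -> P (in_sphere z')) ->
  (exists M : R, forall z, M < normc z -> P (in_sphere z) <-> P infty) ->
  forall w, unbounded_component S w -> (P w <-> P infty).
Proof.
move=> step [M hM]; apply: unbounded_component_locally_constant.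
have [MS MS0 hMS] := compact_normc_bounded cS.
case=> [z|]; rewrite -?/(in_sphere _) -?/infty => nS.
  have [d [d0 dS near_d]] : exists d : R, [/\ 0 < d,
      forall t, S t -> d <= normc (z - t) &
      forall v, normc (v - z) < d / 3 -> forall t, S t -> 2 / 3 * d <= normc (v - t)].
    by apply: outside_near => Sz; apply: nS; exists z.
  apply/nbhs_someP; exists (d / 3); first by rewrite divr_gt0.
  move=> v vz; have vd := near_d _ vz; split.
    move=> [s Ss [sv]]; have := vd _ Ss; rewrite sv subrr normc0; lra.
  split; last by apply: (step _ _ d) => //; lra.
  apply: (step _ _ (2 / 3 * d)) => //; first by lra.
  by rewrite normc_distC; lra.
apply/nbhs_inftyP; split => //; exists (Num.max M MS) => v.
rewrite gt_max => /andP[Mv MSv]; split; last exact: hM.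
by move=> [s Ss [sv]]; have := hMS _ Ss; rewrite sv leNgt MSv.
Qed.

(** Pole pushing: the property spreads over the component, and near infinity it is the expansion of
    the resolvent in powers of [t / v]. The value [True] at infinity records the latter. *)
Lemma runge z : unbounded_component S (in_sphere z) ->
  poly_approx (fun t => (z - t)^-1).
Proof.
pose P (w : sphere R) := if w is Some v then poly_approx (fun t => (v - t)^-1) else True.
move=> Oz; suff : P (in_sphere z) <-> P infty by move=> [_]; apply.
apply: sphere_locally_constant Oz; first exact: resolvent_poly_approx_step.
have [M M0 hM] := compact_normc_bounded cS.
(* Beyond [2 M] one has [|t / v| <= 1 / 2] and [|v - t| >= M] on [S]. *)
exists (2 * M) => v Mv; split => // _ e e0.
have v0 : 0 < normc v by apply: lt_trans Mv; rewrite mulr_gt0.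
have vn0 : v != 0 by rewrite -normc_gt0.
have [m hm] := exists_half_pow (M^-1) e0.
pose Q : {poly R[i]} := v^-1 *: \sum_(j < m) (v^-1) ^+ j *: 'X^j.
exists Q => t St; have tM := hM _ St.
have vt : M <= normc (v - t) by have := normc_le_sub v t; lra.
have vt0 : v - t != 0 by rewrite -normc_gt0 (lt_le_trans M0).
have QE : Q.[t] = (v - t)^-1 * (1 - (t / v) ^+ m).
  rewrite /Q hornerZ horner_sum.
  under eq_bigr do rewrite hornerZ hornerXn -exprMn mulrC.
  apply: (mulfI vt0); rewrite [in RHS]mulrA divff// mul1r mulrA.
  have -> : (v - t) * v^-1 = 1 - t / v by field.
  by rewrite -opprB mulNr -subrX1 opprB.
have -> : (v - t)^-1 - Q.[t] = (v - t)^-1 * (t / v) ^+ m by rewrite QE; ring.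
rewrite normcM normcV normcX normcM normcV; apply: le_trans hm.
apply: ler_pM; rewrite ?invr_ge0 ?normc_ge0 ?exprn_ge0 ?mulr_ge0 ?invr_ge0 ?normc_ge0//.
  by rewrite lef_pV2 ?posrE// (lt_le_trans M0).
apply: lerXn2r; rewrite ?nnegrE ?invr_ge0 ?mulr_ge0 ?invr_ge0 ?normc_ge0//.
by rewrite ler_pdivrMr//; lra.
Qed.

(** If [G] approximates [1 / (z - t)] on [S], then [1 - (z - t) G] is small on [S] and equal to 1 at
    [z]. Renormalising it at nearby points keeps the degree bound [m] uniform around [w]. *)
Lemma small_polynomial w (eta : R) : 0 < eta -> unbounded_component S w ->
  exists m : nat, \forall v \near w, forall z, v = in_sphere z ->
    exists Q : {poly R[i]}, [/\ (size Q <= m.+1)%N, Q.[z] = 1 &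
      forall t, S t -> normc Q.[t] <= eta].
Proof.
move=> eta0; have [M M0 hM] := compact_normc_bounded cS.
case: w => [z|] Ow; last first.
  (* Near infinity the linear polynomial [t / v] is already small on [S]. *)
  exists 1%N; apply/nbhs_inftyP; split => //; exists (M / eta) => v Mv _ [<-].
  have v0 : 0 < normc v by apply: lt_trans Mv; rewrite divr_gt0.
  have vn0 : v != 0 by rewrite -normc_gt0.
  exists (v^-1 *: 'X); split.
  - by apply: (leq_trans (size_scale_leq _ _)); rewrite size_polyX.
  - by rewrite hornerZ hornerX mulVf.
  move=> t St; rewrite hornerZ hornerX normcM normcV mulrC ler_pdivrMr//.
  by rewrite (le_trans (hM _ St))// mulrC -ler_pdivrMr// ltW.
have zM : 0 < normc z + M by rewrite ltr_wpDl ?normc_ge0.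
have [G hG] := runge Ow (e := eta / 2 / (normc z + M)) ltac:(by rewrite !divr_gt0).
pose H : {poly R[i]} := 1 - (z%:P - 'X) * G.
have Hz : H.[z] = 1 by rewrite /H !hornerE subrr mul0r subr0.
have nSz t : S t -> z - t != 0.
  move=> St; apply/eqP => /eqP; rewrite subr_eq0 => /eqP zt.
  have := connected_component_sub Ow; apply; exists t => //.
  by rewrite zt.
have HS t : S t -> normc H.[t] <= eta / 2.
  move=> St; have -> : H.[t] = (z - t) * ((z - t)^-1 - G.[t]).
    by rewrite /H !hornerE mulrBr divff ?nSz.
  rewrite normcM; apply: (@le_trans _ _ ((normc z + M) * (eta / 2 / (normc z + M)))).
    apply: ler_pM; rewrite ?normc_ge0 ?hG//.
    apply: le_trans (normc_le_add _ _) _; rewrite normc_opp lerD2l; exact: hM.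
  by rewrite mulrC divfK// gt_eqF.
exists (size H).
have [cH] := rcont_normc (ccont_horner H).
(* Dividing by [H(v)] costs at most a factor 2, whence the bound [eta / 2] on [H]. *)
have : nbhs (z : R[i]^o) [set v | 2^-1 < normc H.[v]].
  apply: open_nbhs_nbhs; split; last by rewrite /= Hz normc1 invf_lt1 ?ltr1n.
  have -> : [set v : R[i]^o | 2^-1 < normc H.[v]] =
    (fun v : R[i]^o => normc H.[v]) @^-1` [set y | 2^-1 < y] by [].
  by apply: open_comp; [move=> v _; exact: cH|exact: open_gt].
move=> /nbhs_complexP[e e0 he].
apply/nbhs_someP; exists e => // v /he /= Hv _ [<-].
have Hv0 : H.[v] != 0 by rewrite -normc_gt0; apply: lt_trans Hv; rewrite invr_gt0.
exists (H.[v]^-1 *: H); split.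
- by apply: (leq_trans (size_scale_leq _ _)).
- by rewrite hornerZ mulVf.
move=> t St; rewrite hornerZ normcM normcV mulrC ler_pdivrMr ?normc_gt0//.
by apply: le_trans (HS _ St) _; rewrite ler_pM2l// ltW.
Qed.

End Runge.

(** * Moments along an ultrafilter *)

Section VanishingMoments.
Variables (R : realType) (mu : {finite_measure set (borelC R) -> \bar R}).
Variable S : set R[i]^o.
Hypothesis muS : carried mu S.
Hypothesis posdef : forall p : {poly R[i]}, p != 0 -> 0 < sqnorm mu (horner p).
Local Notation p := (orthopoly mu).
Implicit Types (f g h : R[i] -> R[i]) (a z : R[i]) (d e : R) (q : {poly R[i]}).

Definition moment n f := cint mu (fun t => f t * ((p n).[t] * ((p n).[t])^*%C)).

Let ccont_weight n : ccont (fun t => (p n).[t] * ((p n).[t])^*%C).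
Proof. exact: (ccontM (ccont_horner _) (ccont_conj (ccont_horner _))). Qed.

Lemma momentD n f g : ccont f -> ccont g ->
  moment n (fun t => f t + g t) = moment n f + moment n g.
Proof.
move=> cf cg; rewrite /moment -(cintD muS (ccontM cf (ccont_weight n)) (ccontM cg (ccont_weight n))).
by apply: eq_cint => t; rewrite mulrDl.
Qed.

Lemma momentZ n c f : ccont f -> moment n (fun t => c * f t) = c * moment n f.
Proof.
move=> cf; rewrite /moment -(cintZ muS _ (ccontM cf (ccont_weight n))).
by apply: eq_cint => t; rewrite mulrA.
Qed.

Lemma moment_le n f e : 0 <= e -> ccont f -> (forall t, S t -> normc (f t) <= e) ->
  normc (moment n f) <= e.
Proof.
move=> e0 cf fe; have := Cauchy_Schwarz muS e0 (ccont_horner (p n)) (ccont_horner (p n)) cf fe.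
by rewrite (L2norm_orthopoly muS posdef) !mulr1.
Qed.

Lemma ccontX f k : ccont f -> ccont (fun t => f t ^+ k).
Proof.
move=> cf; elim: k => [|k IH]; first exact: ccont_cst.
rewrite (_ : (fun t => _) = fun t => f t * f t ^+ k); first exact: ccontM.
by apply/funext => t; rewrite exprS.
Qed.

Lemma ccont_horner_comp q f : ccont f -> ccont (fun t => q.[f t]).
Proof.
move=> cf; elim/poly_ind: q => [|q c IH].
  rewrite (_ : (fun t => _) = fun=> 0); first exact: ccont_cst.
  by apply/funext => t; rewrite horner0.
rewrite (_ : (fun t => _) = fun t => q.[f t] * f t + c).
  exact: (ccontD (ccontM IH cf) (ccont_cst c)).
by apply/funext => t; rewrite hornerMXaddC.
Qed.

Variable U : set_system nat.
Context {FU : ProperFilter U}.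

Definition vanishing f := forall e : R, 0 < e ->
  \forall n \near U, normc (moment n f) <= e.

Lemma vanishing_lim f : ccont f ->
  (forall e : R, 0 < e -> exists g, [/\ ccont g, vanishing g &
    forall t, S t -> normc (f t - g t) <= e]) -> vanishing f.
Proof.
move=> cf H e e0; have e2 : 0 < e / 2 by rewrite divr_gt0.
have [g [cg vg fg]] := H _ e2; apply: filterS (vg _ e2) => n hn.
have cfg := ccontB cf cg.
have -> : moment n f = moment n (fun t => f t - g t) + moment n g.
  by rewrite -momentD//; apply: eq_cint => t; rewrite subrK.
apply: le_trans (normc_le_add _ _) _; rewrite [e]splitr lerD//.
by apply: moment_le => //; exact: ltW.
Qed.

Lemma vanishing_horner f q k : ccont f -> (forall j, vanishing (fun t => f t ^+ j.+1)) ->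
  vanishing (fun t => f t ^+ k.+1 * q.[f t]).
Proof.
move=> cf vf; elim/poly_ind: q k => [|q c IH] k e e0.
  apply: filterE => n; apply: moment_le; first exact: ltW.
    exact: (ccontM (ccontX _ cf) (ccont_horner_comp 0 cf)).
  by move=> t _; rewrite horner0 mulr0 normc0 ltW.
have e2 : 0 < e / 2 by rewrite divr_gt0.
have c1 : 0 < normc c + 1 by rewrite ltr_wpDl ?normc_ge0.
have e3 : 0 < e / 2 / (normc c + 1) by rewrite divr_gt0.
apply: filterS2 (IH k.+1 _ e2) (vf k _ e3) => n h1 h2.
have cX j := ccontX j cf; have cq := ccont_horner_comp q cf.
have -> : moment n (fun t => f t ^+ k.+1 * (q * 'X + c%:P).[f t]) =
    moment n (fun t => f t ^+ k.+2 * q.[f t]) + c * moment n (fun t => f t ^+ k.+1).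
  rewrite -(momentZ n c (cX k.+1)).
  rewrite -(momentD n (ccontM (cX k.+2) cq) (ccontM (ccont_cst c) (cX k.+1))).
  by apply: eq_cint => t; rewrite hornerMXaddC [_ ^+ k.+2]exprS; ring.
apply: le_trans (normc_le_add _ _) _; rewrite [e]splitr lerD//.
rewrite normcM; apply: (@le_trans _ _ ((normc c + 1) * (e / 2 / (normc c + 1)))).
  by apply: ler_pM; rewrite ?normc_ge0// lerDl.
by rewrite mulrC divfK// gt_eqF.
Qed.

(** The value [False] at infinity is the one that makes the property locally constant there, since
    the first moment is of order [1 / z] for large [z]. *)
Definition vanishing_at (w : sphere R) : Prop :=
  if w is Some z then
    forall d, 0 < d -> (forall t, S t -> d <= normc (z - t)) ->
    forall k, vanishing (fun t => cauchy_kernel d z t ^+ k.+1)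
  else False.

(** Analytic continuation of the zero function: powers of the resolvent at [z'] are uniform limits
    on [S] of polynomials without constant term in the resolvent at [z]. *)
Lemma vanishing_step z z' d : 0 < d -> (forall t, S t -> d <= normc (z - t)) ->
  normc (z' - z) <= d / 2 -> vanishing_at (in_sphere z) -> vanishing_at (in_sphere z').
Proof.
move=> d0 dS zz' /= vz d' d'0 d'S k.
have cz := ccont_kernel z d0; have cz' := ccont_kernel z' d'0.
apply: vanishing_lim; first exact: ccontX.
move=> e e0; have [q hq] := resolvent_approx k d0 dS zz' e0.
exists (fun t => cauchy_kernel d z t ^+ 1 * q.[cauchy_kernel d z t]); split.
- exact: (ccontM (ccontX 1 cz) (ccont_horner_comp q cz)).
- exact: (vanishing_horner q 0 cz (vz d d0 dS)).
move=> t St; rewrite expr1 (cauchy_kernelE d0 (dS _ St)).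
by rewrite (cauchy_kernelE d'0 (d'S _ St)); exact: hq.
Qed.

(* Near infinity the first moment is close to [1 / z], whatever [n]. *)
Lemma nonvanishing w : unbounded_component S w -> ~ vanishing_at w.
Proof.
move=> Ow; suff [h _] : vanishing_at w <-> vanishing_at infty by move=> /h.
apply: (sphere_locally_constant muS.1) Ow; first exact: vanishing_step.
have [M M0 hM] := compact_normc_bounded muS.1.
exists M => z Mz; split => // vz.
have z0 : 0 < normc z by apply: lt_trans Mz.
have d0 : 0 < normc z - M by rewrite subr_gt0.
have [u u1 ud] : exists2 u, normc u <= 1 &
    forall r t, normc t <= r -> normc z - r <= complex.Re (u * (z - t)).
  by apply: normc_direction; rewrite -normc_gt0.
have hv t : S t -> normc z - M <= complex.Re (u * (z - t)) /\
    normc (z - t) <= normc z + M.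
  move=> /hM tM; split; first exact: ud.
  by apply: le_trans (normc_le_add _ _) _; rewrite normc_opp lerD2l.
have dS t : S t -> normc z - M <= normc (z - t).
  by move=> /hM tM; have := normc_le_sub z t; lra.
have b0 : 0 < (normc z - M) / (normc z + M) ^+ 2.
  by rewrite divr_gt0// exprn_gt0// addr_gt0.
have [n] := filter_ex (vz _ d0 dS 0%N _ (divr_gt0 b0 (ltr0n R 2))).
rewrite /moment; have := cauchy_int_lower muS posdef n d0 u1 hv.
rewrite /cauchy_int => h1 h2; have := le_trans h1 h2.
by lra.
Qed.

(** [k] is the order of vanishing at [z] of the limit, along [U], of the Cauchy transforms of
    [|p_n|^2 mu]. *)
Lemma first_nonvanishing z : unbounded_component S (in_sphere z) ->
  exists d k, [/\ 0 < d, forall t, S t -> d <= normc (z - t),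
    forall j, (j < k)%N -> vanishing (fun t => cauchy_kernel d z t ^+ j.+1) &
    ~ vanishing (fun t => cauchy_kernel d z t ^+ k.+1)].
Proof.
move=> /nonvanishing /= /existsNP[d /not_implyP[d0 /not_implyP[dS nv]]].
exists d; apply: contrapT => H; apply: nv => k.
elim/ltn_ind: k => k IH; apply: contrapT => nk; apply: H.
by exists k; split.
Qed.

(** Taylor expansion at [a] of the Cauchy transform of [|p_n|^2 mu], with a remainder uniform in
    [n]. The kernel at [z] is truncated at [d / 2], the distance to [S] that is left there. *)
Lemma cauchy_int_expansion d a z n m : 0 < d -> (forall t, S t -> d <= normc (a - t)) ->
  normc (z - a) <= d / 2 ->
  normc (cauchy_int mu (d / 2) n z (p n) -
    \sum_(j < m) (- (z - a)) ^+ j * moment n (fun t => cauchy_kernel d a t ^+ j.+1))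
  <= 2 / d * (normc (z - a) / d) ^+ m.
Proof.
move=> d0 dS za; have d20 : 0 < d / 2 by rewrite divr_gt0.
have ca := ccont_kernel a d0; have cz := ccont_kernel z d20.
pose G := geometric_poly (z - a) m.
have cG : ccont (fun t => cauchy_kernel d a t * G.[cauchy_kernel d a t]).
  exact: (ccontM ca (ccont_horner_comp G ca)).
have -> : \sum_(j < m) (- (z - a)) ^+ j * moment n (fun t => cauchy_kernel d a t ^+ j.+1)
    = moment n (fun t => cauchy_kernel d a t * G.[cauchy_kernel d a t]).
  have cj (j : 'I_m) : ccont (fun t => (- (z - a)) ^+ j * cauchy_kernel d a t ^+ j.+1).
    exact: (ccontM (ccont_cst _) (ccontX j.+1 ca)).
  have := cint_sum muS (index_enum 'I_m) (fun j => ccontM (cj j) (ccont_weight n)).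
  under [X in _ = X -> _]eq_bigr do rewrite -/(moment n _) (momentZ n _ (ccontX _ ca)).
  move=> <-; apply: eq_cint => t; rewrite -mulr_suml; congr (_ * _).
  rewrite horner_sum mulr_sumr; apply: eq_bigr => j _.
  by rewrite hornerZ hornerXn exprS; ring.
have -> : cauchy_int mu (d / 2) n z (p n) = moment n (cauchy_kernel (d / 2) z) by [].
have -> : moment n (cauchy_kernel (d / 2) z) -
    moment n (fun t => cauchy_kernel d a t * G.[cauchy_kernel d a t]) =
    moment n (fun t => cauchy_kernel (d / 2) z t -
      cauchy_kernel d a t * G.[cauchy_kernel d a t]).
  apply/eqP; rewrite subr_eq; apply/eqP; rewrite -(momentD n (ccontB cz cG) cG).
  by apply: eq_cint => t; rewrite subrK.
apply: moment_le; last 1 first.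
- move=> t St; have dt := dS _ St.
  have at0 : 0 < normc (a - t) by rewrite (lt_le_trans d0).
  have zt : d / 2 <= normc (z - t).
    have -> : z - t = (a - t) - (a - z) by ring.
    apply: le_trans (normc_le_sub _ _); rewrite [normc (a - z)]normc_distC.
    by move: za; lra.
  have an0 : a - t != 0 by rewrite -normc_gt0.
  have zE : a + (z - a) - t = z - t by ring.
  have zn0 : z - t != 0 by rewrite -normc_gt0 (lt_le_trans d20).
  rewrite (cauchy_kernelE d0 dt) (cauchy_kernelE d20 zt) geometric_polyE ?zE//.
  rewrite mulrBr mulr1 subKr normcM normcV normcX normcM normcV normc_opp.
  apply: ler_pM; rewrite ?invr_ge0 ?normc_ge0 ?exprn_ge0 ?mulr_ge0 ?invr_ge0 ?normc_ge0//.
    by rewrite -[2 / d]invrK invf_div lef_pV2 ?posrE// (lt_le_trans d20).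
  apply: lerXn2r; rewrite ?nnegrE ?mulr_ge0 ?invr_ge0 ?normc_ge0 ?(ltW d0)//.
  by rewrite ler_wpM2l ?normc_ge0// lef_pV2 ?posrE.
- by rewrite mulr_ge0 ?divr_ge0 ?exprn_ge0 ?divr_ge0 ?normc_ge0 ?(ltW d0).
- exact: ccontB.
Qed.

End VanishingMoments.

(** * Finite sums and tails of series *)

Section BigCvg.

Lemma cvg_fsum (K : numFieldType) (V : pseudoMetricNormedZmodType K) (T I : Type)
    (F : set_system T) (s : seq I) (f : I -> T -> V) (l : I -> V) : Filter F ->
  (forall i, f i t @[t --> F] --> l i) ->
  \sum_(i <- s) f i t @[t --> F] --> \sum_(i <- s) l i.
Proof.
move=> FF fl; elim: s => [|i s IH].
  rewrite big_nil (_ : (fun t => _) = cst 0); first exact: cvg_cst.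
  by apply/funext => t; rewrite big_nil.
rewrite big_cons (_ : (fun t => _) = fun t => f i t + \sum_(i <- s) f i t).
  exact: (cvgD (fl i) IH).
by apply/funext => t; rewrite big_cons.
Qed.

(** [(a + b)^2 <= 2 a^2 + 2 b^2], then Cauchy-Schwarz on each part. In the head the sum of
    [u i ^+ 2] stops at [m]: this is the factor that the growth of the kernel makes negligible. *)
Lemma sqr_sum_split (R : realFieldType) (u v : nat -> R) m n : (m <= n)%N ->
  (\sum_(0 <= i < n) u i * v i) ^+ 2 <=
  2 * ((\sum_(0 <= i < m) u i ^+ 2) * \sum_(0 <= i < m) v i ^+ 2) +
  2 * ((\sum_(0 <= i < n) u i ^+ 2) * \sum_(m <= i < n) v i ^+ 2).
Proof.
move=> mn; rewrite (big_cat_nat (leq0n m) mn)//=.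
have := sum_Cauchy_Schwarz (index_iota 0 m) u v.
have := sum_Cauchy_Schwarz (index_iota m n) u v.
set a := \sum_(0 <= i < m) u i * v i; set b := \sum_(m <= i < n) u i * v i.
set A := (X in _ <= X -> _); set B := (X in _ -> _ <= X -> _) => hb ha.
have h : A <= (\sum_(0 <= i < n) u i ^+ 2) * \sum_(m <= i < n) v i ^+ 2.
  apply: ler_wpM2r; first by apply: sumr_ge0 => i _; exact: sqr_ge0.
  by rewrite [leRHS](big_cat_nat (leq0n m) mn)//= lerDr; apply: sumr_ge0 => i _; exact: sqr_ge0.
apply: (@le_trans _ _ (2 * B + 2 * A)); last by rewrite lerD2l ler_pM2l.
have := sqr_ge0 (a - b); rewrite -subr_ge0 => h2.
have -> : (a + b) ^+ 2 = 2 * a ^+ 2 + 2 * b ^+ 2 - (a - b) ^+ 2 by ring.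
by move: h2; rewrite subr0; lra.
Qed.

Lemma series_tail (R : realType) (u : nat -> R) : (forall i, 0 <= u i) ->
  (\sum_(0 <= i <oo) (u i)%:E < +oo)%E ->
  (exists2 E : R, 0 <= E & forall n, \sum_(0 <= i < n) u i <= E) /\
  (forall e : R, 0 < e -> exists N, forall n, \sum_(N <= i < n) u i <= e).
Proof.
move=> u0 fin; set s := (\sum_(0 <= i <oo) (u i)%:E)%E in fin.
have s0 : (0 <= s)%E by apply: nneseries_ge0 => i _ _; rewrite lee_fin.
have sfin : s \is a fin_num by rewrite ge0_fin_numE.
have bound n : \sum_(0 <= i < n) u i <= fine s.
  rewrite -lee_fin fineK// -sumEFin.
  by apply: nneseries_lim_ge => i _ _; rewrite lee_fin.
split; first by exists (fine s) => //; exact: fine_ge0.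
move=> e e0; pose A := range (fun n => \sum_(0 <= i < n) u i).
have hA : has_sup A.
  by split; [exists (\sum_(0 <= i < 0) u i), 0%N|exists (fine s) => _ [n _ <-]].
have [_ [N _ <-] hN] := sup_adherent e0 hA.
exists N => n; have [nN|Nn] := leqP n N; first by rewrite big_geq// ltW.
have : \sum_(0 <= i < n) u i <= sup A by apply: (ub_le_sup hA.2); exists n.
by rewrite (big_cat_nat (leq0n N) (ltnW Nn))//=; lra.
Qed.

End BigCvg.

(** * Extremal polynomials and the kernel at infinity *)

Section Christoffel.
Variable R : realType.
Variables (mu : {finite_measure set (borelC R) -> \bar R}) (K : set R[i]^o).
Hypothesis muK : carried mu K.
Hypothesis posdef : forall p : {poly R[i]}, p != 0 -> 0 < sqnorm mu (horner p).

Definition christoffel_poly n z : {poly R[i]} :=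
  (kernel_diag mu n z)^-1%:C *: kernel mu n z.

Lemma christoffel_poly_admissible n z :
  (size (christoffel_poly n z) <= n.+1)%N /\ (christoffel_poly n z).[z] = 1.
Proof.
split; first by apply: (leq_trans (size_scale_leq _ _)); exact: (size_kernel muK posdef).
rewrite hornerZ kernel_diagE -rmorphM /= mulVf//.
by rewrite gt_eqF// (kernel_diag_gt0 muK posdef).
Qed.

Lemma sqnorm_christoffel_poly (m : {finite_measure set (borelC R) -> \bar R})
    (L : set R[i]^o) n z : carried m L ->
  sqnorm m (horner (christoffel_poly n z)) =
  (kernel_diag mu n z)^-1 ^+ 2 * sqnorm m (horner (kernel mu n z)).
Proof.
move=> mL; rewrite (_ : horner (christoffel_poly n z) =
  fun v => (kernel_diag mu n z)^-1%:C * (kernel mu n z).[v]); last first.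
  by apply/funext => v; rewrite hornerZ.
rewrite (sqnormZ mL _ (ccont_horner _)) normc_real ger0_norm// invr_ge0 ltW//.
exact: (kernel_diag_gt0 muK posdef).
Qed.

Lemma sqnorm_christoffel_poly_self n z :
  sqnorm mu (horner (christoffel_poly n z)) = (kernel_diag mu n z)^-1.
Proof.
rewrite (sqnorm_christoffel_poly n z muK) (sqnorm_kernel muK posdef).
rewrite expr2 mulfVK// gt_eqF//; exact: (kernel_diag_gt0 muK posdef).
Qed.

(** Only the term [i = n] of the limit is nonzero, which makes the limit positive, so that quotients
    of kernels converge at infinity. *)
Lemma kernel_diag_infty n :
  sphere_fun (fun z => kernel_diag mu n z / normc (z ^+ n) ^+ 2) v
    @[v --> (infty : sphere R)^'] -->
  (\sum_(i < n.+1) normc (orthopoly mu i)`_n ^+ 2 : R^o).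
Proof.
have -> : sphere_fun (fun z => kernel_diag mu n z / normc (z ^+ n) ^+ 2) =
    fun v => \sum_(i < n.+1)
      normc (sphere_fun (fun z => (orthopoly mu i).[z] / z ^+ n) v) ^+ 2.
  apply/funext => -[z|]; last first.
    by rewrite /sphere_fun big1// => i _; rewrite normc0 expr0n.
  rewrite /sphere_fun /kernel_diag mulr_suml; apply: eq_bigr => i _.
  by rewrite normcM normcV exprMn exprVn.
apply: cvg_fsum => // i.
have sp : (size (orthopoly mu i) <= n.+1)%N.
  by rewrite (size_orthopoly muK posdef) ltn_ord.
have hn : normc (sphere_fun (fun z => (orthopoly mu i).[z] / z ^+ n) v)
    @[v --> (infty : sphere R)^'] --> normc (orthopoly mu i)`_n.
  exact: (cvg_comp _ _ (@horner_infty R _ n sp) (@continuous_normc R _)).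
by rewrite expr2; under eq_fun do rewrite expr2; exact: (cvgM hn hn).
Qed.

End Christoffel.

(** * Polynomially small perturbations *)

Section Perturbation.
Variable R : realType.
Variables mu0 mu1 mu2 : {finite_measure set (borelC R) -> \bar R}.
Let S0 := measure_support mu0.
Let S1 := measure_support mu1.
Hypothesis cS0 : compact S0.
Hypothesis iS0 : infinite_set S0.
Hypothesis cS1 : compact S1.
Hypothesis iS1 : infinite_set S1.
Hypothesis mu012 : forall A, measurable A -> mu0 A = (mu1 A + mu2 A)%E.
Local Notation p0 := (orthopoly mu0).
Local Notation p1 := (orthopoly mu1).

Lemma carried0 : carried mu0 S0.
Proof. exact: carried_support. Qed.

Lemma carried1 : carried mu1 S1.
Proof. exact: carried_support. Qed.

Let null_S0 : (mu1 (~` S0) + mu2 (~` S0) = 0)%E.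
Proof. by rewrite -mu012; [exact: carried0.2|exact: (measurable_carrier carried0)]. Qed.

Lemma carried10 : carried mu1 S0.
Proof.
split => //; apply/eqP; rewrite -measure_le0 -null_S0 leeDl//.
Qed.

Lemma carried20 : carried mu2 S0.
Proof.
split => //; apply/eqP; rewrite -measure_le0 -null_S0 leeDr//.
Qed.

Lemma posdef0 (p : {poly R[i]}) : p != 0 -> 0 < sqnorm mu0 (horner p).
Proof. exact: sqnorm_horner_gt0. Qed.

Lemma posdef1 (p : {poly R[i]}) : p != 0 -> 0 < sqnorm mu1 (horner p).
Proof. exact: sqnorm_horner_gt0. Qed.

Lemma sqnorm_split f : ccont f -> sqnorm mu0 f = sqnorm mu1 f + sqnorm mu2 f.
Proof.
move=> cf; have rf := rcontX 2 (rcont_normc cf).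
have i1 := integrable_rcont carried10 rf; have i2 := integrable_rcont carried20 rf.
rewrite /sqnorm /Rintegral (eq_measure_integral (measure_add mu1 mu2)).
  by rewrite integral_measure_add// fineD//; exact: integrable_fin_num.
by move=> A mA _; apply: etrans (mu012 mA) _; exact/esym/measure_addE.
Qed.

Lemma L2norm_le_split f : ccont f -> L2norm mu1 f <= L2norm mu0 f.
Proof.
move=> cf; rewrite !L2normE ler_wsqrtr// (sqnorm_split cf) lerDl.
exact: sqnorm_ge0.
Qed.

Let eps n := L2norm mu2 (horner (p1 n)).

Lemma sqnorm0_p1 n : sqnorm mu0 (horner (p1 n)) = 1 + eps n ^+ 2.
Proof.
rewrite (sqnorm_split (ccont_horner _)) (sqnorm_orthopoly carried1 posdef1).
by rewrite sqr_L2norm.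
Qed.

Let size0 := size_orthopoly carried0 posdef0.
Let size1 := size_orthopoly carried1 posdef1.

(** Up to a polynomial of lower degree, which is orthogonal to [p_n], [r] is this multiple of
    [p_n]. *)
Lemma ip_lead_ratio (mu : {finite_measure set (borelC R) -> \bar R})
    (K : set R[i]^o) (muK : carried mu K)
    (posdef : forall p : {poly R[i]}, p != 0 -> 0 < sqnorm mu (horner p))
    n (r : {poly R[i]}) : size r = n.+1 ->
  ip mu r (orthopoly mu n) = lead_coef r / gamma mu n.
Proof.
move=> sr; have g0 : gamma mu n != 0 by rewrite gt_eqF// (gamma_gt0 muK posdef).
have sp := size_orthopoly muK posdef n.
pose c := lead_coef r / gamma mu n.
rewrite -[r in LHS](subrK (c *: orthopoly mu n)) (ipDl muK) (ipZl muK).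
rewrite (ip_orthopoly muK posdef) eqxx mulr1.
rewrite (ip_orthopoly_small muK posdef) ?add0r//.
apply/leq_sizeP => j nj; rewrite coefB coefZ.
have [->|jn] := eqVneq j n.
  have -> : r`_n = lead_coef r by rewrite lead_coefE sr.
  have -> : (orthopoly mu n)`_n = gamma mu n by rewrite /gamma lead_coefE sp.
  by rewrite /c divfK ?subrr.
have nj' : (n < j)%N by rewrite ltn_neqAle eq_sym jn.
by rewrite !nth_default ?mulr0 ?subr0 ?sr ?sp.
Qed.

(** Two uses of Cauchy-Schwarz. In L2(mu1), [<p0, p1>] is the inverse ratio, at most the norm of
    [p0], itself at most 1 because [mu1] is dominated by [mu0]. In L2(mu0), [<p1, p0>] is the ratio,
    at most the norm of [p1]. *)
Lemma gamma_ratio n : exists g : R, [/\ gamma mu1 n / gamma mu0 n = g%:C,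
  1 <= g & g ^+ 2 <= 1 + eps n ^+ 2].
Proof.
have g0 := gamma_gt0 carried0 posdef0 n; have g1 := gamma_gt0 carried1 posdef1 n.
have e10 : ip mu0 (p1 n) (p0 n) = gamma mu1 n / gamma mu0 n.
  exact: (ip_lead_ratio carried0 posdef0 (size1 n)).
have e01 : ip mu1 (p0 n) (p1 n) = gamma mu0 n / gamma mu1 n.
  exact: (ip_lead_ratio carried1 posdef1 (size0 n)).
have := divr_gt0 g1 g0; rewrite ltcE /= => /andP[/eqP Im0 Re0].
pose g := complex.Re (gamma mu1 n / gamma mu0 n); exists g.
have gE : gamma mu1 n / gamma mu0 n = g%:C by exact: complex_eq.
split => //.
  have := inner_Cauchy_Schwarz carried1 (ccont_horner (p0 n)) (ccont_horner (p1 n)).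
  rewrite -/(ip _ _ _) e01 (L2norm_orthopoly carried1 posdef1) mulr1 => h.
  have := le_trans h (L2norm_le_split (ccont_horner (p0 n))).
  rewrite (L2norm_orthopoly carried0 posdef0) -[_ / _]invrK invfM invrK mulrC gE.
  by rewrite normcV normc_real gtr0_norm// invf_le1.
have := inner_Cauchy_Schwarz carried0 (ccont_horner (p1 n)) (ccont_horner (p0 n)).
rewrite -/(ip _ _ _) e10 (L2norm_orthopoly carried0 posdef0) mulr1 gE.
rewrite normc_real gtr0_norm// => h.
by rewrite -sqnorm0_p1 -sqr_L2norm ler_pXn2r// nnegrE ?L2norm_ge0// ltW.
Qed.

(** The squared norm is [(1 + eps^2) - 2 g + 1], at most [eps^2] since [g >= 1]. *)
Lemma L2norm_p1B_p0 n :
  L2norm mu0 (fun z => (p1 n).[z] - (p0 n).[z]) <= eps n.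
Proof.
have e0 : 0 <= eps n by exact: L2norm_ge0.
rewrite -(@ler_pXn2r _ 2)// ?nnegrE ?L2norm_ge0// sqr_L2norm.
have cN : ccont (fun z => -1 * (p0 n).[z]).
  exact: (ccontM (ccont_cst _) (ccont_horner _)).
rewrite (_ : (fun z => _) = fun z => (p1 n).[z] + -1 * (p0 n).[z]); last first.
  by apply/funext => z; rewrite mulN1r.
rewrite (sqnormD carried0 (ccont_horner _) cN) sqnorm0_p1.
rewrite (sqnormZ carried0 _ (ccont_horner _)) (sqnorm_orthopoly carried0 posdef0).
rewrite normc_opp normc1.
have cp0 := ccont_horner (p0 n); have cp1 := ccont_horner (p1 n).
rewrite (inner_conj carried0 cN cp1) (innerZl carried0 _ cp0 cp1) Re_conj.
rewrite mulN1r ReN (inner_conj carried0 cp1 cp0) Re_conj.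
have [g [gE g1 _]] := gamma_ratio n.
have -> : inner mu0 (horner (p1 n)) (horner (p0 n)) = g%:C.
  by rewrite -gE -(ip_lead_ratio carried0 posdef0 (size1 n)).
by rewrite /=; lra.
Qed.

Hypothesis eps_cvg : L2norm mu2 (horner (p1 n)) @[n --> \oo] --> (0 : R).

Lemma eps_small (e : R) : 0 < e -> exists N : nat, forall n, (N <= n)%N -> eps n < e.
Proof.
move=> e0; have /cvgrPdist_lt/(_ _ e0)[N _ HN] := eps_cvg.
by exists N => n /HN /=; rewrite sub0r normrN ger0_norm ?L2norm_ge0.
Qed.

Lemma gamma_ratio_cvg :
  (gamma mu1 n / gamma mu0 n : R[i]^o) @[n --> \oo] --> (1 : R[i]^o).
Proof.
apply/cvg_complexP => e e0.
(* With [eps < 1] one has [g - 1 <= g^2 - 1 <= eps^2 <= eps]. *)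
have m0 : 0 < Num.min e 1 by rewrite lt_min e0 ltr01.
have [N HN] := eps_small m0; exists N => // n /= /HN.
rewrite lt_min => /andP[ee e1]; have [g [-> g1 g2]] := gamma_ratio n.
have -> : g%:C - 1 = (g - 1)%:C by rewrite rmorphB.
rewrite normc_real ger0_norm ?subr_ge0//.
have eps0 : 0 <= eps n by exact: L2norm_ge0.
by nra.
Qed.

Lemma orthopoly_diff_cvg :
  L2norm mu0 (fun z => (p1 n).[z] - (p0 n).[z]) @[n --> \oo] --> (0 : R).
Proof.
apply: (@squeeze_cvgr _ _ _ _ (fun=> 0) eps) => //.
  by near=> n; rewrite L2norm_ge0 L2norm_p1B_p0.
exact: cvg_cst.
Unshelve. all: by end_near. Qed.

(** * Ratio asymptotics outside the convex hull *)

Let S0_neq0 : S0 !=set0.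
Proof.
have [S0e|/set0P//] := eqVneq S0 set0.
by exfalso; apply: iS0; rewrite S0e.
Qed.

Lemma hull_local_bound w : (~` (in_sphere @` convex_hull S0)) w ->
  exists C : R, \forall v \near w, forall z, v = in_sphere z ->
    forall n (r : {poly R[i]}), (size r <= n.+1)%N ->
    normc r.[z] <= C * L2norm mu0 (horner r) * normc (p0 n).[z] /\ (p0 n).[z] != 0.
Proof.
have [M M0 hM] := compact_normc_bounded cS0.
case: w => [z|] hw.
  have hz : ~ convex_hull S0 z by move=> hz; apply: hw; exists z.
  have [u [d [u1 d0 ud]]] := hull_separation cS0 S0_neq0 hz.
  have d20 : 0 < d / 2 by rewrite divr_gt0.
  exists (((normc z + d / 2 + M) / (d / 2)) ^+ 2).
  apply/nbhs_someP; exists (d / 2) => // v vz _ [<-] n r sr.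
  have hv t : S0 t -> d / 2 <= complex.Re (u * (v - t)) /\
      normc (v - t) <= normc z + d / 2 + M.
    move=> St; split.
      have -> : u * (v - t) = u * (z - t) - u * (z - v) by ring.
      rewrite ReD ReN; have := ud _ St.
      have : complex.Re (u * (z - v)) <= d / 2.
        apply: le_trans (Re_le_normc _) _; rewrite normcM normc_distC.
        by apply: le_trans (ltW vz); rewrite ler_piMl ?normc_ge0.
      lra.
    apply: le_trans (normc_le_add _ _) _; rewrite normc_opp lerD ?hM//.
    have -> : v = z + (v - z) by ring.
    by apply: le_trans (normc_le_add _ _) _; rewrite lerD2l ltW.
  split; last exact: (orthopoly_outside_hull_neq0 carried0 posdef0 n d20 u1 hv).
  exact: (outside_hull_bound carried0 posdef0 d20 u1 hv).
(* For [|v| > 2 M] the separation is at least [|v| / 2] and the distances to the support at most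
   [3 |v| / 2]; their quotient no longer depends on [v]. *)
exists (((3 / 2) / 2^-1) ^+ 2); apply/nbhs_inftyP; split => //; exists (2 * M).
move=> v Mv _ [<-] n r sr.
have v0 : 0 < normc v by apply: lt_trans Mv; rewrite mulr_gt0.
have d0 : 0 < 2^-1 * normc v by rewrite mulr_gt0.
have [u u1 ud] : exists2 u, normc u <= 1 &
    forall r t, normc t <= r -> normc v - r <= complex.Re (u * (v - t)).
  by apply: normc_direction; rewrite -normc_gt0.
have hv t : S0 t -> 2^-1 * normc v <= complex.Re (u * (v - t)) /\
    normc (v - t) <= 3 / 2 * normc v.
  move=> /hM tM; split; first by apply: le_trans (ud _ _ tM); lra.
  by apply: le_trans (normc_le_add _ _) _; rewrite normc_opp; lra.
have E : (3 / 2 * normc v) / (2^-1 * normc v) = (3 / 2) / 2^-1.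
  by field; rewrite gt_eqF.
split; last exact: (orthopoly_outside_hull_neq0 carried0 posdef0 n d0 u1 hv).
by rewrite -E; exact: (outside_hull_bound carried0 posdef0 d0 u1 hv).
Qed.

Lemma ratio_infty_cvg n :
  cvg (sphere_fun (fun z => (p1 n).[z] / (p0 n).[z]) v @[v --> (infty : sphere R)^']).
Proof.
have sp0 : (size (p0 n) <= n.+1)%N by rewrite size0.
have sp1 : (size (p1 n) <= n.+1)%N by rewrite size1.
apply: (cvg_ratio_infty (h := fun z => z ^+ n) _ _
  (horner_infty sp1) (horner_infty sp0)).
  have -> : (p0 n)`_n = gamma mu0 n by rewrite /gamma lead_coefE size0.
  by rewrite gt_eqF// (gamma_gt0 carried0 posdef0).
by move=> z z0; rewrite expf_neq0.
Qed.

(* The value at infinity is a limit of values at finite points. *)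
Lemma extend_ratio_close (A : set (sphere R)) n (e : R) :
  (forall z, A (in_sphere z) -> normc ((p1 n).[z] / (p0 n).[z] - 1) <= e) ->
  (A infty -> nbhs (infty : sphere R) A) ->
  forall v, A v ->
    normc (extend_infty (fun z => (p1 n).[z] / (p0 n).[z]) v - 1) <= e.
Proof.
move=> h Ai [z|] Av; first exact: h.
have cD := @closed_disc R 1 e.
apply: (@extend_infty_closed _ _ _ [set v : R[i]^o | normc (v - 1) <= e]
  (@ratio_infty_cvg n) cD).
have /nbhs_inftyP[_ [M MA]] := Ai Av.
by exists M => z /MA /h.
Qed.

Definition ratio_locally_close (w : sphere R) := forall e : R, 0 < e ->
  exists N : nat, \forall v \near w, forall n, (N <= n)%N ->
    normc (extend_infty (fun z => (p1 n).[z] / (p0 n).[z]) v - 1) <= e.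

Lemma ratio_close_outside_hull w : (~` (in_sphere @` convex_hull S0)) w ->
  ratio_locally_close w.
Proof.
move=> hw e e0; have [C hC] := hull_local_bound hw.
have C1 : 0 < `|C| + 1 by rewrite ltr_wpDl.
have [N HN] := eps_small (divr_gt0 e0 C1).
exists N.
(* The interior is open, hence a neighbourhood of infinity as soon as it contains it, as
   [extend_ratio_close] requires. *)
have hC' := nbhs_interior hC.
apply: filterS hC' => v iv n Nn.
pose A := (fun v : sphere R => forall z, v = in_sphere z ->
    forall n (r : {poly R[i]}), (size r <= n.+1)%N ->
    normc r.[z] <= C * L2norm mu0 (horner r) * normc (p0 n).[z] /\ (p0 n).[z] != 0)^°.
apply: (@extend_ratio_close A) iv; last first.
  by move=> Ai; exact: nbhs_interior.
move=> z Az; have sr : (size (p1 n - p0 n)%R <= n.+1)%N.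
  by rewrite (leq_trans (size_polyD _ _))// size_polyN size0 size1 maxnn.
have [h1 h2] := interior_subset Az z erefl n _ sr.
have -> : (p1 n).[z] / (p0 n).[z] - 1 = (p1 n - p0 n).[z] / (p0 n).[z].
  by rewrite !hornerE mulrBl divff.
rewrite normcM normcV ler_pdivrMr ?normc_gt0//; apply: le_trans h1 _.
apply: ler_wpM2r; first exact: normc_ge0.
have -> : L2norm mu0 (horner (p1 n - p0 n)) =
    L2norm mu0 (fun z => (p1 n).[z] - (p0 n).[z]).
  by congr (L2norm mu0 _); apply/funext => x; rewrite !hornerE.
have := le_lt_trans (L2norm_p1B_p0 n) (HN _ Nn); rewrite ltr_pdivlMr// => h3.
have l0 := L2norm_ge0 mu0 (fun z => (p1 n).[z] - (p0 n).[z]).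
apply: le_trans (ltW h3); rewrite mulrC ler_wpM2l//.
by rewrite (le_trans (ler_norm _))// lerDl.
Qed.

Lemma ratio_cvg_unif U : (forall w, U w -> ratio_locally_close w) ->
  cvg_unif_compacts U
    (fun n => extend_infty (fun z => (p1 n).[z] / (p0 n).[z])) (cst 1).
Proof.
move=> H; apply: uniform_of_local => w Uw e e0.
(* The norm of [R[i]] takes values in [R[i]], where a positive [e] is real; halving turns the
   non-strict local bound into a strict one. *)
have e0' : 0 < complex.Re e / 2.
  by move: e0; rewrite ltcE /= => /andP[_ h]; rewrite divr_gt0.
have eE : e = (complex.Re e)%:C.
  by apply: complex_eq => //; move: e0; rewrite ltcE /= => /andP[/eqP].
have [N HN] := H w Uw _ e0'.
exists N; apply: filterS HN => v hv n Nn.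
rewrite distrC normcE eE ltcR; apply: le_lt_trans (hv n Nn) _.
by lra.
Qed.

(** * Ratio asymptotics in the unbounded component *)

Local Notation Omega := (unbounded_component S1).

(** The segment from [a] to [v] is connected and avoids [S1], so it stays in the component of
    [a]. *)
Lemma Omega_disc a (r : R) : Omega (in_sphere a) ->
  (forall v : R[i], normc (v - a) <= r -> ~ S1 v) ->
  forall v, normc (v - a) <= r -> Omega (in_sphere v).
Proof.
move=> Oa disc v va.
pose g (s : R) : sphere R := in_sphere (a + s%:C * (v - a)).
have cg : continuous g.
  have c1 : continuous (fun s : R => a + s%:C * (v - a) : R[i]^o).
    apply: continuous_addc; first exact: cst_continuous.
    apply: continuous_mulc; last exact: cst_continuous.
    by apply: continuous_real_complex => s; exact: cvg_id.
  move=> s; apply: (@continuous_comp _ _ _ (fun s : R => a + s%:C * (v - a) : R[i]^o)).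
    exact: c1.
  exact: one_point_compactification_some_continuous.
pose B := g @` `[0, 1]%classic.
have cB : connected B.
  apply: connected_continuous_connected; last exact: continuous_subspaceT.
  exact: segment_connected.
have Ba : B (in_sphere a).
  exists 0; first by rewrite /= in_itv /= lexx ler01.
  by rewrite /g mul0r addr0.
have Bv : B (in_sphere v).
  exists 1; first by rewrite /= in_itv /= lexx ler01.
  by rewrite /g mul1r addrC subrK.
have BT : B `<=` ~` (in_sphere @` S1).
  move=> _ [s s01 <-] [x Sx [xE]]; apply: (disc x) => //.
  move: s01; rewrite /= in_itv /= => /andP[s0 s1].
  rewrite xE addrAC subrr add0r normcM normc_real ger0_norm//.
  by apply: le_trans va; rewrite ler_piMl ?normc_ge0.
exact: connected_component_trans Oa (connected_component_max Ba BT cB Bv).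
Qed.

Hypothesis p0_zeros : \forall n \near \oo, forall z : R[i],
  convex_hull S0 z -> Omega (in_sphere z) -> (p0 n).[z] != 0.

Lemma p0_neq0_Omega : \forall n \near \oo, forall z : R[i],
  Omega (in_sphere z) -> (p0 n).[z] != 0.
Proof.
apply: filterS p0_zeros => n hn z Oz.
have [hz|hz] := pselect (convex_hull S0 z); first exact: hn.
have [|C hC] := @hull_local_bound (in_sphere z).
  by move=> [x hx [xz]]; apply: hz; rewrite -xz.
(* Any admissible [r] gives access to the nonvanishing of [p0]; here [r = 0]. *)
by have [] := nbhs_singleton hC z erefl n 0 ltac:(by rewrite size_poly0).
Qed.

(* On a small circle around [a], [p1 / p0 = A / B] with [A - B] small and [A]
   bounded below by its first nonvanishing Taylor coefficient along the
   ultrafilter; the maximum principle carries the bound to the disc. *)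
Lemma ultra_ratio (U : set_system nat) a (e : R) : UltraFilter U ->
  (forall A : set nat, (\forall n \near \oo, A n) -> U A) ->
  Omega (in_sphere a) -> 0 < e ->
  exists2 r : R, 0 < r & U [set n | forall v, normc (v - a) <= r ->
    normc (p1 n - p0 n).[v] <= e * normc (p0 n).[v] /\ (p0 n).[v] != 0].
Proof.
move=> UU Uoo Oa e0.
have [d [k [d0 dS vj nk]]] := first_nonvanishing carried1 posdef1 (FU := @ultra_proper _ _ UU) Oa.
pose c j n := moment mu1 n (fun t => cauchy_kernel d a t ^+ j.+1).
have [eta eta0 Ueta] : exists2 eta : R, 0 < eta & U [set n | eta < normc (c k n)].
  move/existsNP : nk => [eta /not_implyP[eta0 nU]]; exists eta => //.
  (* The ultrafilter turns a failure to be eventually small into being eventually large. *)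
  have [//|h] := in_ultra_setVsetC [set n | normc (c k n) <= eta] UU.
  by apply: filterS h => n /negP; rewrite -ltNge.
(* [d / 3] keeps the disc at distance at least [d / 2] from [S1]; the other bound makes the Taylor
   remainder after order [k] at most [kappa]. *)
pose r := Num.min (d / 3) (eta * d ^+ k.+2 / 8).
have r0 : 0 < r by rewrite lt_min !divr_gt0// mulr_gt0// exprn_gt0.
have rd : r <= d / 3 by rewrite ge_min lexx.
have reta : r <= eta * d ^+ k.+2 / 8 by rewrite ge_min lexx orbT.
have rk : 0 < r ^+ k by rewrite exprn_gt0.
(* On the circle the term of order [k] is at least [4 kappa]. The lower terms and the remainder each
   cost [kappa], leaving [2 kappa] for [A]; then [A - B] costs at most another, leaving [kappa] for
   [B]. *)
pose kappa := eta * r ^+ k / 4.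
have kappa0 : 0 < kappa by rewrite divr_gt0// mulr_gt0.
have tail : 2 / d * (r / d) ^+ k.+1 <= kappa.
  rewrite exprS expr_div_n /kappa.
  have -> : 2 / d * (r / d * (r ^+ k / d ^+ k)) = (2 * r / d ^+ k.+2) * r ^+ k.
    by rewrite !exprS; field; rewrite ?expf_neq0 ?gt_eqF.
  have -> : eta * r ^+ k / 4 = (eta / 4) * r ^+ k by field.
  rewrite ler_pM2r// ler_pdivrMr ?exprn_gt0//; lra.
pose s := \sum_(j < k) r ^+ j.
have s0 : 0 <= s by apply: sumr_ge0 => j _; rewrite exprn_ge0// ltW.
(* Moments below this size, weighted by the powers of [r] of sum [s], add up to at most [kappa]. *)
have theta0 : 0 < kappa / (s + 1) by rewrite divr_gt0// ltr_wpDl.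
have Uj : U [set n | forall j, (j < k)%N -> normc (c j n) <= kappa / (s + 1)].
  elim: {-2}k (leqnn k) => [_|l IH lk]; first by apply: filterE.
  apply: filterS2 (IH (ltnW lk)) (vj l lk _ theta0) => n h1 h2 j.
  by rewrite ltnS leq_eqVlt => /orP[/eqP ->|/h1].
have d20 : 0 < d / 2 by rewrite divr_gt0.
have disc v : normc (v - a) <= r -> forall t, S1 t -> d / 2 <= normc (v - t).
  move=> va t St; have -> : v - t = (a - t) - (a - v) by ring.
  apply: le_trans (normc_le_sub _ _); rewrite [normc (a - v)]normc_distC.
  have := dS _ St; lra.
have Odisc : forall v, normc (v - a) <= r -> Omega (in_sphere v).
  apply: Omega_disc => // v va Sv; have := disc v va v Sv.
  by rewrite subrr normc0; lra.
have Apos n : eta < normc (c k n) ->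
    (forall j, (j < k)%N -> normc (c j n) <= kappa / (s + 1)) ->
    forall v, normc (v - a) = r -> 2 * kappa <= normc (cauchy_int mu1 (d / 2) n v (p1 n)).
  move=> hk hj v va.
  have := @cauchy_int_expansion _ _ _ carried1 posdef1 d a v n k.+1 d0 dS.
  rewrite va => /(_ ltac:(lra)); rewrite big_ord_recr /= -/(c k n).
  set A := cauchy_int _ _ _ _ _; set sm := \sum_(i < k) _; set top := _ * c k n.
  move=> h.
  have htop : normc top = r ^+ k * normc (c k n).
    by rewrite normcM normcX normc_opp va.
  have hsm : normc sm <= kappa.
    apply: le_trans (normc_sum _ _ _) _.
    apply: (@le_trans _ _ (\sum_(j < k) r ^+ j * (kappa / (s + 1)))).
      apply: ler_sum => j _; rewrite normcM normcX normc_opp va.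
      by rewrite ler_wpM2l ?exprn_ge0 ?(ltW r0)// hj.
    rewrite -mulr_suml -/s mulrCA ler_piMr ?(ltW kappa0)//.
    by rewrite ler_pdivrMr ?mul1r ?lerDl// ltr_wpDl.
  have h4 : 4 * kappa <= normc top.
    rewrite htop /kappa mulrC; have : r ^+ k * eta <= r ^+ k * normc (c k n).
      by rewrite ler_pM2l// ltW.
    lra.
  suff : 2 * kappa <= normc A by [].
  have -> : A = top - (- (A - (sm + top)) - sm) by ring.
  apply: le_trans (normc_le_sub _ _).
  have : normc (- (A - (sm + top)) - sm) <= kappa + kappa.
    by apply: le_trans (normc_le_add _ _) _; rewrite !normc_opp lerD// (le_trans h).
  lra.
(* The bound 1 serves to keep [|B| >= kappa], the bound [e] to conclude; the factor [d / 2] in the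
   next line cancels the bound [2 / d] of the Cauchy kernel. *)
have e1 : 0 < Num.min e 1 * kappa by rewrite mulr_gt0// lt_min e0 ltr01.
have [N HN] := eps_small (mulr_gt0 e1 d20).
exists r => //.
have UN : U [set n | (N <= n)%N] by apply: Uoo; exists N.
have Unz := Uoo _ p0_neq0_Omega.
apply: filterS2 (filterI Ueta Uj) (filterI UN Unz) => n [hk hj] [Nn nz] v va.
split; last exact: nz (Odisc _ va).
apply: (rational_maximum_modulus r0 _ _ va).
  by move=> z za; apply: nz; exact: Odisc.
move=> z za; have zr : normc (z - a) <= r by rewrite za.
have dz := disc z zr; have Az := Apos n hk hj z za.
have sp0 : (size (p0 n) <= n.+1)%N by rewrite size0.
have := cauchy_int_ratio carried1 posdef1 d20 dz sp0.
have := normc_cauchy_int carried1 posdef1 n (p1 n - p0 n) d20 dz.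
rewrite (cauchy_intB carried1 n z (p1 n) (p0 n) d20).
set A := cauchy_int mu1 (d / 2) n z (p1 n) in Az *.
set B := cauchy_int mu1 (d / 2) n z (p0 n).
have -> : L2norm mu1 (horner (p1 n - p0 n)) =
    L2norm mu1 (fun z => (p1 n).[z] - (p0 n).[z]).
  by congr (L2norm mu1 _); apply/funext => x; rewrite !hornerE.
have l1 : L2norm mu1 (fun z => (p1 n).[z] - (p0 n).[z]) <= Num.min e 1 * kappa * (d / 2).
  apply: le_trans (L2norm_le_split (ccontB (ccont_horner _) (ccont_horner _))) _.
  exact: le_trans (L2norm_p1B_p0 n) (ltW (HN _ Nn)).
move=> AB qAB; clearbody A B.
have {}AB : normc (A - B) <= Num.min e 1 * kappa.
  apply: le_trans AB _; rewrite mulrC ler_pdivrMr//.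
have me : Num.min e 1 <= e by rewrite ge_min lexx.
have m1 : Num.min e 1 <= 1 by rewrite ge_min lexx orbT.
have Bk : kappa <= normc B.
  have -> : B = A - (A - B) by ring.
  apply: le_trans (normc_le_sub _ _).
  have : Num.min e 1 * kappa <= kappa by rewrite ler_piMl// ltW.
  lra.
(* This is [p0 A = p1 B], the orthogonality identity for [mu1], after subtracting [p0 B]. *)
have E : (p1 n - p0 n).[z] * B = (p0 n).[z] * (A - B).
  by rewrite hornerD hornerN mulrBl mulrBr qAB.
rewrite -(ler_pM2r (lt_le_trans kappa0 Bk)) -normcM E normcM [e * _]mulrC -mulrA.
apply: ler_wpM2l; first exact: normc_ge0.
apply: le_trans AB _; apply: ler_pM => //; last exact: ltW.
by rewrite le_min (ltW e0) ler01.
Qed.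

Lemma ratio_close_Omega w : Omega w -> ratio_locally_close w.
Proof.
case: w => [a|] Ow e e0; last first.
  by apply: ratio_close_outside_hull e0 => -[z _].
apply: contrapT => H.
(* The indices beyond a rank that fail somewhere in a small disc. If the claim is false these sets
   are all nonempty, so they form a filter base. *)
pose F (x : nat * R) := [set n : nat | (x.1 <= n)%N /\ exists v, normc (v - a) < x.2 /\
  ~ (normc ((p1 n).[v] / (p0 n).[v] - 1) <= e)].
pose FF := filter_from [set x : nat * R | 0 < x.2] F.
have PF : ProperFilter FF.
  apply: filter_from_proper.
    apply: filter_from_filter; first by exists (0%N, 1); rewrite /= ltr01.
    move=> [N1 r1] [N2 r2] /= h1 h2; exists (maxn N1 N2, Num.min r1 r2).
      by rewrite /= lt_min h1.
    move=> n [/=]; rewrite geq_max => /andP[a1 a2] [v [va nv]].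
    move: va; rewrite lt_min => /andP[b1 b2].
    by split; split => //; exists v.
  move=> [N r] /= r0; apply: contrapT => Fe; apply: H; exists N.
  apply/nbhs_someP; exists r => // v va n Nn; apply: contrapT => nv.
  by apply: Fe; exists n; split => //; exists v.
(* Along [U] failures occur in arbitrarily small discs around [a], whereas [ultra_ratio] provides
   one disc without failure for [U]-many indices. *)
have [U [UU FU]] := ultraFilterLemma PF.
have Uoo (A : set nat) : (\forall n \near \oo, A n) -> U A.
  move=> [N _ NA]; apply: FU; exists (N, 1); first exact: ltr01.
  by move=> n [/= Nn _]; exact: NA.
have [r r0 Ur] := ultra_ratio UU Uoo Ow e0.
have Ubad : U (F (0%N, r)) by apply: FU; exists (0%N, r).
have [n [hn [_ [v [va nv]]]]] := filter_ex (filterI Ur Ubad).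
have [h1 h2] := hn v (ltW va); apply: nv.
have -> : (p1 n).[v] / (p0 n).[v] - 1 = (p1 n - p0 n).[v] / (p0 n).[v].
  by rewrite !hornerE mulrBl divff.
by rewrite normcM normcV ler_pdivrMr ?normc_gt0.
Qed.

(** * Ratio of the Christoffel functions *)

Lemma christoffel_ratioE n z :
  christoffel mu0 n z / christoffel mu1 n z = kernel_diag mu1 n z / kernel_diag mu0 n z.
Proof.
by rewrite (christoffelE carried0 posdef0) (christoffelE carried1 posdef1) invrK mulrC.
Qed.

(** Here the extremal polynomial of [mu0] competes for [mu1], where its norm can only be smaller. *)
Lemma christoffel_ratio_ge1 n z : 1 <= christoffel mu0 n z / christoffel mu1 n z.
Proof.
have k0 := kernel_diag_gt0 carried0 posdef0 n z.
have k1 := kernel_diag_gt0 carried1 posdef1 n z.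
rewrite christoffel_ratioE ler_pdivlMr// mul1r -lef_pV2 ?posrE//.
have [s e] := christoffel_poly_admissible carried0 posdef0 n z.
rewrite -(christoffelE carried1 posdef1).
apply: le_trans (christoffel_le carried1 posdef1 s e) _.
rewrite -(sqnorm_christoffel_poly_self carried0 posdef0).
by rewrite (sqnorm_split (ccont_horner _)) lerDl sqnorm_ge0.
Qed.

Lemma christoffel_ratio_le n z : christoffel mu0 n z / christoffel mu1 n z <=
  1 + sqnorm mu2 (horner (kernel mu1 n z)) / kernel_diag mu1 n z.
Proof.
have k1 := kernel_diag_gt0 carried1 posdef1 n z.
have [s e] := christoffel_poly_admissible carried1 posdef1 n z.
have := christoffel_le carried0 posdef0 s e.
rewrite (sqnorm_split (ccont_horner _)) (sqnorm_christoffel_poly_self carried1 posdef1).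
rewrite (sqnorm_christoffel_poly carried1 posdef1 n z carried20) => h.
rewrite (christoffelE carried1 posdef1) invrK -ler_pdivlMr//.
apply: le_trans h _; set x := sqnorm _ _; rewrite le_eqVlt; apply/orP; left.
by apply/eqP; field; rewrite gt_eqF.
Qed.

(** The triangle inequality bounds the norm of the kernel by the sum of the [|p_i(z)| eps_i], to
    which [sqr_sum_split] applies. *)
Lemma sqnorm2_kernel n z (N : nat) : (N <= n)%N ->
  sqnorm mu2 (horner (kernel mu1 n z)) <=
  2 * (kernel_diag mu1 N z * \sum_(0 <= i < N.+1) eps i ^+ 2) +
  2 * (kernel_diag mu1 n z * \sum_(N.+1 <= i < n.+1) eps i ^+ 2).
Proof.
move=> Nn; rewrite -sqr_L2norm.
pose u i := normc (p1 i).[z].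
have kE m : kernel_diag mu1 m z = \sum_(0 <= i < m.+1) u i ^+ 2.
  by rewrite big_mkord.
rewrite !kE; apply: le_trans (sqr_sum_split u eps (Nn : (N < n.+1)%N)).
have : L2norm mu2 (horner (kernel mu1 n z)) <= \sum_(0 <= i < n.+1) u i * eps i.
  rewrite big_mkord (_ : horner _ = fun t =>
    \sum_(i < n.+1) ((p1 i).[z])^*%C * (p1 i).[t]).
    apply: le_trans (L2norm_sum carried20 _ _ (fun i : 'I_n.+1 => ccont_horner (p1 i))) _.
    by apply: ler_sum => i _; rewrite normc_conj.
  by apply/funext => t; rewrite horner_sum; apply: eq_bigr => i _; rewrite hornerZ.
move=> h; rewrite ler_pXn2r// nnegrE; first exact: L2norm_ge0.
by apply: le_trans h; exact: L2norm_ge0.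
Qed.

Lemma christoffel_ratio_infty_cvg n : cvg (sphere_fun
  (fun z => christoffel mu0 n z / christoffel mu1 n z) v @[v --> (infty : sphere R)^']).
Proof.
rewrite (_ : (fun z => _) = fun z => kernel_diag mu1 n z / kernel_diag mu0 n z); last first.
  by apply/funext => z; exact: christoffel_ratioE.
apply: (cvg_ratio_infty (h := fun z => normc (z ^+ n) ^+ 2) _ _
  (@kernel_diag_infty _ _ _ carried1 posdef1 n) (@kernel_diag_infty _ _ _ carried0 posdef0 n)).
  rewrite gt_eqF// big_ord_recr /= ltr_wpDl//.
    by apply: sumr_ge0 => i _; exact: sqr_ge0.
  rewrite exprn_gt0// normc_gt0.
  have -> : (p0 n)`_n = gamma mu0 n by rewrite /gamma lead_coefE size0.
  by rewrite gt_eqF// (gamma_gt0 carried0 posdef0).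
by move=> z z0; rewrite expf_neq0// gt_eqF// normc_gt0 expf_neq0.
Qed.

Lemma christoffel_ratio_cvg :
  (\sum_(0 <= j <oo) (eps j ^+ 2)%:E < +oo)%E ->
  cvg_unif_compacts Omega
    (fun n => extend_infty
       (fun z => christoffel mu0 n z / christoffel mu1 n z)) (cst 1).
Proof.
move=> fin; have [[E E0 hE] tail] := series_tail (fun i => sqr_ge0 (eps i)) fin.
apply: uniform_of_local => w Ow e e0.
(* [sqnorm2_kernel] doubles both its terms, and [2 e / 8 + 2 e / 8 = e / 2]. *)
have e8 : 0 < e / 8 by rewrite divr_gt0.
have [N hN] := tail _ e8.
have E1 : 0 < E + 1 by rewrite ltr_wpDl.
(* The bound 1 gives [eta^2 <= eta], and then [eta^2 E <= eta (E + 1) <= e / 8]. *)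
pose eta := Num.min 1 (e / 8 / (E + 1)).
have eta0 : 0 < eta by rewrite lt_min ltr01 divr_gt0.
have eta2 : eta ^+ 2 * E <= e / 8.
  have h1 : eta <= 1 by rewrite ge_min lexx.
  have h2 : eta <= e / 8 / (E + 1) by rewrite ge_min lexx orbT.
  have h3 : eta * (E + 1) <= e / 8 by rewrite -ler_pdivlMr.
  have h4 : eta ^+ 2 <= eta by rewrite expr2 ler_piMl// ltW.
  have h5 : eta ^+ 2 * E <= eta * E by rewrite ler_wpM2r.
  by move: h3; rewrite mulrDr mulr1; lra.
have [m hm] := small_polynomial cS1 eta0 Ow.
(* The small polynomial costs [m] degrees: [K_N <= eta^2 K_(N + m) <= eta^2 K_n] on the diagonal. *)
exists (N + m)%N.
pose A := [set v : sphere R | forall z, v = in_sphere z ->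
    exists Q : {poly R[i]}, [/\ (size Q <= m.+1)%N, Q.[z] = 1 &
      forall t, S1 t -> normc Q.[t] <= eta]]^°.
have nA : \forall v \near w, A v by exact: nbhs_interior.
apply: filterS nA => v Av n Nmn.
have Nn : (N <= n)%N by apply: leq_trans Nmn; exact: leq_addr.
have close z : A (in_sphere z) ->
    `|christoffel mu0 n z / christoffel mu1 n z - 1| <= e / 2.
  move=> Az; have [Q [sQ Qz QS]] := interior_subset Az z erefl.
  have k1 := kernel_diag_gt0 carried1 posdef1 n z.
  rewrite ger0_norm ?subr_ge0 ?christoffel_ratio_ge1// lerBlDl.
  apply: le_trans (christoffel_ratio_le n z) _; rewrite lerD2l ler_pdivrMr//.
  apply: le_trans (sqnorm2_kernel z Nn) _.
  have g1 := kernel_diag_growth carried1 posdef1 N (ltW eta0) sQ Qz QS.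
  have g2 := kernel_diag_le mu1 z Nmn.
  have g3 : kernel_diag mu1 N z * \sum_(0 <= i < N.+1) eps i ^+ 2 <=
      e / 8 * kernel_diag mu1 n z.
    have kN := kernel_diag_gt0 carried1 posdef1 N z.
    apply: (@le_trans _ _ (eta ^+ 2 * kernel_diag mu1 n z * E)).
      apply: ler_pM; rewrite ?(ltW kN) ?hE//.
        by apply: sumr_ge0 => i _; exact: sqr_ge0.
      by apply: le_trans g1 _; rewrite ler_wpM2l// sqr_ge0.
    by rewrite mulrAC ler_wpM2r// ltW.
  have g4 : kernel_diag mu1 n z * \sum_(N.+1 <= i < n.+1) eps i ^+ 2 <=
      e / 8 * kernel_diag mu1 n z.
    rewrite mulrC ler_wpM2r ?(ltW k1)//; apply: le_trans (hN n.+1).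
    by rewrite [leRHS]big_ltn ?ltnS// lerDr sqr_ge0.
  by lra.
suff : `|extend_infty (fun z => christoffel mu0 n z / christoffel mu1 n z) v - 1| <= e / 2.
  by rewrite distrC => /le_lt_trans; apply; lra.
case: v Av => [z|] Av; first exact: close.
have cD : closed [set x : R^o | `|x - 1| <= e / 2].
  have -> : [set x : R^o | `|x - 1| <= e / 2] =
    (fun x : R^o => `|x - 1|) @^-1` [set y | y <= e / 2] by [].
  apply: closed_comp; last exact: closed_le.
  move=> x _; apply: (@continuous_comp _ _ _ (fun x : R^o => x - 1)).
    by apply: cvgB; [exact: cvg_id|exact: cvg_cst].
  exact: norm_continuous.
apply: (@extend_infty_closed _ _ _ [set x : R^o | `|x - 1| <= e / 2]
  (@christoffel_ratio_infty_cvg n) cD).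
have /nbhs_inftyP[_ [M MA]] : nbhs (infty : sphere R) A by exact: nbhs_interior.
by exists M => z /MA /close.
Qed.

End Perturbation.

Theorem theorem2p1 (R : realType)
    (mu0 mu1 mu2 : {finite_measure set (borelC R) -> \bar R}) :
  let S0 := measure_support mu0 in
  let S1 := measure_support mu1 in
  let Omega := unbounded_component S1 in
  let p0 := orthopoly mu0 in
  let p1 := orthopoly mu1 in
  compact S0 -> infinite_set S0 ->
  compact S1 -> infinite_set S1 ->
  (forall A, measurable A -> (mu1 A <= mu0 A)%E) ->
  (forall A, measurable A -> mu2 A = (mu0 A - mu1 A)%E) ->
  PS_perturbation mu0 mu1 mu2 ->
  [/\ (gamma mu1 n / gamma mu0 n : R[i]^o) @[n --> \oo] --> (1 : R[i]^o),
      L2norm mu0 (fun z => (p1 n).[z] - (p0 n).[z]) @[n --> \oo] --> (0 : R),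
      cvg_unif_compacts (~` (in_sphere @` convex_hull S0))
        (fun n => extend_infty (fun z => (p1 n).[z] / (p0 n).[z])) (cst 1)
      /\
      ((\forall n \near \oo, forall z : R[i],
          convex_hull S0 z -> Omega (in_sphere z) -> (p0 n).[z] != 0) ->
       cvg_unif_compacts Omega
         (fun n => extend_infty (fun z => (p1 n).[z] / (p0 n).[z])) (cst 1))
    & (\sum_(0 <= j <oo) (L2norm mu2 (horner (p1 j)) ^+ 2)%:E < +oo)%E ->
      cvg_unif_compacts Omega
        (fun n => extend_infty
           (fun z => christoffel mu0 n z / christoffel mu1 n z)) (cst 1)].
Proof.
move=> S0 S1 Omega p0 p1 cS0 iS0 cS1 iS1 _ _ [mu012 _ eps_cvg].
split.
- exact: gamma_ratio_cvg eps_cvg.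
- exact: orthopoly_diff_cvg eps_cvg.
- split.
    apply: ratio_cvg_unif => w hw.
    exact: (ratio_close_outside_hull cS0 iS0 cS1 iS1 mu012 eps_cvg hw).
  move=> p0_zeros; apply: ratio_cvg_unif => w Ow.
  exact: (ratio_close_Omega cS0 iS0 cS1 iS1 mu012 eps_cvg p0_zeros Ow).
- exact: christoffel_ratio_cvg.
Qed.
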